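(* Consider the problem $\min_xg(x)-h(x)+r(x)$ with possibly non-smooth non-convex $r$, assume $h$ is differentiable and has $(L,\nu)$-H\''older continuous gradient for some $\nu\in(0,1]$, and apply the stagewise algorithm to its DC reformulation with smoothing parameter $\mu$. Let $\tau\in\{1,\dots,K\}$ be the sampled index and $w_\tau=\mathrm{prox}_{\mu r}(x_\tau)$. Denote by $( * )$ the guarantee $$\mathbb{E}[\|x_\tau-w_\tau\|]\le O(\epsilon),\qquad\mathbb{E}\big[\mathrm{dist}\big(\nabla h(w_\tau),\nabla g(w_\tau)+\hat\partial r(w_\tau)\big)\big]\le O(\epsilon^\nu).\qquad( * )$$ (a) If (R1) and (S) hold, then using SPG with $\mu=\epsilon$, $\gamma_k=3Lk^{1/(1+2\nu)}$, $T_k=3Lk/\gamma_k+3$, the algorithm returns after $K=O(1/\epsilon^{1+2\nu})$ stages a solution $x_\tau$ satisfying $( * )$, and the total iteration complexity is $\sum_{k=1}^KT_k=O(1/\epsilon^{1+4\nu})$. (b) If (R2) and (S) hold, then using SPG with $\mu=\epsilon^2$, $\gamma_k=3Lk^{1/(1+\nu)}$, $T_k=3Lk/\gamma_k+3$, the algorithm returns after $K=O(1/\epsilon^{2(1+\nu)})$ stages a solution $x_\tau$ satisfying $( * )$, and the total iteration complexity is $\sum_{k=1}^KT_k=O(1/\epsilon^{2(1+2\nu)})$. (c) If $g=\frac1{n_1}\sum_{i=1}^{n_1}g_i$ and $h=\frac1{n_2}\sum_{j=1}^{n_2}h_j$ have a finite-sum form with each $g_i$ $L$-smooth, and (R1)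 holds, then using SVRG with $\mu=\epsilon$, $\gamma_k=ck^{1/(1+2\nu)}$, $T_k\ge\max(2,200L/\gamma_k)$, $S_k=\lceil\log_2(k)\rceil$, the algorithm returns after $K=O(1/\epsilon^{1+2\nu})$ stages a solution $x_\tau$ satisfying $( * )$, and the total gradient complexity is $\widetilde O(n/\epsilon^{1+2\nu})$. (d) If $g=\frac1{n_1}\sum_{i=1}^{n_1}g_i$ and $h=\frac1{n_2}\sum_{j=1}^{n_2}h_j$ have a finite-sum form with each $g_i$ $L$-smooth, and (R2) or (R3) holds, then using SVRG with $\mu=\epsilon^2$, $\gamma_k=ck^{1/(1+\nu)}$, $T_k\ge\max(2,200L/\gamma_k)$, $S_k=\lceil\log_2(k)\rceil$, the algorithm returns after $K=O(1/\epsilon^{2(1+\nu)})$ stages a solution $x_\tau$ satisfying $( * )$, and the total gradient complexity is $\widetilde O(n/\epsilon^{2(1+\nu)})$.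
   Context: Setting: $g,h:\mathbb{R}^d\to\mathbb{R}$ are lower-semicontinuous convex, $g$ is $L$-smooth (differentiable with $L$-Lipschitz gradient), $r$ is a proper lower-semicontinuous (possibly non-smooth and non-convex) function whose proximal mapping $\mathrm{prox}_{\mu r}(x)=\arg\min_y\{\frac1{2\mu}\|y-x\|^2+r(y)\}$ exists. Write $f=g-h$, $n=n_1+n_2$; $c>0$ is a constant. $(L,\nu)$-H\''older continuous gradient means $\|\nabla h(x)-\nabla h(y)\|\le L\|x-y\|^\nu$ for all $x,y$. $\mathrm{prox}_{\mu r}(x)$ may be set-valued; when used as a vector it denotes a fixed selection (the same wherever it appears). $\hat\partial r(\bar x)=\{v:\liminf_{x\to\bar x}\frac{r(x)-r(\bar x)-v^\top(x-\bar x)}{\|x-\bar x\|}\ge0\}$ is the Fr\'echet subdifferential; $\mathrm{dist}$ is the distance between sets. In (a),(b), $g=\mathbb{E}_\xi[g(\cdot;\xi)]$ and $h=\mathbb{E}_\varsigma[h(\cdot;\varsigma)]$ with unbiased stochastic gradients $\nabla g(x;\xi)$, $\partial h(x;\varsigma)$. DC reformulation: $r_\mu(x)=\min_y\{\frac1{2\mu}\|y-x\|^2+r(y)\}=\frac1{2\mu}\|x\|^2-R_\mu(x)$ with $R_\mu(x)=\max_y\{\frac1\mu y^\top x-\frac1{2\mu}\|y\|^2-r(y)\}$ convex and $\frac1\mu\mathrm{prox}_{\mu r}(x)\subseteq\partial R_\mu(x)$. The algorithm is applied to $F(x)=g(x)+\frac1{2\mu}\|x\|^2-(h(x)+R_\mu(x))=f(x)+r_\mu(x)$.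 Stagewise algorithm: from $x_1$, for $k=1,\dots,K$ obtain $x_{k+1}$ by running the subproblem solver, initialized at $x_k$, on $$F_k(x)=g(x)+\tfrac1{2\mu}\|x\|^2-\big(\nabla h(x_k)+\tfrac1\mu\mathrm{prox}_{\mu r}(x_k)\big)^\top(x-x_k)+\tfrac{\gamma_k}2\|x-x_k\|^2.$$ Return $x_\tau$ with $\tau$ sampled by $p(\tau=k)=k^\alpha/\sum_{j=1}^Kj^\alpha$, $\alpha\ge1$ fixed. SPG at stage $k$ ($T_k$ iterations, rounded up, $\eta_t=3/(\gamma_k(t+1))$): $y_1=x_k$; for $t=1,\dots,T_k$ with fresh independent samples, $$y_{t+1}=\arg\min_xx^\top\big(\nabla g(y_t;\xi_t)-\partial h(x_k;\varsigma_t)-\tfrac1\mu\mathrm{prox}_{\mu r}(x_k)\big)+\tfrac1{2\mu}\|x\|^2+\tfrac{\gamma_k}2\|x-x_k\|^2+\tfrac1{2\eta_t}\|x-y_t\|^2;$$ output $x_{k+1}=\sum_{t=2}^{T_k+1}ty_t/\sum_{t=2}^{T_k+1}t$. SVRG at stage $k$ (step size $\eta=0.05/L$): $\bar x^{(0)}=x_k$; for $s=1,\dots,S_k$ set $\bar g_s=\nabla g(\bar x^{(s-1)})-\nabla h(x_k)-\frac1\mu\mathrm{prox}_{\mu r}(x_k)$, $x_0^{(s)}=\bar x^{(s-1)}$; for $t=1,\dots,T_k$ pick $i_t\in\{1,\dots,n_1\}$ uniformly, $v_t=\nabla g_{i_t}(x^{(s)}_{t-1})-\nabla g_{i_t}(\bar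 x^{(s-1)})+\bar g_s$, $x^{(s)}_t=\arg\min_x\langle v_t,x-x^{(s)}_{t-1}\rangle+\frac1{2\eta}\|x-x^{(s)}_{t-1}\|^2+\frac1{2\mu}\|x\|^2+\frac{\gamma_k}2\|x-x_k\|^2$; $\bar x^{(s)}=\frac1{T_k}\sum_{t=1}^{T_k}x^{(s)}_t$. Output $x_{k+1}=\bar x^{(S_k)}$. The total gradient complexity is $\sum_{k=1}^K(n+T_k)S_k$, with $T_k$ taken of the order of its lower bound. Conditions. (S): $g$ is $L$-smooth and there is $G>0$ with $\mathbb{E}\|(\nabla g(x;\xi)-\partial h(x;\varsigma))-\mathbb{E}[\nabla g(x;\xi)-\partial h(x;\varsigma)]\|^2\le G^2$. (R1): $r$ is Lipschitz continuous. (R2): $r$ is lower bounded and finite-valued over $\mathbb{R}^d$. (R3): $f+r_\mu$ is level bounded for a small $\mu<1$, $r$ is finite-valued on a compact set, and $r$ is lower bounded over $\mathbb{R}^d$. Standing assumption: there is $\Delta>0$ (independent of $\epsilon$) with $\mathbb{E}[F(x_k)-\min_xF(x)]\le\Delta$ for all $k\in\{1,\dots,K\}$ when SPG is used, and $F(x_1)-\min_xF(x)\le\Delta$ when SVRG is used. ''After $K=O(q(\epsilon))$ stages'' means $K=\lceil Cq(\epsilon)\rceil$ for a constant $C$ independent of $\epsilon\in(0,1)$; all $O(\cdot)$ constants are independent of $\epsilon$; $\widetilde O$ hides logarithmic factors. *)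

(* Defs.v *)
From HB Require Import structures.
From mathcomp Require Import all_boot all_order all_algebra.
From mathcomp Require Import all_classical all_reals all_analysis.
Import Order.TTheory GRing.Theory Num.Theory.
Import numFieldNormedType.Exports.

Set Implicit Arguments.
Unset Strict Implicit.
Unset Printing Implicit Defensive.

Local Open Scope classical_set_scope.
Local Open Scope ring_scope.

Section euclidean.
Context {R : realType} {d : nat}.
Local Notation V := 'rV[R]_d.
Implicit Types (f : V -> R) (r : V -> \bar R) (x y v : V).

(* The library norm on row vectors is the sup norm, which induces the same
   topology (hence the same notions of openness, differentiability and
   boundedness) as the Euclidean norm [enorm]. *)
Definition dot x y : R := \sum_(i < d) x 0 i * y 0 i.
Definition enorm x : R := Num.sqrt (dot x x).

Definition grad f x : V := \row_i ('D_(delta_mx 0 i) f x).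

Definition smooth (L : R) f : Prop :=
  (forall x, differentiable (f : V -> R^o) x) /\
  forall x y, enorm (grad f x - grad f y) <= L * enorm (x - y).

Definition holder_grad (L nu : R) f : Prop :=
  (forall x, differentiable (f : V -> R^o) x) /\
  forall x y, enorm (grad f x - grad f y) <= L * enorm (x - y) `^ nu.

Definition proper_ereal r : Prop :=
  (forall x, (-oo < r x)%E) /\ exists x, (r x < +oo)%E.

Definition is_argmin f y : Prop := forall z, f y <= f z.

Definition prox_set r (mu : R) x : set V :=
  [set y | forall z, (((2 * mu)^-1 * enorm (y - x) ^+ 2)%:E + r y
                   <= ((2 * mu)^-1 * enorm (z - x) ^+ 2)%:E + r z)%E].

Definition moreau r (mu : R) x : \bar R :=
  ereal_inf (range (fun y => (((2 * mu)^-1 * enorm (y - x) ^+ 2)%:E + r y)%E)).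

Definition smoothed_objective (g h : V -> R) r (mu : R) x : \bar R :=
  ((g x - h x)%:E + moreau r mu x)%E.

Definition frechet_subdiff r x : set V :=
  [set v | r x \is a fin_num /\
    (0 <= limf_einf
       (fun y => (r y - r x - (dot v (y - x))%:E) * ((enorm (y - x))^-1)%:E)
       x^')%E].

(* Equal to +oo when one of the sets is empty. *)
Definition set_dist (A B : set V) : \bar R :=
  ereal_inf [set e | exists2 a, A a & exists2 b, B b & e = (enorm (a - b))%:E].

Definition reg_R1 r : Prop :=
  exists (r0 : V -> R) (M : R), (forall x, r x = (r0 x)%:E) /\
    forall x y, `|r0 x - r0 y| <= M * enorm (x - y).

Definition lower_bounded r : Prop := exists m : R, forall x, (m%:E <= r x)%E.

Definition reg_R2 r : Prop :=
  lower_bounded r /\ forall x, r x \is a fin_num.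

Definition reg_R3 (g h : V -> R) r : Prop :=
  [/\ exists mu : R, 0 < mu < 1 /\
        forall a : R, bounded_set [set x | (smoothed_objective g h r mu x <= a%:E)%E],
      exists A : set V, [/\ A !=set0, compact A & forall x, A x -> r x \is a fin_num]
    & lower_bounded r].

(* [p mu] is the selection of the (possibly set-valued) map prox_{mu r}. *)
Record dc_problem (L nu : R) (g h : V -> R) r (p : R -> V -> V) : Prop := {
  dc_L_gt0 : 0 < L;
  dc_nu : 0 < nu <= 1;
  dc_g_lsc : lower_semicontinuous (fun x => (g x)%:E);
  dc_g_convex : convex_function [set: V] g;
  dc_g_smooth : smooth L g;
  dc_h_lsc : lower_semicontinuous (fun x => (h x)%:E);
  dc_h_convex : convex_function [set: V] h;
  dc_h_holder : holder_grad L nu h;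
  dc_r_proper : proper_ereal r;
  dc_r_lsc : lower_semicontinuous r;
  dc_prox : forall (mu : R) (x : V), 0 < mu -> prox_set r mu x (p mu x)
}.

Definition is_mean (n : nat) (fs : 'I_n -> V -> R) f : Prop :=
  (0 < n)%N /\ forall x, f x = n%:R^-1 * \sum_(i < n) fs i x.

End euclidean.

(* R^d with its Borel sigma-algebra. *)
Notation borelV R d := (g_sigma_algebraType (@open 'rV[R]_d)).

Definition ceiln {R : realType} (a : R) : nat := `|Num.ceil a|%N.

Definition vecE {R : realType} {d : nat} {dO : measure_display}
    {Om : measurableType dO} (mu : {measure set Om -> \bar R})
    (X : Om -> 'rV[R]_d) : 'rV[R]_d :=
  \row_i Rintegral mu setT (fun w => X w 0 i).

Section probability.
Local Open Scope ereal_scope.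
Context {R : realType} {dO : measure_display} {Om : measurableType dO}
  (P : probability Om R).

Definition sigma_of {dT : measure_display} {T : measurableType dT}
  (X : Om -> T) : set (set Om) := preimage_set_system setT X measurable.

(* Mutual independence of the sigma-algebras [E i], where [i] ranges over [D]. *)
Definition mutually_independent (I : eqType) (D : pred I)
    (E : I -> set (set Om)) : Prop :=
  forall s : seq I, uniq s -> all D s ->
  forall A : I -> set Om, (forall i, i \in s -> E i (A i)) ->
  P (\bigcap_(i in [set` s]) A i) = \prod_(i <- s) P (A i).

Definition has_law {dT : measure_display} {T : measurableType dT}
    (X : Om -> T) (Q : probability T R) : Prop :=
  measurable_fun setT X /\ forall A, measurable A -> P (X @^-1` A) = Q A.

Definition index_law (alpha : R) (K : nat) (tau : Om -> nat) : Prop :=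
  [/\ measurable_fun setT tau,
      forall w, (1 <= tau w <= K)%N
    & forall k, (1 <= k <= K)%N ->
      P (tau @^-1` [set k]) =
        (k%:R `^ alpha / \sum_(1 <= j < K.+1) j%:R `^ alpha)%R%:E].

End probability.

Section oracles.
Context {R : realType} {d : nat}.
Local Notation V := 'rV[R]_d.
Context {d1 d2 : measure_display} {T1 : measurableType d1} {T2 : measurableType d2}
  (P1 : probability T1 R) (P2 : probability T2 R).

(* [gs x xi] = g(x; xi), [hs x zeta] = h(x; zeta), [dg x xi] = grad g(x; xi),
   and [dh x zeta] is the stochastic subgradient of h(.; zeta) at x. *)
Record stochastic_oracles (g h : V -> R) (gs : V -> T1 -> R) (hs : V -> T2 -> R)
    (dg : V -> T1 -> V) (dh : V -> T2 -> V) : Prop := {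
  so_gs_int : forall x, P1.-integrable setT (EFin \o gs x);
  so_gs_mean : forall x, g x = Rintegral P1 setT (gs x);
  so_hs_int : forall x, P2.-integrable setT (EFin \o hs x);
  so_hs_mean : forall x, h x = Rintegral P2 setT (hs x);
  so_dg_grad : forall x : V, {ae P1, forall xi,
    differentiable (gs ^~ xi : V -> R^o) x /\ dg x xi = grad (gs ^~ xi) x};
  so_dh_subgrad : forall x, {ae P2, forall zeta,
    frechet_subdiff (fun y => (hs y zeta)%:E) x (dh x zeta)};
  so_dg_meas : measurable_fun setT
    (fun z : borelV R d * T1 => dg z.1 z.2 : borelV R d);
  so_dh_meas : measurable_fun setT
    (fun z : borelV R d * T2 => dh z.1 z.2 : borelV R d);
  so_dg_int : forall x i, P1.-integrable setT (fun xi => (dg x xi 0 i)%:E);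
  so_dh_int : forall x i, P2.-integrable setT (fun zeta => (dh x zeta 0 i)%:E);
  so_dg_unbiased : forall x, vecE P1 (dg x) = grad g x;
  so_dh_unbiased : forall x, vecE P2 (dh x) = grad h x
}.

(* The product measure expresses that xi and zeta are independent. *)
Definition variance_bound (dg : V -> T1 -> V) (dh : V -> T2 -> V) (G : R) : Prop :=
  forall x, (\int[(P1 \x P2)%E]_z
    (enorm ((dg x z.1 - dh x z.2)
       - vecE (P1 \x P2)%E (fun z => dg x z.1 - dh x z.2)) ^+ 2)%:E
    <= (G ^+ 2)%:E)%E.

End oracles.

Section algorithms.
Context {R : realType} {d : nat}.
Local Notation V := 'rV[R]_d.

(* [x k] is the k-th stage point, [y k t] the t-th inner iterate of stage k,
   [prox] the selection of prox_{mu r}. *)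
Record spg_path {S1 S2 : Type} (dg : V -> S1 -> V) (dh : V -> S2 -> V)
    (prox : V -> V) (mu : R) (gamma : nat -> R) (T : nat -> nat) (K : nat) (x1 : V)
    (xi : nat -> nat -> S1) (zeta : nat -> nat -> S2)
    (x : nat -> V) (y : nat -> nat -> V) : Prop := {
  spg_init : x 1%N = x1;
  spg_stage_init : forall k, (1 <= k <= K)%N -> y k 1%N = x k;
  spg_step : forall k t, (1 <= k <= K)%N -> (1 <= t <= T k)%N ->
    let eta := 3 / (gamma k * t.+1%:R) in
    is_argmin (fun z : V =>
      dot z (dg (y k t) (xi k t) - dh (x k) (zeta k t) - mu^-1 *: prox (x k))
      + (2 * mu)^-1 * enorm z ^+ 2
      + gamma k / 2 * enorm (z - x k) ^+ 2
      + (2 * eta)^-1 * enorm (z - y k t) ^+ 2) (y k t.+1);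
  spg_output : forall k, (1 <= k <= K)%N ->
    x k.+1 = (\sum_(2 <= t < (T k).+2) t%:R)^-1 *:
             \sum_(2 <= t < (T k).+2) t%:R *: y k t
}.

(* [xb k s] is the snapshot bar-x^(s) and [xs k s t] the iterate x_t^(s) of
   stage k. *)
Record svrg_path (n1 : nat) (L : R) (gi : 'I_n1 -> V -> R) (g h : V -> R)
    (prox : V -> V) (mu : R) (gamma : nat -> R) (T S : nat -> nat) (K : nat) (x1 : V)
    (i : nat -> nat -> nat -> 'I_n1)
    (x : nat -> V) (xb : nat -> nat -> V) (xs : nat -> nat -> nat -> V) : Prop := {
  svrg_init : x 1%N = x1;
  svrg_stage_init : forall k, (1 <= k <= K)%N -> xb k 0%N = x k;
  svrg_epoch_init : forall k s, (1 <= k <= K)%N -> (1 <= s <= S k)%N ->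
    xs k s 0%N = xb k s.-1;
  svrg_step : forall k s t, (1 <= k <= K)%N -> (1 <= s <= S k)%N ->
    (1 <= t <= T k)%N ->
    let eta := 5%:R / 100%:R / L in
    let gbar := grad g (xb k s.-1) - grad h (x k) - mu^-1 *: prox (x k) in
    let v := grad (gi (i k s t)) (xs k s t.-1) - grad (gi (i k s t)) (xb k s.-1)
             + gbar in
    is_argmin (fun z : V =>
      dot v (z - xs k s t.-1)
      + (2 * eta)^-1 * enorm (z - xs k s t.-1) ^+ 2
      + (2 * mu)^-1 * enorm z ^+ 2
      + gamma k / 2 * enorm (z - x k) ^+ 2) (xs k s t);
  svrg_epoch_output : forall k s, (1 <= k <= K)%N -> (1 <= s <= S k)%N ->
    xb k s = (T k)%:R^-1 *: \sum_(1 <= t < (T k).+1) xs k s t;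
  svrg_output : forall k, (1 <= k <= K)%N -> x k.+1 = xb k (S k)
}.

Context {dO : measure_display} {Om : measurableType dO} (P : probability Om R).

Section spg.
Context {d1 d2 : measure_display} {T1 : measurableType d1} {T2 : measurableType d2}
  (P1 : probability T1 R) (P2 : probability T2 R).

Definition spg_sigma (xi : nat -> nat -> Om -> T1) (zeta : nat -> nat -> Om -> T2)
    (tau : Om -> nat) (j : (nat * nat) + (nat * nat) + unit) : set (set Om) :=
  match j with
  | inl (inl (k, t)) => sigma_of (xi k t)
  | inl (inr (k, t)) => sigma_of (zeta k t)
  | inr _ => sigma_of tau
  end.

Definition spg_index (T : nat -> nat) (K : nat)
    (j : (nat * nat) + (nat * nat) + unit) : bool :=
  match j with
  | inl (inl (k, t)) | inl (inr (k, t)) => (1 <= k <= K)%N && (1 <= t <= T k)%N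
  | inr _ => true
  end.

Record spg_run (dg : V -> T1 -> V) (dh : V -> T2 -> V) (prox : V -> V)
    (mu alpha : R) (gamma : nat -> R) (T : nat -> nat) (K : nat) (x1 : V)
    (xi : nat -> nat -> Om -> T1) (zeta : nat -> nat -> Om -> T2)
    (tau : Om -> nat) (x : nat -> Om -> V) (y : nat -> nat -> Om -> V) : Prop := {
  spg_xi_law : forall k t, (1 <= k <= K)%N -> (1 <= t <= T k)%N ->
    has_law P (xi k t) P1;
  spg_zeta_law : forall k t, (1 <= k <= K)%N -> (1 <= t <= T k)%N ->
    has_law P (zeta k t) P2;
  spg_tau_law : index_law P alpha K tau;
  spg_indep : mutually_independent P (spg_index T K) (spg_sigma xi zeta tau);
  spg_traj : forall w, spg_path dg dh prox mu gamma T K x1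
    (fun k t => xi k t w) (fun k t => zeta k t w)
    (fun k => x k w) (fun k t => y k t w)
}.
End spg.

Section svrg.
Context {n1 : nat}.

(* The sigma-algebra of an 'I_n1-valued variable is that of its nat value. *)
Definition svrg_sigma (i : nat -> nat -> nat -> Om -> 'I_n1) (tau : Om -> nat)
    (j : (nat * nat * nat) + unit) : set (set Om) :=
  match j with
  | inl (k, s, t) => sigma_of (fun w => i k s t w : nat)
  | inr _ => sigma_of tau
  end.

Definition svrg_index (T S : nat -> nat) (K : nat)
    (j : (nat * nat * nat) + unit) : bool :=
  match j with
  | inl (k, s, t) =>
      [&& (1 <= k <= K)%N, (1 <= s <= S k)%N & (1 <= t <= T k)%N]
  | inr _ => true
  end.

Record svrg_run (L : R) (gi : 'I_n1 -> V -> R) (g h : V -> R) (prox : V -> V)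
    (mu alpha : R) (gamma : nat -> R) (T S : nat -> nat) (K : nat) (x1 : V)
    (i : nat -> nat -> nat -> Om -> 'I_n1) (tau : Om -> nat)
    (x : nat -> Om -> V) (xb : nat -> nat -> Om -> V)
    (xs : nat -> nat -> nat -> Om -> V) : Prop := {
  svrg_i_meas : forall k s t, svrg_index T S K (inl (k, s, t)) ->
    measurable_fun setT (fun w => i k s t w : nat);
  svrg_i_unif : forall k s t, svrg_index T S K (inl (k, s, t)) ->
    forall j, P (i k s t @^-1` [set j]) = (n1%:R^-1)%:E;
  svrg_tau_law : index_law P alpha K tau;
  svrg_indep : mutually_independent P (svrg_index T S K) (svrg_sigma i tau);
  svrg_traj : forall w, svrg_path L gi g h prox mu gamma T S K x1
    (fun k s t => i k s t w) (fun k => x k w) (fun k s => xb k s w)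
    (fun k s t => xs k s t w)
}.
End svrg.

(* Since dist is the distance to a possibly empty set, both expectations are
   taken in the extended reals. *)
Definition near_stationary (g h : V -> R) (r : V -> \bar R) (prox : V -> V)
    (nu eps M : R) (tau : Om -> nat) (x : nat -> Om -> V) : Prop :=
  let w om := prox (x (tau om) om) in
  ((\int[P]_om (enorm (x (tau om) om - w om)%R)%:E <= (M * eps)%R%:E) /\
   (\int[P]_om
      set_dist [set grad h (w om)]
               [set (grad g (w om) + v)%R | v in frechet_subdiff r (w om)]
    <= (M * eps `^ nu)%R%:E))%E.

End algorithms.

(* Main.v *)
(* Idea. Write F = f + r_mu, F_k for the stage objective, z_k for its minimizer,
   A_k = F_k(x_k) - F_k(z_k) and Phi_k = F_k(x_{k+1}) - F_k(z_k). Linearizing the concave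
   part gives A_k <= F(x_k) - F(x_{k+1}) + Phi_k, and both inner solvers achieve
   E Phi_k <= E A_k / 2 + B / k. Telescoping with the weights k^alpha bounds E A_tau by a
   multiple of 1/K, while strong convexity gives (gamma_k + 1/mu) |x_k - z_k|^2 <= 2 A_k.
   With w = prox(x_k), the residual (x_k - w) / mu is a Frechet subgradient of r at w, and
   optimality of z_k expresses it through x_k - z_k, so the distance to stationarity is at most
   L |x_k - w|^nu + L |x_k - w| + (L + gamma_k + 1/mu) |x_k - z_k|.
   If r is M-Lipschitz then |x_k - w| <= 2 M mu. If mu = eps^2, then |x_k - w| is at most
   mu |grad f(x_k)| up to a multiple of |x_k - z_k|, where
   |grad f(x_k)| <= |grad f(x_1)| + L + 2 L |x_k - x_1| and E |x_k - x_1| = O(1/eps), by summing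
   the bounds on |x_{j+1} - x_j| with the weights sqrt j. *)

Require Import Defs.
From HB Require Import structures.
From mathcomp Require Import all_boot all_order all_algebra.
From mathcomp Require Import all_classical all_reals all_analysis.
From mathcomp Require Import measurable_realfun ring lra zify.
Import Order.TTheory GRing.Theory Num.Theory.
Import numFieldNormedType.Exports.

Set Implicit Arguments.
Unset Strict Implicit.
Unset Printing Implicit Defensive.

Local Open Scope classical_set_scope.
Local Open Scope ring_scope.

(** * Euclidean norm *)

Lemma le_of_eq {disp : Order.disp_t} {T : porderType disp} (x y : T) : x = y -> (x <= y)%O.
Proof. by move=> ->. Qed.

Section Euclidean.
Context {R : realType} {d : nat}.
Local Notation V := 'rV[R]_d.
Implicit Types (x y z u v : V) (a b : R).

Lemma dotC x y : dot x y = dot y x.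
Proof. by rewrite /dot; apply: eq_bigr => i _; rewrite mulrC. Qed.

Lemma dotDl x y z : dot (x + y) z = dot x z + dot y z.
Proof. by rewrite /dot -big_split; apply: eq_bigr => i _; rewrite !mxE mulrDl. Qed.

Lemma dotZl a x y : dot (a *: x) y = a * dot x y.
Proof. by rewrite /dot mulr_sumr; apply: eq_bigr => i _; rewrite !mxE mulrA. Qed.

Lemma dotDr x y z : dot x (y + z) = dot x y + dot x z.
Proof. by rewrite dotC dotDl (dotC y) (dotC z). Qed.

Lemma dotZr a x y : dot x (a *: y) = a * dot x y.
Proof. by rewrite dotC dotZl dotC. Qed.

Lemma dotNl x y : dot (- x) y = - dot x y.
Proof. by rewrite -scaleN1r dotZl mulN1r. Qed.

Lemma dotNr x y : dot x (- y) = - dot x y.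
Proof. by rewrite dotC dotNl dotC. Qed.

Lemma dot0l y : dot 0 y = 0.
Proof. by rewrite -(scale0r y) dotZl mul0r. Qed.

Lemma dot0r y : dot y 0 = 0.
Proof. by rewrite dotC dot0l. Qed.

Lemma dot_ge0 x : 0 <= dot x x.
Proof. by apply: sumr_ge0 => i _; rewrite -expr2 sqr_ge0. Qed.

Lemma dot_eq0 x : dot x x = 0 -> x = 0.
Proof.
move=> /eqP; rewrite psumr_eq0; last by move=> i _; rewrite -expr2 sqr_ge0.
move=> /allP h; apply/rowP => i; rewrite mxE; apply/eqP.
by have := h i (mem_index_enum _); rewrite /= mulf_eq0 orbb.
Qed.

Lemma enorm_ge0 x : 0 <= enorm x.
Proof. exact: sqrtr_ge0. Qed.

Lemma enorm_sq x : enorm x ^+ 2 = dot x x.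
Proof. by rewrite sqr_sqrtr ?dot_ge0. Qed.

End Euclidean.

Ltac dot_expand :=
  rewrite ?enorm_sq ?(dotDl, dotDr, dotNl, dotNr, dotZl, dotZr, dot0l, dot0r);
  repeat match goal with |- context [dot ?x ?y] =>
    match goal with |- context [dot y x] =>
      first [constr_eq x y; fail 1 | rewrite (dotC y x)] end end.

Section EuclideanNorm.
Context {R : realType} {d : nat}.
Local Notation V := 'rV[R]_d.
Implicit Types (x y z u v : V) (a b : R).

Lemma dot_sumr (I : Type) (s : seq I) (X : I -> V) x :
  dot x (\sum_(i <- s) X i) = \sum_(i <- s) dot x (X i).
Proof.
by elim/big_rec2: _ => [|i ? ? _ <-]; [exact: dot0r|rewrite dotDr].
Qed.

Lemma enorm0 : enorm (0 : V) = 0.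
Proof. by rewrite /enorm dot0l sqrtr0. Qed.

Lemma enorm_eq0 x : enorm x = 0 -> x = 0.
Proof. by move=> h; apply: dot_eq0; rewrite -enorm_sq h expr0n. Qed.

Lemma enormN x : enorm (- x) = enorm x.
Proof. by rewrite /enorm dotNl dotNr opprK. Qed.

Lemma enormB x y : enorm (x - y) = enorm (y - x).
Proof. by rewrite -enormN opprB. Qed.

Lemma enormZ a x : enorm (a *: x) = `|a| * enorm x.
Proof.
by rewrite /enorm dotZl dotZr mulrA -expr2 sqrtrM ?sqr_ge0// sqrtr_sqr.
Qed.

Lemma dot_le_enorm x y : dot x y <= enorm x * enorm y.
Proof.
have [nx0|nx0] := eqVneq (enorm x) 0.
  by rewrite (enorm_eq0 nx0) dot0l enorm0 mul0r.
have [ny0|ny0] := eqVneq (enorm y) 0.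
  by rewrite (enorm_eq0 ny0) dot0r enorm0 mulr0.
have px : 0 < enorm x by rewrite lt0r nx0 enorm_ge0.
have py : 0 < enorm y by rewrite lt0r ny0 enorm_ge0.
have := dot_ge0 (enorm y *: x - enorm x *: y).
have -> : dot (enorm y *: x - enorm x *: y) (enorm y *: x - enorm x *: y) =
   2 * (enorm x * enorm y) * (enorm x * enorm y - dot x y).
  transitivity (enorm y ^+ 2 * dot x x + enorm x ^+ 2 * dot y y
                - 2 * (enorm x * enorm y) * dot x y).
    by rewrite !(dotDl, dotDr, dotNl, dotNr, dotZl, dotZr) (dotC y x); ring.
  by rewrite -!enorm_sq; ring.
by rewrite pmulr_rge0 ?subr_ge0 // !mulr_gt0.
Qed.

Lemma enormD x y : enorm (x + y) <= enorm x + enorm y.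
Proof.
rewrite -(@ler_pXn2r _ 2) ?nnegrE ?addr_ge0 ?enorm_ge0 //.
have h := dot_le_enorm x y.
have -> : enorm (x + y) ^+ 2 = enorm x ^+ 2 + enorm y ^+ 2 + 2 * dot x y.
  by dot_expand; ring.
by nra.
Qed.

Lemma enorm_triangle z x y : enorm (x - y) <= enorm (x - z) + enorm (z - y).
Proof. by rewrite (_ : x - y = (x - z) + (z - y)) ?enormD// addrA subrK. Qed.

Lemma dot_young a x y : 0 < a -> dot x y <= a / 2 * enorm x ^+ 2 + (2 * a)^-1 * enorm y ^+ 2.
Proof.
move=> a0; have := dot_ge0 (a *: x - y).
have -> : dot (a *: x - y) (a *: x - y) =
   (2 * a) * (a / 2 * enorm x ^+ 2 + (2 * a)^-1 * enorm y ^+ 2 - dot x y).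
  by dot_expand; field; rewrite gt_eqF.
by rewrite pmulr_rge0 ?subr_ge0 ?mulr_gt0.
Qed.

Lemma enorm_sq_le2 x y : enorm (x + y) ^+ 2 <= 2 * enorm x ^+ 2 + 2 * enorm y ^+ 2.
Proof.
have := dot_ge0 (x - y).
suff -> : dot (x - y) (x - y) = 2 * enorm x ^+ 2 + 2 * enorm y ^+ 2 - enorm (x + y) ^+ 2.
  by rewrite subr_ge0.
by dot_expand; ring.
Qed.

Lemma coord_le_enorm x i : `|x 0 i| <= enorm x.
Proof.
rewrite -sqrtr_sqr ler_sqrt ?dot_ge0// /dot (bigD1 i)//= expr2 lerDl.
by apply: sumr_ge0 => j _; rewrite -expr2 sqr_ge0.
Qed.

Lemma mx_norm_le_enorm x : `|x| <= enorm x.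
Proof.
rewrite [leLHS]/Num.norm /= mx_normrE; apply: bigmax_le; first exact: enorm_ge0.
by move=> [i j] _ /=; rewrite ord1; exact: coord_le_enorm.
Qed.

Lemma coord_le_mx_norm x i : `|x 0 i| <= `|x|.
Proof.
rewrite [leRHS]/Num.norm /= mx_normrE.
by apply: (@le_bigmax _ _ _ _ (fun ij => `|x ij.1 ij.2|) (0, i)).
Qed.

Lemma enorm_le_mx_norm x : enorm x <= d%:R * `|x|.
Proof.
rewrite -(@ler_pXn2r _ 2) ?nnegrE ?enorm_ge0 ?mulr_ge0 //.
rewrite enorm_sq exprMn /dot.
have -> : (d%:R ^+ 2 : R) * `|x| ^+ 2 = d%:R * \sum_(i < d) `|x| ^+ 2.
  by rewrite sumr_const card_ord -mulr_natl; ring.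
case: (posnP d) => [d0|d0].
  by rewrite big1 ?mulr_ge0 ?ler0n ?exprn_ge0 ?sumr_ge0//; case: (d) d0 x => [|//] _ x [].
rewrite -[leLHS]mul1r ler_pM ?ler1n//.
  by apply: sumr_ge0 => i _; rewrite -expr2 sqr_ge0.
apply: ler_sum => i _; rewrite -expr2 -real_normK ?num_real//.
by rewrite lerXn2r ?nnegrE// coord_le_mx_norm.
Qed.

Lemma row_sum_delta x : x = \sum_(i < d) x 0 i *: delta_mx 0 i.
Proof. exact: row_sum_delta. Qed.

End EuclideanNorm.

(** * Convex and smooth functions *)

Section ConvexAnalysis.
Context {R : realType} {d : nat}.
Local Notation V := 'rV[R]_d.
Implicit Types (f g : V -> R) (x y z u v : V) (a b : R).

Lemma derive_dot_grad f x v : differentiable (f : V -> R^o) x ->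
  'D_v (f : V -> R^o) x = dot (grad f x) v.
Proof.
move=> df; rewrite deriveE// {1}(row_sum_delta v) linear_sum /dot.
by apply: eq_bigr => i _; rewrite linearZ/= mxE deriveE// mulrC.
Qed.

Lemma is_derive_line f x v (s : R) : differentiable (f : V -> R^o) (x + s *: v) ->
  is_derive s 1 (fun t : R => f (x + t *: v) : R^o) (dot (grad f (x + s *: v)) v).
Proof.
move=> df; have E : (fun h : R => h^-1 *: ((f (x + (h *: (1 : R) + s) *: v) : R^o) - f (x + s *: v)))
  = (fun h : R => h^-1 *: ((f (h *: v + (x + s *: v)) : R^o) - f (x + s *: v))).
  by apply/funext => h; rewrite [h *: 1]mulr1 scalerDl addrCA.
apply: DeriveDef.
  by have := @diff_derivable _ _ _ _ _ v df; rewrite /derivable E.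
by rewrite -derive_dot_grad// /derive E.
Qed.

Lemma convex_grad_le f x y : convex_function [set: V] f ->
  differentiable (f : V -> R^o) x -> f x + dot (grad f x) (y - x) <= f y.
Proof.
move=> cf df; rewrite addrC -lerBrDr -derive_dot_grad//.
have /cvgrPdist_lt dfl := @diff_derivable _ _ _ _ _ (y - x) df.
apply/ler_addgt0Pr => e e0.
have [/= r r0 hr] := (nbhs_ballP _ _).1 (dfl e e0).
pose t := Num.min (r / 2) 1.
have t0 : 0 < t by rewrite lt_min ltr01 divr_gt0.
have t1 : t <= 1 by rewrite ge_min lexx orbT.
have tr2 : t <= r / 2 by rewrite ge_min lexx.
have tr : ball (0 : R) r t.
  by rewrite -ball_normE /= sub0r normrN gtr0_norm//; move: (r0 : 0 < r); lra.
have := hr t tr (lt0r_neq0 t0).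
have := cf (Itv01 (ltW t0) t1) y x (in_setT _) (in_setT _).
rewrite convRE /conv/= /unstable.onem.
have -> : t *: y + (1 - t) *: x = t *: (y - x) + x.
  by rewrite scalerBr scalerBl scale1r -addrA; congr (_ + _); rewrite addrC.
set q := f (_ + x); move=> cfq; rewrite ltr_distl => /andP[_].
have {}cfq : q - f x <= t * (f y - f x).
  by move: cfq; lra.
have : t^-1 *: ((q : R^o) - f x) <= f y - f x.
  by rewrite {1}/GRing.scale/= ler_pdivrMl.
rewrite /derive; set D := lim _; set Q := _ *: _ => hQ hD.
by apply: (le_trans (ltW hD)); rewrite lerD2r.
Qed.

Lemma grad_monotone f x y : convex_function [set: V] f ->
  (forall z, differentiable (f : V -> R^o) z) ->
  0 <= dot (grad f x - grad f y) (x - y).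
Proof.
move=> cf df; have := convex_grad_le x cf (df y); have := convex_grad_le y cf (df x).
by rewrite -(opprB x y) dotNr dotDl dotNl; lra.
Qed.

Lemma smooth_descent L f x y : smooth L f ->
  f y <= f x + dot (grad f x) (y - x) + L / 2 * enorm (y - x) ^+ 2.
Proof.
move=> [df lf]; set v := y - x.
pose c := dot (grad f x) v; pose n := enorm v ^+ 2.
pose psi (s : R) : R^o := f (x + s *: v) - (s * c + L / 2 * n * s ^+ 2).
pose dpsi (s : R) := dot (grad f (x + s *: v)) v - (c + L * n * s).
have dpsiP s : is_derive (s : R^o) 1 (psi : R^o -> R^o) (dpsi s).
  have h1 := is_derive_line (df (x + s *: v)).
  have h2 : is_derive (s : R^o) 1 (fun t : R => t * c + L / 2 * n * t ^+ 2 : R^o) (c + L * n * s).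
    apply: is_derive_eq; rewrite /GRing.scale /=.
    by field.
  exact: is_deriveB.
have [c' c'01] : exists2 c', c' \in `]0, 1[%R & psi 1 - psi 0 = dpsi c' * (1 - 0).
  apply: MVT => //.
  exact: (@derivable_within_continuous _ _ (psi : R -> R^o) `[0, 1]%R (fun s _ => @ex_derive _ _ _ _ _ _ _ (dpsiP s))).
rewrite subr0 mulr1 /psi /dpsi => E.
have {E} : f (x + v) - (c + L / 2 * n) - f x = dot (grad f (x + c' *: v)) v - (c + L * n * c') :> R.
  rewrite -E scale1r scale0r addr0.
 by field.
have -> : f (x + v) = f y by rewrite /v addrC subrK.
have : dot (grad f (x + c' *: v) - grad f x) v <= L * n * c'.
  apply: le_trans (dot_le_enorm _ _) _.
  move: c'01; rewrite in_itv/= => /andP[c0 c1].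
  have := lf (x + c' *: v) x; rewrite (addrC x) addrK enormZ gtr0_norm// => h.
  have -> : L * n * c' = L * (c' * enorm v) * enorm v by rewrite /n; ring.
  by rewrite ler_wpM2r ?enorm_ge0.
by rewrite dotDl dotNl -/c -/n; lra.
Qed.

End ConvexAnalysis.

(** * Regularized subproblem *)

Section Subproblem.
Context {R : realType} {d : nat}.
Local Notation V := 'rV[R]_d.
Implicit Types (f g : V -> R) (b x y z u v w : V) (a mu gam eta L : R).

Lemma argmin_grad_eq0 f z u a : 0 < a ->
  (forall w, f (z + w) <= f z + dot u w + a / 2 * enorm w ^+ 2) ->
  is_argmin f z -> u = 0.
Proof.
move=> a0 fle fmin; apply: dot_eq0; apply/eqP; rewrite eq_le dot_ge0 andbT.
have := le_trans (fmin _) (fle (- a^-1 *: u)).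
rewrite -addrA lerDl enorm_sq !(dotZr, dotZl).
have -> : - a^-1 * dot u u + a / 2 * (- a^-1 * (- a^-1 * dot u u)) = - (2 * a)^-1 * dot u u.
  by field; rewrite gt_eqF.
by rewrite mulNr oppr_ge0 pmulr_rle0// invr_gt0 mulr_gt0.
Qed.

Definition stage_obj g mu gam b x z : R :=
  g z + (2 * mu)^-1 * enorm z ^+ 2 - dot b z + gam / 2 * enorm (z - x) ^+ 2.

Definition stage_grad g mu gam b x z : V :=
  grad g z + (mu^-1 *: z - b + gam *: (z - x)).

Lemma stage_obj_quad g mu gam b x y z : mu != 0 ->
  stage_obj g mu gam b x z - stage_obj g mu gam b x y =
  g z - g y + dot (mu^-1 *: y - b + gam *: (y - x)) (z - y)
  + (gam + mu^-1) / 2 * enorm (z - y) ^+ 2.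
Proof. by move=> mu0; rewrite /stage_obj; dot_expand; field. Qed.

Lemma stage_obj_ge g mu gam b x y z : mu != 0 ->
  convex_function [set: V] g -> differentiable (g : V -> R^o) y ->
  stage_obj g mu gam b x y + dot (stage_grad g mu gam b x y) (z - y)
    + (gam + mu^-1) / 2 * enorm (z - y) ^+ 2 <= stage_obj g mu gam b x z.
Proof.
move=> mu0 cg dg; have := stage_obj_quad g gam b x y z mu0.
have := convex_grad_le z cg dg.
by rewrite /stage_grad dotDl; lra.
Qed.

Lemma stage_obj_le g L mu gam b x y z : mu != 0 -> smooth L g ->
  stage_obj g mu gam b x z <=
  stage_obj g mu gam b x y + dot (stage_grad g mu gam b x y) (z - y)
    + (L + gam + mu^-1) / 2 * enorm (z - y) ^+ 2.
Proof.
move=> mu0 sg; have := stage_obj_quad g gam b x y z mu0.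
have := smooth_descent y z sg.
by rewrite /stage_grad dotDl; lra.
Qed.

Lemma stage_obj_mean_le g L mu gam b x (z : V) (I : Type) (s : seq I) (w : I -> R) (X : I -> V) :
  0 < mu -> 0 <= gam -> convex_function [set: V] g -> smooth L g ->
  (forall i, 0 <= w i) -> 0 < \sum_(i <- s) w i ->
  (\sum_(i <- s) w i) *
    (stage_obj g mu gam b x ((\sum_(i <- s) w i)^-1 *: \sum_(i <- s) w i *: X i)
      - stage_obj g mu gam b x z)
    <= \sum_(i <- s) w i * (stage_obj g mu gam b x (X i) - stage_obj g mu gam b x z).
Proof.
move=> mu0 gam0 cg [dg _] w0 W0; set W := \sum_(i <- s) w i in W0 *; set m := _ *: _.
set F := stage_obj g mu gam b x.
have : \sum_(i <- s) w i * (F m - F z + dot (stage_grad g mu gam b x m) (X i - m))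
    <= \sum_(i <- s) w i * (F (X i) - F z).
  apply: ler_sum => i _; rewrite ler_wpM2l//.
  have := stage_obj_ge gam b x (X i) (lt0r_neq0 mu0) cg (dg m).
  have : 0 <= (gam + mu^-1) / 2 * enorm (X i - m) ^+ 2.
    by rewrite mulr_ge0 ?sqr_ge0// divr_ge0// addr_ge0// invr_ge0 ltW.
  by rewrite -/F; lra.
apply: le_trans.
have -> : \sum_(i <- s) w i * (F m - F z + dot (stage_grad g mu gam b x m) (X i - m)) =
   W * (F m - F z) + dot (stage_grad g mu gam b x m) (\sum_(i <- s) w i *: (X i - m)).
  rewrite /W mulr_suml dot_sumr -big_split; apply: eq_bigr => i _.
  by rewrite dotZr /= mulrDr.
suff -> : \sum_(i <- s) w i *: (X i - m) = 0 by rewrite dot0r addr0.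
under eq_bigr do rewrite scalerBr.
by rewrite sumrB -scaler_suml /m scalerA mulfV ?gt_eqF// scale1r subrr.
Qed.

Lemma stage_argmin_grad0 g L mu gam b x z : 0 < mu -> 0 <= gam -> 0 <= L -> smooth L g ->
  is_argmin (stage_obj g mu gam b x) z -> stage_grad g mu gam b x z = 0.
Proof.
move=> mu0 gam0 L0 sg; apply: (@argmin_grad_eq0 _ _ _ (L + gam + mu^-1)).
  by rewrite ltr_wpDl ?addr_ge0// invr_gt0.
move=> w; have := @stage_obj_le g L mu gam b x z (z + w) (lt0r_neq0 mu0) sg.
by rewrite (addrC z w) addrK.
Qed.

Lemma smooth_differentiable L g x : smooth L g -> differentiable (g : V -> R^o) x.
Proof. by case. Qed.

Lemma stage_growth g L mu gam b x z y : mu != 0 ->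
  convex_function [set: V] g -> smooth L g -> stage_grad g mu gam b x z = 0 ->
  (gam + mu^-1) / 2 * enorm (y - z) ^+ 2 <= stage_obj g mu gam b x y - stage_obj g mu gam b x z.
Proof.
move=> mu0 cg [dg _] g0; have := stage_obj_ge gam b x y mu0 cg (dg z).
by rewrite g0 dot0l; lra.
Qed.

Lemma stage_solution_lipschitz g L mu gam b x z b' x' z' : 0 < mu -> 0 <= gam ->
  convex_function [set: V] g -> smooth L g ->
  stage_grad g mu gam b x z = 0 -> stage_grad g mu gam b' x' z' = 0 ->
  (gam + mu^-1) * enorm (z - z') <= enorm (b + gam *: x - (b' + gam *: x')).
Proof.
move=> mu0 gam0 cg [dg _] E E'.
set B := b + _; set B' := b' + _.
have sg0 : 0 < gam + mu^-1 by rewrite ltr_wpDl// invr_gt0.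
have [n0|n0] := eqVneq (enorm (z - z')) 0.
  by rewrite n0 mulr0 enorm_ge0.
have n1 : 0 < enorm (z - z') by rewrite lt0r n0 enorm_ge0.
rewrite -(ler_pM2r n1) -mulrA -expr2.
apply: le_trans (dot_le_enorm _ _).
have {}E : grad g z = B - (gam + mu^-1) *: z.
  apply/eqP; rewrite -subr_eq0 -E /stage_grad /B; apply/eqP/rowP => i; rewrite !mxE; ring.
have {}E' : grad g z' = B' - (gam + mu^-1) *: z'.
  apply/eqP; rewrite -subr_eq0 -E' /stage_grad /B'; apply/eqP/rowP => i; rewrite !mxE; ring.
have := grad_monotone z z' cg dg; rewrite E E'.
have -> : B - (gam + mu^-1) *: z - (B' - (gam + mu^-1) *: z') =
   (B - B') - (gam + mu^-1) *: (z - z').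
  by apply/rowP => i; rewrite !mxE; ring.
by rewrite dotDl dotNl dotZl -enorm_sq subr_ge0.
Qed.

Lemma enorm_continuous (f : V -> R) :
  (forall x e, 0 < e -> exists2 a, 0 < a & forall y, enorm (y - x) <= a -> `|f y - f x| <= e) ->
  continuous f.
Proof.
move=> fC x B /nbhs_ballP[e /= e0 eB]; apply/nbhs_ballP.
have [a a0 fa] := fC x (e / 2) (divr_gt0 e0 (ltr0n R 2)).
exists (a / d.+1%:R) => /=; first by rewrite divr_gt0 ?ltr0n.
move=> y; rewrite -ball_normE/= => yr; apply: eB; rewrite -ball_normE/= distrC.
apply: le_lt_trans (fa _ _) _; last by rewrite ltr_pdivrMr// ltr_pMr// ltr1n.
rewrite enormB; apply: le_trans (enorm_le_mx_norm _) _.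
have : d.+1%:R * `|x - y| <= a by rewrite mulrC -ler_pdivlMr ?ltr0n// ltW.
by apply: le_trans; rewrite ler_wpM2r// ler_nat.
Qed.

Lemma enorm_calm_continuous (f : V -> R) :
  (forall x, exists C, forall y, enorm (y - x) <= 1 -> `|f y - f x| <= C * enorm (y - x)) ->
  continuous f.
Proof.
move=> fC; apply: enorm_continuous => x e e0; have [C hC] := fC x.
have C0 : 0 < `|C| + 1 by rewrite ltr_wpDl.
exists (Num.min 1 (e / (`|C| + 1))); first by rewrite lt_min ltr01 divr_gt0.
move=> y; rewrite le_min => /andP[y1 y2]; apply: le_trans (hC y y1) _.
apply: le_trans (_ : (`|C| + 1) * enorm (y - x) <= _); last by rewrite mulrC -ler_pdivlMr.
by rewrite ler_wpM2r ?enorm_ge0//; have := ler_norm C; lra.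
Qed.

Lemma stage_obj_continuous g L mu gam b x : 0 < mu -> 0 <= gam -> 0 <= L ->
  convex_function [set: V] g -> smooth L g -> continuous (stage_obj g mu gam b x).
Proof.
move=> mu0 gam0 L0 cg sg; apply: enorm_calm_continuous => z.
set G := enorm (stage_grad g mu gam b x z); set A := (L + gam + mu^-1) / 2.
have A0 : 0 <= A by rewrite divr_ge0// !addr_ge0// invr_ge0 ltW.
exists (G + A) => y y1.
have h1 := stage_obj_le gam b x z y (lt0r_neq0 mu0) sg.
have h2 := stage_obj_ge gam b x y (lt0r_neq0 mu0) cg (smooth_differentiable z sg).
have h3 := dot_le_enorm (stage_grad g mu gam b x z) (y - z).
have h4 := dot_le_enorm (- stage_grad g mu gam b x z) (y - z).
rewrite dotNl enormN in h4.
have h5 : enorm (y - z) ^+ 2 <= enorm (y - z).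
  by rewrite expr2 ler_piMr ?enorm_ge0.
have h6 : 0 <= (gam + mu^-1) / 2 * enorm (y - z) ^+ 2.
  by rewrite mulr_ge0 ?sqr_ge0// divr_ge0// addr_ge0// invr_ge0 ltW.
have h7 : A * enorm (y - z) ^+ 2 <= A * enorm (y - z) by rewrite ler_wpM2l.
have h8 : 0 <= A * enorm (y - z) by rewrite mulr_ge0 ?enorm_ge0.
rewrite ler_norml; apply/andP; split; rewrite -/G -/A in h1 h3 h4 *; lra.
Qed.

Lemma stage_argmin_ex g L mu gam b x : 0 < mu -> 0 <= gam -> 0 <= L ->
  convex_function [set: V] g -> smooth L g ->
  exists z, is_argmin (stage_obj g mu gam b x) z.
Proof.
move=> mu0 gam0 L0 cg sg.
have cF := @stage_obj_continuous g L mu gam b x mu0 gam0 L0 cg sg.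
set F := stage_obj g mu gam b x in cF *.
have sg0 : 0 < (gam + mu^-1) / 2 by rewrite divr_gt0// ltr_wpDl// invr_gt0.
set s := (gam + mu^-1) / 2 in sg0.
pose G := stage_grad g mu gam b x 0.
pose r := enorm G / s.
have Fout y : r < enorm y -> F 0 < F y.
  move=> ry.
  have := stage_obj_ge gam b x y (lt0r_neq0 mu0) cg (smooth_differentiable 0 sg).
  rewrite subr0 -/F -/G -/s => h1.
  have := dot_le_enorm (- G) y; rewrite dotNl enormN.
  have y0 : 0 < enorm y by rewrite (le_lt_trans _ ry)// divr_ge0 ?enorm_ge0// ltW.
  have : enorm G * enorm y < s * enorm y ^+ 2.
    by rewrite expr2 mulrA ltr_pM2r// mulrC -ltr_pdivrMr.
  by lra.
pose A := [set y : V | F y <= F 0].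
have [c /set_mem cA cmin] : exists2 c, c \in A & forall t, t \in A -> F c <= F t.
  apply: EVT_min_rV.
  - by exists 0; rewrite /A /=.
  - apply: bounded_closed_compact.
      exists r; split; first exact: num_real.
      move=> M rM y /= yA; apply: le_trans (mx_norm_le_enorm _) _.
      rewrite leNgt; apply/negP => My.
      by have := Fout y (lt_trans rM My); rewrite ltNge yA.
    have -> : A = F @^-1` [set t : R | t <= F 0] by [].
    by apply: closed_comp => // y _; exact: cF.
  - exact: continuous_subspaceT.
exists c => y; have [yA|/ltW yA] := leP (F y) (F 0).
  by apply: cmin; rewrite inE.
exact: le_trans cA yA.
Qed.

Lemma prox_gradient_step g L mu gam b x y y' e z eta :
  mu != 0 -> 0 < eta -> eta * L < 1 -> convex_function [set: V] g -> smooth L g ->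
  grad g y + e - b + mu^-1 *: y' + gam *: (y' - x) + eta^-1 *: (y' - y) = 0 ->
  stage_obj g mu gam b x y' - stage_obj g mu gam b x z <=
  - dot e (y - z) + eta / (2 * (1 - eta * L)) * enorm e ^+ 2
  + (2 * eta)^-1 * enorm (y - z) ^+ 2
  - ((2 * eta)^-1 + (gam + mu^-1) / 2) * enorm (y' - z) ^+ 2.
Proof.
move=> mu0 eta0 etaL cg sg E.
have h1 := stage_obj_quad g gam b x y' z mu0.
have h2 := smooth_descent y y' sg.
have h3 := convex_grad_le z cg (smooth_differentiable y sg).
have E' : mu^-1 *: y' - b + gam *: (y' - x) = - grad g y - e - eta^-1 *: (y' - y).
  apply/eqP; rewrite -subr_eq0 -E; apply/eqP/rowP => i; rewrite !mxE; ring.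
rewrite E' in h1.
have eL : 0 < eta / (1 - eta * L) by rewrite divr_gt0// subr_gt0.
have h4 := dot_young e (y - y') eL.
have h5 : dot (- grad g y - e - eta^-1 *: (y' - y)) (z - y') =
   dot (grad g y) (y' - y) - dot (grad g y) (z - y) + dot e (y - z) - dot e (y - y')
   - (2 * eta)^-1 * enorm (y - z) ^+ 2 + (2 * eta)^-1 * enorm (y' - z) ^+ 2
   + (2 * eta)^-1 * enorm (y - y') ^+ 2.
  by dot_expand; field; rewrite gt_eqF.
have h6 : enorm (z - y') ^+ 2 = enorm (y' - z) ^+ 2 by rewrite enormB.
have h7 : (2 * (eta / (1 - eta * L)))^-1 = (2 * eta)^-1 - L / 2.
  by field; rewrite !gt_eqF// subr_gt0.
have h8 : enorm (y' - y) ^+ 2 = enorm (y - y') ^+ 2 by rewrite enormB.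
have h9 : eta / (1 - eta * L) / 2 = eta / (2 * (1 - eta * L)).
  by field; rewrite !gt_eqF// subr_gt0.
rewrite h9 h7 in h4; rewrite h5 h6 in h1; rewrite h8 in h2.
lra.
Qed.

End Subproblem.

(** * DC reformulation *)

Lemma powR_le1D {R : realType} (nu t : R) : 0 <= nu <= 1 -> 0 <= t -> t `^ nu <= 1 + t.
Proof.
move=> /andP[nu0 nu1] t0; have [t1|t1] := leP t 1.
  have : t `^ nu <= 1 `^ nu by rewrite ge0_ler_powR// nnegrE.
  by rewrite powR1; lra.
by have := ler1_powR (ltW t1) nu1; lra.
Qed.

Section DCProblem.
Context {R : realType} {d : nat}.
Local Notation V := 'rV[R]_d.
Context {L nu : R} {g h : V -> R} {r : V -> \bar R} {p : R -> V -> V}.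
Hypothesis Hdc : dc_problem L nu g h r p.
Implicit Types (x y z w : V) (mu gam : R).

Lemma prox_fin_num mu x : 0 < mu -> r (p mu x) \is a fin_num.
Proof.
move=> mu0; have [noo [x0 x0oo]] := dc_r_proper Hdc.
have := dc_prox Hdc x mu0 x0.
have := noo x0; have := noo (p mu x).
by case: (r (p mu x)) => [//| |]//; case: (r x0) x0oo.
Qed.

Definition moreau_real mu x : R :=
  (2 * mu)^-1 * enorm (p mu x - x) ^+ 2 + fine (r (p mu x)).

Lemma moreauE mu x : 0 < mu -> moreau r mu x = (moreau_real mu x)%:E.
Proof.
move=> mu0; rewrite /moreau /moreau_real EFinD fineK ?prox_fin_num//.
apply/eqP; rewrite eq_le; apply/andP; split.
  by apply: ereal_inf_lbound; exists (p mu x).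
by apply: le_ereal_inf_tmp => _ [y _ <-]; exact: (dc_prox Hdc).
Qed.

Lemma moreau_real_le mu x y : 0 < mu ->
  moreau_real mu y <= (2 * mu)^-1 * enorm (p mu x - y) ^+ 2 + fine (r (p mu x)).
Proof.
move=> mu0; rewrite -lee_fin -moreauE// EFinD fineK ?prox_fin_num//.
by apply: ereal_inf_lbound; exists (p mu x).
Qed.

Definition smoothed_real mu x : R := g x - h x + moreau_real mu x.

Lemma smoothed_objectiveE mu x : 0 < mu ->
  smoothed_objective g h r mu x = (smoothed_real mu x)%:E.
Proof. by move=> mu0; rewrite /smoothed_objective moreauE. Qed.

Definition dc_slope mu x : V := grad h x + mu^-1 *: p mu x.

Lemma smoothed_real_majorant mu gam x y : 0 < mu -> 0 <= gam ->
  smoothed_real mu y - smoothed_real mu x <=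
  stage_obj g mu gam (dc_slope mu x) x y - stage_obj g mu gam (dc_slope mu x) x x.
Proof.
move=> mu0 gam0; rewrite /smoothed_real /stage_obj subrr enorm0 expr0n/= mulr0 addr0.
have h1 := moreau_real_le x y mu0.
have h2 := convex_grad_le y (dc_h_convex Hdc) ((dc_h_holder Hdc).1 x).
have h3 : (2 * mu)^-1 * enorm (p mu x - y) ^+ 2 - (2 * mu)^-1 * enorm (p mu x - x) ^+ 2
  + dot (grad h x) (x - y) =
  (2 * mu)^-1 * enorm y ^+ 2 - (2 * mu)^-1 * enorm x ^+ 2 - dot (dc_slope mu x) y
  + dot (dc_slope mu x) x.
  by rewrite /dc_slope; dot_expand; field; rewrite gt_eqF.
have h4 : dot (grad h x) (y - x) = - dot (grad h x) (x - y) by rewrite -dotNr opprB.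
have h5 : 0 <= gam / 2 * enorm (y - x) ^+ 2 by rewrite mulr_ge0 ?sqr_ge0// divr_ge0.
rewrite h4 in h2.
rewrite {2}/moreau_real.
by lra.
Qed.

Lemma prox_residual_frechet mu x : 0 < mu ->
  frechet_subdiff r (p mu x) (mu^-1 *: (x - p mu x)).
Proof.
move=> mu0; split; first exact: prox_fin_num.
set w := p mu x; set v := _ *: _.
have rw := prox_fin_num x mu0; rewrite -/w in rw.
have key y : y != w -> ((- ((2 * mu)^-1 * enorm (y - w)))%:E <=
   (r y - r w - (dot v (y - w))%:E) * ((enorm (y - w))^-1)%:E)%E.
  move=> yw; have n0 : 0 < enorm (y - w).
    rewrite lt0r enorm_ge0 andbT; apply/eqP => /enorm_eq0 /eqP.
    by rewrite subr_eq0 (negbTE yw).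
  rewrite -lee_pdivrMr; last by rewrite invr_gt0.
  rewrite invrK -EFinM.
  have := dc_prox Hdc x mu0 y; rewrite -/w.
  rewrite -(fineK rw); have := (dc_r_proper Hdc).1 y.
  case: (r y) => [s| |]//= _; last by rewrite ?leey.
  rewrite -!EFinD !lee_fin.
  have : (2 * mu)^-1 * enorm (w - x) ^+ 2 - (2 * mu)^-1 * enorm (y - x) ^+ 2 =
    dot v (y - w) - (2 * mu)^-1 * enorm (y - w) * enorm (y - w).
    by rewrite -mulrA -expr2 /v; dot_expand; field; rewrite gt_eqF.
  by lra.
rewrite limf_einfE; apply/lee_addgt0Pr => e e0.
suff : ((- e)%:E <= ereal_sup [set ereal_inf [set ((r y - r w - (dot v (y - w))%:E) *
      (enorm (y - w))^-1%:E)%E | y in A] | A in w^'])%E.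
  by move=> h1; rewrite -leeBlDr// sub0e.
pose rho := (2 * mu) * e / d.+1%:R.
have rho0 : 0 < rho by rewrite divr_gt0 ?ltr0n// !mulr_gt0.
apply: le_ereal_sup_tmp.
pose A := [set y : V | y != w /\ ball w rho y].
exists (ereal_inf [set ((r y - r w - (dot v (y - w))%:E) *
      (enorm (y - w))^-1%:E)%E | y in A]).
  exists A => //.
  by apply/nbhs_ballP; exists rho => // y yb yw; split.
apply: le_ereal_inf_tmp => _ [y [yw yb] <-]; apply: le_trans (key y yw).
rewrite lee_fin lerN2 mulrC ler_pdivrMr ?mulr_gt0//.
move: yb; rewrite -ball_normE/= => yb.
rewrite enormB; apply: le_trans (enorm_le_mx_norm _) _.
have : d.+1%:R * `|w - y| <= e * (2 * mu).
  by move: yb; rewrite /rho ltr_pdivlMr ?ltr0n// => /ltW; rewrite mulrC (mulrC e).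
by apply: le_trans; rewrite ler_wpM2r// ler_nat.
Qed.

Lemma set_dist_le (A B : set V) a b : A a -> B b -> (set_dist A B <= (enorm (a - b))%:E)%E.
Proof. by move=> Aa Bb; apply: ereal_inf_lbound; exists a => //; exists b. Qed.

Lemma prox_displacement mu gam x z : 0 < mu -> 0 <= gam ->
  stage_grad g mu gam (dc_slope mu x) x z = 0 ->
  mu^-1 *: (x - p mu x) = (mu^-1 + gam) *: (x - z) + grad h x - grad g z.
Proof.
move=> mu0 gam0 E; apply/eqP; rewrite -subr_eq0 -E /stage_grad /dc_slope.
by apply/eqP/rowP => i; rewrite !mxE; ring.
Qed.

Lemma stationarity_dist_le mu gam x z : 0 < mu -> 0 <= gam ->
  stage_grad g mu gam (dc_slope mu x) x z = 0 ->
  (set_dist [set grad h (p mu x)]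
     [set (grad g (p mu x) + v)%R | v in frechet_subdiff r (p mu x)]
   <= (L * enorm (x - p mu x) `^ nu + L * enorm (x - p mu x)
        + (L + gam + mu^-1) * enorm (x - z))%:E)%E.
Proof.
move=> mu0 gam0 E; set w := p mu x.
apply: le_trans (set_dist_le (a := grad h w) (b := grad g w + mu^-1 *: (x - w)) _ _) _ => //.
  by exists (mu^-1 *: (x - w)) => //; exact: prox_residual_frechet.
rewrite lee_fin (prox_displacement mu0 gam0 E).
have -> : grad h w - (grad g w + ((mu^-1 + gam) *: (x - z) + grad h x - grad g z)) =
   (grad h w - grad h x) + ((grad g z - grad g x) + (grad g x - grad g w)) - (mu^-1 + gam) *: (x - z).
  by apply/rowP => i; rewrite !mxE; ring.
have h1 := (dc_h_holder Hdc).2 w x; rewrite (enormB w) in h1.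
have h2 := (dc_g_smooth Hdc).2 z x.
have h3 := (dc_g_smooth Hdc).2 x w.
have h4 : enorm (- ((mu^-1 + gam) *: (x - z))) = (mu^-1 + gam) * enorm (x - z).
  by rewrite enormN enormZ ger0_norm// addr_ge0// invr_ge0 ltW.
have h5 := enormD (grad g z - grad g x) (grad g x - grad g w).
set a := grad h w - grad h x in h1 *; set b := (_ + _ : V) in h5 *.
have h6 := enormD a b.
apply: le_trans (enormD (a + b) _) _; rewrite h4.
have h8 : enorm (a + b) <= L * enorm (x - w) `^ nu + (L * enorm (z - x) + L * enorm (x - w)).
  exact: le_trans h6 (lerD h1 (le_trans h5 (lerD h2 h3))).
apply: (le_trans (lerD h8 (lexx _))); rewrite (enormB z).
by clear; lra.
Qed.

Lemma prox_displacement_le mu gam x0 x z : 0 < mu -> 0 <= gam ->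
  stage_grad g mu gam (dc_slope mu x) x z = 0 ->
  enorm (x - p mu x) <= (1 + mu * gam + mu * L) * enorm (x - z)
    + mu * (enorm (grad h x0 - grad g x0) + L + 2 * L * enorm (x - x0)).
Proof.
move=> mu0 gam0 E.
have L0 := dc_L_gt0 Hdc; have /andP[nu0 nu1] := dc_nu Hdc.
rewrite -(ler_pM2l (_ : 0 < mu^-1)) ?invr_gt0//.
rewrite mulrDr (mulrA mu^-1 mu) mulVf ?gt_eqF// mul1r.
have -> : mu^-1 * enorm (x - p mu x) = enorm (mu^-1 *: (x - p mu x)).
  by rewrite enormZ gtr0_norm// invr_gt0.
rewrite (prox_displacement mu0 gam0 E).
have -> : (mu^-1 + gam) *: (x - z) + grad h x - grad g z =
   (mu^-1 + gam) *: (x - z) + ((grad g x - grad g z) + ((grad h x - grad h x0)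
     + ((grad h x0 - grad g x0) + (grad g x0 - grad g x)))).
  by apply/rowP => i; rewrite !mxE; ring.
have h4 : enorm ((mu^-1 + gam) *: (x - z)) = (mu^-1 + gam) * enorm (x - z).
  by rewrite enormZ ger0_norm// addr_ge0// invr_ge0 ltW.
set a := grad g x - grad g z; set b := grad h x - grad h x0.
set c := grad h x0 - grad g x0; set e := grad g x0 - grad g x.
have k1 := enormD ((mu^-1 + gam) *: (x - z)) (a + (b + (c + e))).
have k2 := enormD a (b + (c + e)); have k3 := enormD b (c + e).
have k4 : enorm a <= L * enorm (x - z) := (dc_g_smooth Hdc).2 x z.
rewrite h4 in k1.
have -> : mu^-1 * ((1 + mu * gam + mu * L) * enorm (x - z)) =
  (mu^-1 + gam) * enorm (x - z) + L * enorm (x - z) by field; rewrite gt_eqF.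
have h1 := (dc_h_holder Hdc).2 x x0; rewrite -/b in h1.
have h2 := enormD c e.
have h3 := (dc_g_smooth Hdc).2 x0 x; rewrite -/e (enormB x0) in h3.
have h5 : L * enorm (x - x0) `^ nu <= L * (1 + enorm (x - x0)).
  by rewrite ler_pM2l// powR_le1D ?enorm_ge0// (ltW nu0).
apply: (le_trans k1); rewrite -[leRHS]addrA lerD2l; apply: (le_trans k2); rewrite lerD//.
apply: (le_trans k3); apply: (le_trans (lerD h1 h2)).
move: h3 h5; clear k1 k2 k3 k4 h1 h2 h4 E.
move: (enorm c) (enorm b) (enorm e) (enorm (x - x0)) (enorm (x - x0) `^ nu) => *; lra.
Qed.

Lemma prox_displacement_lipschitz : reg_R1 r ->
  exists2 M : R, 0 <= M & forall mu x, 0 < mu -> enorm (x - p mu x) <= M * mu.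
Proof.
move=> [r0 [M [rE rL]]]; exists (2 * `|M|); first by rewrite mulr_ge0.
move=> mu x mu0; set w := p mu x.
have := dc_prox Hdc x mu0 x; rewrite -/w !rE -!EFinD lee_fin subrr enorm0 expr0n/= mulr0 add0r.
have [->|n0] := eqVneq (enorm (x - w)) 0; first by rewrite !mulr_ge0// ltW.
have n1 : 0 < enorm (x - w) by rewrite lt0r n0 enorm_ge0.
rewrite (enormB w) => h1.
have h2 := rL x w; have h3 := ler_norm (r0 x - r0 w).
have h4 : M * enorm (x - w) <= `|M| * enorm (x - w) by rewrite ler_wpM2r ?enorm_ge0// ler_norm.
have h5 : (2 * mu)^-1 * enorm (x - w) ^+ 2 <= `|M| * enorm (x - w) by lra.
move: h5; rewrite expr2 mulrA ler_pM2r// ler_pdivrMl ?mulr_gt0//; lra.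
Qed.

End DCProblem.

(** * Borel measurability of vector-valued maps *)

Section BorelVectors.
Context {R : realType} {d : nat} {dT : measure_display} {T : measurableType dT}.
Local Notation V := 'rV[R]_d.

Lemma measurable_coord (i : 'I_d) : measurable_fun setT (fun v : borelV R d => v 0 i : R).
Proof.
apply: (measurability _ (RGenOpens.measurableE R)) => _ [_ [a [b ->] <-]].
apply: sub_sigma_algebra; rewrite setTI.
have cc : continuous (fun v : V => v 0 i : R).
  apply: enorm_calm_continuous => x; exists 1 => y _; rewrite mul1r.
  by have := coord_le_enorm (y - x) i; rewrite !mxE.
by have /continuousP := cc; apply; exact: interval_open.
Qed.

Lemma continuous_measurable_borelV (f : V -> R) : continuous f ->
  measurable_fun setT (f : borelV R d -> R).
Proof.
move=> /continuousP cf; apply: (measurability _ (RGenOpens.measurableE R)) => _ [_ [a [b ->] <-]].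
by apply: sub_sigma_algebra; rewrite setTI; apply: cf; exact: interval_open.
Qed.

Lemma open_rV_rat_box (U : set V) : open U ->
  U = \bigcup_(qn : 'rV[rat]_d * nat)
       [set v | (forall u : V, (forall i, `|u 0 i - ratr (qn.1 0 i)| < qn.2.+1%:R^-1) -> U u)
         /\ forall i, `|v 0 i - ratr (qn.1 0 i)| < qn.2.+1%:R^-1].
Proof.
move=> oU; apply/seteqP; split => [v Uv|v [qn _ []] + h]; last exact.
have /nbhs_ballP[e /= e0 eU] : nbhs v U by apply: open_nbhs_nbhs.
have [n ne] : exists n, 2 * n.+1%:R^-1 < e.
  exists (Num.truncn (2 / e)).
  have := truncnS_gt (2 / e); rewrite ltr_pdivrMr// => h.
  by rewrite ltr_pdivrMr ?ltr0n// mulrC.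
have n0 : 0 < n.+1%:R^-1 :> R by rewrite invr_gt0 ltr0n.
have qP i : exists q : rat, `|v 0 i - ratr q| < n.+1%:R^-1.
  have [|q] := @rat_in_itvoo _ (v 0 i - n.+1%:R^-1) (v 0 i + n.+1%:R^-1); first by rewrite ltrD2l gtrN.
  by rewrite in_itv/= => hq; exists q; rewrite distrC ltr_distl.
have [q qv] := choice qP.
exists (\row_i q i, n) => //=; split => [u hu|i]; last by rewrite mxE.
apply: eU; rewrite -ball_normE/=.
rewrite [ltLHS]/Num.norm /= mx_normrE.
apply: le_lt_trans ne; apply: bigmax_le; first by rewrite mulr_ge0// ltW.
move=> [k i] _ /=; rewrite ord1 !mxE.
have := hu i; rewrite /= mxE distrC => h2; have := qv i => h1.
have h3 := ler_distD (ratr (q i)) (v 0 i) (u 0 i).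
by rewrite mulr_natl mulr2n; apply: (le_trans h3); rewrite lerD// ltW.
Qed.

Lemma measurable_fun_rV (D : set T) (X : T -> borelV R d) :
  (forall i, measurable_fun D (fun w => X w 0 i : R)) -> measurable_fun D X.
Proof.
move=> mX mD; apply: (@measurability _ _ _ _ _ X (@open V)) => // _ [U oU <-].
rewrite (open_rV_rat_box oU) preimage_bigcup setI_bigcupr.
apply: countable_bigcupT_measurable => // -[q n].
have [sub|nsub] := pselect (forall u : V, (forall i, `|u 0 i - ratr (q 0 i)| < n.+1%:R^-1) -> U u);
  last first.
  rewrite [X in measurable X](_ : _ = set0)//; apply/seteqP; split => // w [_ []].
  by move=> /nsub.
rewrite [X in measurable X](_ : _ = D `&` \bigcap_(i in [set: 'I_d])
    (D `&` (fun w => X w 0 i : R) @^-1` [set t : R | `|t - ratr (q 0 i)| < n.+1%:R^-1])); last first.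
  apply/seteqP; split => w [Dw].
    by move=> [_ h]; split => // i _; split => //; exact: h.
  by move=> h; split => //; split => // i; have [] := h i I.
apply: measurableI => //; apply: fin_bigcap_measurable; first exact: finite_finset.
move=> i _; apply: mX => //.
have -> : [set t : R | `|t - ratr (q 0 i)| < n.+1%:R^-1] =
   `](ratr (q 0 i) - n.+1%:R^-1), (ratr (q 0 i) + n.+1%:R^-1)[%classic.
  by apply/seteqP; split => t /=; rewrite in_itv/= -ltr_distl.
exact: measurable_itv.
Qed.

Lemma measurable_borelV_coord (D : set T) (X : T -> borelV R d) i :
  measurable_fun D X -> measurable_fun D (fun w => X w 0 i : R).
Proof. by move=> mX; exact: (measurableT_comp (measurable_coord i) mX). Qed.

Lemma measurable_rVD (D : set T) (X Y : T -> borelV R d) :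
  measurable_fun D X -> measurable_fun D Y ->
  measurable_fun D ((fun w => (X w : V) + (Y w : V)) : T -> borelV R d).
Proof.
move=> mX mY; apply: measurable_fun_rV => i; under eq_fun do rewrite mxE.
by apply: measurable_funD; exact: measurable_borelV_coord.
Qed.

Lemma measurable_rVZ (D : set T) (a : R) (X : T -> borelV R d) :
  measurable_fun D X -> measurable_fun D ((fun w => a *: (X w : V)) : T -> borelV R d).
Proof.
move=> mX; apply: measurable_fun_rV => i; under eq_fun do rewrite mxE.
by apply: measurable_funM => //; exact: measurable_borelV_coord.
Qed.

Lemma measurable_rVB (D : set T) (X Y : T -> borelV R d) :
  measurable_fun D X -> measurable_fun D Y ->
  measurable_fun D ((fun w => (X w : V) - (Y w : V)) : T -> borelV R d).
Proof.
move=> mX mY; under eq_fun do rewrite -scaleN1r.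
by apply: measurable_rVD => //; exact: measurable_rVZ.
Qed.

Lemma measurable_rV_sum (D : set T) (I : Type) (s : seq I) (X : I -> T -> borelV R d) :
  (forall i, measurable_fun D (X i)) ->
  measurable_fun D ((fun w => \sum_(i <- s) (X i w : V)) : T -> borelV R d).
Proof.
move=> mX; elim: s => [|i s IH].
  by under eq_fun do rewrite big_nil; exact: measurable_cst.
by under eq_fun do rewrite big_cons; exact: measurable_rVD.
Qed.

Lemma measurable_dot (D : set T) (X Y : T -> borelV R d) :
  measurable_fun D X -> measurable_fun D Y ->
  measurable_fun D (fun w => dot (X w : V) (Y w : V)).
Proof.
move=> mX mY; apply: measurable_sum => i.
by apply: measurable_funM; exact: measurable_borelV_coord.
Qed.

Lemma measurable_enorm_sq (D : set T) (X : T -> borelV R d) :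
  measurable_fun D X -> measurable_fun D (fun w => enorm (X w : V) ^+ 2).
Proof. by move=> mX; under eq_fun do rewrite enorm_sq; exact: measurable_dot. Qed.

End BorelVectors.

Lemma holder_measurable {R : realType} {d : nat} (f : 'rV[R]_d -> 'rV[R]_d) (C nu : R) :
  0 <= C -> 0 < nu -> (forall x y, enorm (f x - f y) <= C * enorm (x - y) `^ nu) ->
  measurable_fun setT (f : borelV R d -> borelV R d).
Proof.
move=> C0 nu0 fC; apply: measurable_fun_rV => i; apply: continuous_measurable_borelV.
have C1 : 0 < C + 1 by rewrite ltr_wpDl.
apply: enorm_continuous => x e e0; exists ((e / (C + 1)) `^ nu^-1).
  by rewrite powR_gt0// divr_gt0.
move=> y yx; have := coord_le_enorm (f y - f x) i; rewrite !mxE => h1; apply: le_trans h1 _.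
apply: le_trans (fC y x) _; apply: le_trans (_ : (C + 1) * enorm (y - x) `^ nu <= _).
  by rewrite ler_wpM2r ?powR_ge0// lerDl.
rewrite mulrC -ler_pdivlMr//.
have -> : e / (C + 1) = ((e / (C + 1)) `^ nu^-1) `^ nu.
  by rewrite -powRrM mulVf ?gt_eqF// powRr1// divr_ge0// ltW.
by rewrite ge0_ler_powR ?nnegrE ?enorm_ge0 ?powR_ge0// ltW.
Qed.

Lemma lipschitz_measurable {R : realType} {d : nat} (f : 'rV[R]_d -> 'rV[R]_d) (C : R) :
  0 <= C -> (forall x y, enorm (f x - f y) <= C * enorm (x - y)) ->
  measurable_fun setT (f : borelV R d -> borelV R d).
Proof.
by move=> C0 fC; apply: (holder_measurable C0 ltr01) => x y; rewrite powRr1 ?enorm_ge0.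
Qed.

Section ProbabilityIntegrals.
Context {R : realType} {dO : measure_display} {Om : measurableType dO}.

Lemma Rintegral_sum (P : {measure set Om -> \bar R}) (I : Type) (s : seq I) (f : I -> Om -> R) :
  (forall i, P.-integrable setT (EFin \o f i)) ->
  P.-integrable setT (EFin \o (fun w => \sum_(i <- s) f i w)) /\
  \int[P]_w (\sum_(i <- s) f i w) = \sum_(i <- s) \int[P]_w f i w.
Proof.
move=> fi; elim: s => [|i s [IH1 IH2]].
  have -> : (fun w => \sum_(i <- [::]) f i w) = cst 0 by apply/funext => w; rewrite big_nil.
  by rewrite big_nil /Rintegral/= integral0; split => //; exact: integrable0.
have -> : (fun w => \sum_(j <- i :: s) f j w) = (fun w => f i w + \sum_(j <- s) f j w).
  by apply/funext => w; rewrite big_cons.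
rewrite RintegralD// IH2 big_cons; split => //.
exact: (integrableD measurableT (fi i) IH1).
Qed.

Variable P : probability Om R.

Lemma integral_prob_cst (c : \bar R) : (\int[P]_w c = c)%E.
Proof. by rewrite integral_cst// -[RHS]mule1; congr (_ * _)%E; exact: probability_setT. Qed.

Lemma Rintegral_prob_cst (c : R) : \int[P]_w c = c.
Proof. by rewrite /Rintegral integral_prob_cst. Qed.

Lemma integrable_dominated (X Y : Om -> R) : measurable_fun setT X ->
  P.-integrable setT (EFin \o Y) -> (forall w, `|X w| <= Y w) ->
  P.-integrable setT (EFin \o X).
Proof.
move=> mX iY XY; apply: (le_integrable measurableT _ _ iY); first exact/measurable_EFinP.
by move=> w _ /=; rewrite lee_fin; apply: le_trans (XY w) (ler_norm _).
Qed.

End ProbabilityIntegrals.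

(** * Independence *)

Section Independence.
Context {R : realType} {dO : measure_display} {Om : measurableType dO} (P : probability Om R).

Lemma sigma_of_measurable {dT} {T : measurableType dT} (X : Om -> T) :
  measurable_fun setT X -> sigma_of X `<=` measurable.
Proof. by move=> mX _ [B mB <-]; exact: mX. Qed.

Lemma sigma_of_algebra {dT} {T : measurableType dT} (X : Om -> T) :
  sigma_algebra setT (sigma_of X).
Proof. exact/sigma_algebra_preimage/sigma_algebra_measurable. Qed.

Let fin_P (A : set Om) : measurable A -> P A \is a fin_num.
Proof. by move=> mA; exact: fin_num_measure. Qed.

Lemma independent_lambda_system (B : set Om) : measurable B ->
  lambda_system setT [set A | measurable A /\ (P (A `&` B) = P A * P B)%E].
Proof.
move=> mB; split => //=.
- by rewrite setTI probability_setT mul1e.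
- move=> A A' A'A [mA PA] [mA' PA']; split; first exact: measurableD.
  have mAB : measurable (A `&` B) by exact: measurableI.
  have -> : (A `\` A') `&` B = (A `&` B) `\` A' by rewrite !setDE setIAC.
  rewrite (measureD mAB mA') ?ltey_eq ?fin_P// (measureD mA mA') ?ltey_eq ?fin_P//.
  rewrite (setIidr A'A) muleBl ?fin_P//; last by rewrite fin_num_adde_defl// fin_numN fin_P.
  rewrite -PA -PA'; congr (_ - P _)%E.
  by rewrite setIAC (setIidr A'A).
- move=> F ndF hF; have mF i : measurable (F i) by have [] := hF i.
  have mUF : measurable (\bigcup_i F i) by exact: bigcupT_measurable.
  split => //.
  have h1 : P \o (fun n => F n `&` B) @ \oo --> P (\bigcup_n (F n `&` B)).
    apply: nondecreasing_cvg_mu.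
    - by move=> i; exact: measurableI.
    - by apply: bigcupT_measurable => i; exact: measurableI.
    - by move=> m n mn; apply/subsetPset; apply: setSI; exact/subsetPset/ndF.
  have h2 : (fun n => P (F n) * P B)%E @ \oo --> (P (\bigcup_n F n) * P B)%E.
    by apply: cvgeZr; [exact: fin_P|exact: nondecreasing_cvg_mu].
  have E : P \o (fun n => F n `&` B) = (fun n => P (F n) * P B)%E.
    by apply/funext => n /=; have [] := hF n.
  rewrite setI_bigcupl.
  rewrite E in h1.
  exact: (cvg_unique _ h1 h2).
Qed.

(* Only mutual independence of the generators is given, so independence of one of them from the
   sigma-algebra generated by the others goes through the pi-lambda theorem. *)
Lemma independent_generated (I : choiceType) (D : pred I) (E : I -> set (set Om))
    (J : seq I) (i : I) (A B : set Om) :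
  mutually_independent P D E -> uniq (i :: J) -> all D (i :: J) ->
  (forall j, j \in i :: J -> sigma_algebra setT (E j) /\ E j `<=` measurable) ->
  <<s \bigcup_(j in [set` J]) E j >> A -> E i B ->
  (P (A `&` B) = P A * P B)%E.
Proof.
move=> indE uJ DJ sE sA EB.
have mE j A' : j \in i :: J -> E j A' -> measurable A' by move=> /sE[_]; exact.
have mB : measurable B by apply: mE EB; rewrite mem_head.
have Jm j : j \in J -> j \in i :: J by move=> jJ; rewrite in_cons jJ orbT.
have iJ j : j \in J -> j != i.
  by move=> jJ; apply: contraTneq jJ => ->; have /= /andP[] := uJ.
pose G : set (set Om) := [set A | exists2 F : I -> set Om,
  (forall j, j \in J -> E j (F j)) & A = \bigcap_(j in [set` J]) F j].
have sEP j : j \in J -> [/\ E j setT, setSD_closed (E j), ndseq_closed (E j) & setI_closed (E j)].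
  by move=> /Jm /sE[+ _] => /(sigma_algebraP (fun _ _ => @subsetT _ _)).
have GI : setI_closed G.
  move=> _ _ [F1 hF1 ->] [F2 hF2 ->]; exists (fun j => F1 j `&` F2 j).
    move=> j jJ; have [_ _ _ sI] := sEP j jJ.
    by apply: sI; [exact: hF1|exact: hF2].
  by rewrite bigcapI.
have EG : \bigcup_(j in [set` J]) E j `<=` G.
  move=> C [j /= jJ EC]; exists (fun k => if k == j then C else setT).
    by move=> k kJ; case: eqP => [->//|_]; have [] := sEP k kJ.
  apply/seteqP; split => [w Cw k _|w /(_ j jJ)]; last by rewrite eqxx.
  by case: eqP.
suff : <<s G >> `<=` [set A | measurable A /\ (P (A `&` B) = P A * P B)%E].
  by move=> /(_ A) []//; apply: sub_sigma_algebra2 EG _ sA.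
apply: lambda_system_subset => //; first exact: independent_lambda_system.
move=> _ [F hF ->]; split.
  by apply: fin_bigcap_measurable => // j jJ; exact: mE (Jm j jJ) (hF j jJ).
have /= /andP[_ uJ'] := uJ; have /= /andP[_ DJ'] := DJ.
rewrite (indE J uJ' DJ' F hF).
pose F' k := if k == i then B else F k.
have := indE (i :: J) uJ DJ F'; rewrite big_cons.
have -> : F' i = B by rewrite /F' eqxx.
have -> : (\prod_(j <- J) P (F' j) = \prod_(j <- J) P (F j))%E.
  by apply: eq_big_seq => j jJ; rewrite /F' (negbTE (iJ j jJ)).
rewrite muleC => <-.
  congr (P _); apply/seteqP; split => [w [wF wB] j /=|w h].
    rewrite in_cons /F'; case: eqP => //= _; exact: wF.
  split => [j jJ|].
    by have := h j (Jm j jJ); rewrite /F' (negbTE (iJ j jJ)).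
  by have := h i (mem_head i J); rewrite /F'; case: eqP.
move=> j; rewrite in_cons /F'; case: eqP => [->//|_ /=]; exact: hF.
Qed.

Section Freezing.
Context {d1 d2 : measure_display} {S : measurableType d1} {T : measurableType d2}.
Context (X : Om -> S) (Y : Om -> T) (Q : probability T R).
Hypotheses (mX : measurable_fun setT X) (mY : measurable_fun setT Y).
Hypothesis indXY : forall A B, measurable A -> measurable B ->
  (P (X @^-1` A `&` Y @^-1` B) = P (X @^-1` A) * Q B)%E.

Let X_mixin := isMeasurableFun.Build _ _ _ _ X mX.
Let X' : {mfun Om >-> S} := HB.pack X X_mixin.
Let mXY : measurable_fun setT (fun w => (X w, Y w)).
Proof. exact: measurable_fun_pair. Qed.
Let XY_mixin := isMeasurableFun.Build _ _ _ _ (fun w => (X w, Y w)) mXY.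
Let XY' : {mfun Om >-> (S * T)%type} := HB.pack (fun w => (X w, Y w)) XY_mixin.

Let joint_law (f : S * T -> \bar R) :
  (\int[distribution P XY']_z f z = \int[(distribution P X' \x Q)%E]_z f z)%E.
Proof.
apply: eq_measure_integral => A mA _; apply/esym.
apply: (@product_measure_unique _ _ _ _ _ (distribution P X') Q (distribution P XY')) => //.
Qed.

(* If [Y] with law [Q] is independent of [X], then E f(X, Y) = E F(X) with F(x) = E_Q f(x, .). *)
Lemma freezing_ge0 (f : S * T -> \bar R) : measurable_fun setT f -> (forall z, 0 <= f z)%E ->
  (\int[P]_w f (X w, Y w) = \int[P]_w \int[Q]_t f (X w, t))%E.
Proof.
move=> mf f0.
have /= <- := @ge0_integral_distribution _ _ _ _ _ P XY' f mf f0.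
rewrite joint_law fubini_tonelli1//.
rewrite ge0_integral_distribution//.
  exact: measurable_fun_fubini_tonelli_F.
by move=> s; exact: integral_ge0.
Qed.

Lemma freezing_eq0 (f : S * T -> R) : measurable_fun setT f ->
  P.-integrable setT (fun w => (f (X w, Y w))%:E) ->
  (forall s, \int[Q]_t (f (s, t))%:E = 0)%E ->
  (\int[P]_w (f (X w, Y w))%:E = 0)%E.
Proof.
move=> mf intf f0; have mf' : measurable_fun setT (EFin \o f) by exact/measurable_EFinP.
have /= <- := @integral_distribution _ _ _ _ _ P XY' (EFin \o f) mf' intf.
rewrite (joint_law (EFin \o f)).
rewrite -integral12_prod_meas1.
  by apply: integral0_eq => s _; exact: f0.
apply/integrableP; split => //.
rewrite -joint_law.
have := @integrable_pushforward _ _ _ _ _ _ mXY P setT (EFin \o f) mf' intf measurableT.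
by case/integrableP.
Qed.

End Freezing.
End Independence.

(** * Stage recursion and random output index *)

Section WeightedSums.
Context {R : realType}.
Implicit Types (K : nat) (D w c : nat -> R) (a : R).

Lemma telescope_weighted_le K D w (b : R) : nondecreasing_seq w ->
  (forall k, (1 <= k <= K)%N -> D k <= b) -> w 0%N = 0 ->
  \sum_(1 <= k < K.+1) w k * (D k - D k.+1) <= w K * (b - D K.+1).
Proof.
move=> mw hD w0; elim: K hD => [|K IH] hD; first by rewrite big_geq// w0 mul0r.
rewrite big_nat_recr//=.
have {}IH : \sum_(1 <= k < K.+1) w k * (D k - D k.+1) <= w K * (b - D K.+1).
  by apply: IH => k /andP[k1 kK]; apply: hD; rewrite k1 ltnW.
have h1 : D K.+1 <= b by apply: hD; rewrite ltnSn.
have h2 : w K <= w K.+1 by apply: mw.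
have h3 : 0 <= (w K.+1 - w K) * (b - D K.+1) by rewrite mulr_ge0// subr_ge0.
by lra.
Qed.

Lemma sum_inv_sqrt_le K : \sum_(1 <= k < K.+1) (Num.sqrt k%:R : R)^-1 <= 2 * Num.sqrt K%:R.
Proof.
elim: K => [|K IH]; first by rewrite big_geq// sqrtr0 mulr0.
rewrite big_nat_recr//=.
set s := Num.sqrt K.+1%:R; set t := Num.sqrt K%:R in IH *.
have s0 : 0 < s by rewrite sqrtr_gt0 ltr0n.
have t0 : 0 <= t by exact: sqrtr_ge0.
have ss : s ^+ 2 = t ^+ 2 + 1 by rewrite !sqr_sqrtr ?ler0n// -natr1.
have ts : t <= s by rewrite ler_sqrt ?ler0n// ler_nat.
suff : s^-1 <= 2 * s - 2 * t by lra.
rewrite -div1r ler_pdivrMr//; nra.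
Qed.

Lemma sum_powR_ge (al : R) K : 0 <= al -> (0 < K)%N ->
  K%:R * K%:R `^ al <= (2 * 2 `^ al) * \sum_(1 <= k < K.+1) k%:R `^ al.
Proof.
move=> al0 K0.
have -> : \sum_(1 <= k < K.+1) (k%:R `^ al : R) = \sum_(k < K) (k.+1%:R `^ al : R).
  by rewrite big_add1 /= big_mkord.
set S := \sum_(k < K) _.
have E : 2 * S = \sum_(k < K) (k.+1%:R `^ al + (rev_ord k).+1%:R `^ al).
  rewrite big_split /= mulr_natl mulr2n; congr (_ + _).
  by rewrite /S (reindex_inj rev_ord_inj).
have h k : (k < K)%N -> K%:R `^ al <= 2 `^ al * ((k.+1)%:R `^ al + (K - k)%:R `^ al) :> R.
  move=> kK; rewrite mulrDr -!powRM ?ler0n//.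
  have [h1|h1] := leqP K (2 * k.+1).
    apply: le_trans (_ : (2 * k.+1%:R) `^ al <= _); last by rewrite lerDl powR_ge0.
    by rewrite ge0_ler_powR ?nnegrE ?ler0n ?mulr_ge0// -natrM ler_nat.
  apply: le_trans (_ : (2 * (K - k)%:R) `^ al <= _); last by rewrite lerDr powR_ge0.
  rewrite ge0_ler_powR ?nnegrE ?ler0n ?mulr_ge0// -natrM ler_nat mulnBr.
  by rewrite leq_subRL; lia.
have : \sum_(k < K) (K%:R `^ al : R) <= 2 `^ al * (2 * S).
  rewrite E mulr_sumr; apply: ler_sum => k _.
  by apply: le_trans (h k (ltn_ord k)) _; rewrite /= subnSK.
by rewrite sumr_const card_ord -mulr_natr; lra.
Qed.

End WeightedSums.

Section StageGaps.
Context {R : realType} {d : nat}.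
Local Notation V := 'rV[R]_d.
Context {L nu : R} {g h : V -> R} {r : V -> \bar R} {p : R -> V -> V}.
Hypothesis Hdc : dc_problem L nu g h r p.
Implicit Types (x y z : V) (mu gam m : R).

Definition dc_stage mu gam x : V -> R := stage_obj g mu gam (@dc_slope R d h p mu x) x.

Definition dc_stage_sol mu gam x : V :=
  xget 0 [set z | stage_grad g mu gam (@dc_slope R d h p mu x) x z = 0].

Definition start_gap mu gam x : R := dc_stage mu gam x x - dc_stage mu gam x (dc_stage_sol mu gam x).

Definition end_gap mu gam x y : R := dc_stage mu gam x y - dc_stage mu gam x (dc_stage_sol mu gam x).

Lemma dc_stage_solP mu gam x : 0 < mu -> 0 <= gam ->
  stage_grad g mu gam (@dc_slope R d h p mu x) x (dc_stage_sol mu gam x) = 0.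
Proof.
move=> mu0 gam0; have L0 := ltW (dc_L_gt0 Hdc).
have [z zmin] := stage_argmin_ex (@dc_slope R d h p mu x) x mu0 gam0 L0
   (dc_g_convex Hdc) (dc_g_smooth Hdc).
have := stage_argmin_grad0 mu0 gam0 L0 (dc_g_smooth Hdc) zmin.
move=> hz; exact: (@xgetPex _ 0 [set z | stage_grad g mu gam (dc_slope mu x) x z = 0] (ex_intro _ z hz)).
Qed.

Lemma end_gap_ge mu gam x y : 0 < mu -> 0 <= gam ->
  (gam + mu^-1) / 2 * enorm (y - dc_stage_sol mu gam x) ^+ 2 <= end_gap mu gam x y.
Proof.
move=> mu0 gam0; apply: (stage_growth _ (lt0r_neq0 mu0) (dc_g_convex Hdc) (dc_g_smooth Hdc)).
exact: dc_stage_solP.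
Qed.

Lemma end_gap_ge0 mu gam x y : 0 < mu -> 0 <= gam -> 0 <= end_gap mu gam x y.
Proof.
move=> mu0 gam0; apply: le_trans (end_gap_ge x y mu0 gam0).
by rewrite mulr_ge0 ?sqr_ge0// divr_ge0// addr_ge0// invr_ge0 ltW.
Qed.

Lemma start_gap_ge mu gam x : 0 < mu -> 0 <= gam ->
  (gam + mu^-1) / 2 * enorm (x - dc_stage_sol mu gam x) ^+ 2 <= start_gap mu gam x.
Proof. exact: end_gap_ge. Qed.

Lemma start_gap_ge0 mu gam x : 0 < mu -> 0 <= gam -> 0 <= start_gap mu gam x.
Proof. exact: end_gap_ge0. Qed.

Lemma gap_descent mu gam x y : 0 < mu -> 0 <= gam ->
  start_gap mu gam x <= @smoothed_real R d g h r p mu x - @smoothed_real R d g h r p mu y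
    + end_gap mu gam x y.
Proof.
move=> mu0 gam0; have := smoothed_real_majorant Hdc x y mu0 gam0.
rewrite /start_gap /end_gap /dc_stage; lra.
Qed.

Lemma start_gap_le mu gam x m : 0 < mu -> 0 <= gam ->
  (forall y, m <= @smoothed_real R d g h r p mu y) ->
  start_gap mu gam x <= @smoothed_real R d g h r p mu x - m.
Proof.
move=> mu0 gam0 hm; have := gap_descent x (dc_stage_sol mu gam x) mu0 gam0.
by rewrite /end_gap subrr addr0; have := hm (dc_stage_sol mu gam x); lra.
Qed.

Lemma smoothed_inf_real mu x (Delta : R) : 0 < mu ->
  (smoothed_objective g h r mu x - ereal_inf (range (smoothed_objective g h r mu)) <= Delta%:E)%E ->
  exists m, [/\ ereal_inf (range (smoothed_objective g h r mu)) = m%:E,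
    forall y, m <= @smoothed_real R d g h r p mu y &
    @smoothed_real R d g h r p mu x - m <= Delta].
Proof.
move=> mu0; have le_inf y : (ereal_inf (range (smoothed_objective g h r mu)) <=
    (@smoothed_real R d g h r p mu y)%:E)%E.
  by rewrite -(smoothed_objectiveE Hdc)//; apply: ereal_inf_lbound; exists y.
rewrite (smoothed_objectiveE Hdc)//.
case: (ereal_inf _) le_inf => [m| |]// le_inf; last by have := le_inf x.
by rewrite -EFinB lee_fin => hD; exists m.
Qed.

End StageGaps.

Section FinitelyValued.
Context {R : realType} {dO : measure_display} {Om : measurableType dO}.
Variable G : set (set Om).

Definition fin_measurable {U : Type} (X : Om -> U) : Prop :=
  finite_set (range X) /\ forall u, <<s G>> (X @^-1` [set u]).

Lemma fin_measurable_preimage {U : Type} (X : Om -> U) (A : set U) :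
  fin_measurable X -> <<s G>> (X @^-1` A).
Proof.
move=> [fX mX].
have -> : X @^-1` A = \bigcup_(u in range X `&` A) X @^-1` [set u].
  apply/seteqP; split => [w Aw|w [u [_ Au] /= ->//]].
  by exists (X w) => //; split => //; exists w.
have := @fin_bigcup_measurable _ (g_sigma_algebraType G) _ (range X `&` A)
  (fun u => X @^-1` [set u]).
by apply => [|u _]; [exact: finite_setIl|exact: mX].
Qed.

Lemma fin_measurable_comp {U U' : Type} (X : Om -> U) (f : U -> U') :
  fin_measurable X -> fin_measurable (fun w => f (X w)).
Proof.
move=> fmX; split.
  have -> : range (fun w => f (X w)) = f @` range X.
    by rewrite image_comp.
  by apply: finite_image; case: fmX.
by move=> u; exact: (fin_measurable_preimage (f @^-1` [set u]) fmX).
Qed.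

Lemma fin_measurable_pair {U U' : Type} (X : Om -> U) (Y : Om -> U') :
  fin_measurable X -> fin_measurable Y -> fin_measurable (fun w => (X w, Y w)).
Proof.
move=> [fX mX] [fY mY]; split.
  apply: (sub_finite_set _ (finite_setX fX fY)).
  by move=> _ [w _ <-]; split => /=; exists w.
move=> [u v].
have -> : (fun w => (X w, Y w)) @^-1` [set (u, v)] = X @^-1` [set u] `&` Y @^-1` [set v].
  by apply/seteqP; split => [w [<- <-]//|w [/= -> ->]].
exact: (@measurableI _ (g_sigma_algebraType G) _ _ (mX u) (mY v)).
Qed.

Lemma fin_measurable_cst {U : Type} (u : U) : fin_measurable (fun _ => u).
Proof.
split.
  apply: (sub_finite_set _ (finite_set1 u)) => _ [w _ <-] //.
move=> v; rewrite preimage_cst; case: ifP => _.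
  exact: (@measurableT _ (g_sigma_algebraType G)).
exact: (@measurable0 _ (g_sigma_algebraType G)).
Qed.

Lemma fin_measurable_sum {V : zmodType} {I : eqType} (s : seq I) (X : I -> Om -> V) :
  (forall i, i \in s -> fin_measurable (X i)) -> fin_measurable (fun w => \sum_(i <- s) X i w).
Proof.
elim: s => [|i s IH] mX.
  have -> : (fun w => \sum_(i <- [::]) X i w) = (fun _ => 0).
    by apply/funext => w; rewrite big_nil.
  exact: fin_measurable_cst.
have -> : (fun w => \sum_(j <- i :: s) X j w) = (fun w => X i w + \sum_(j <- s) X j w).
  by apply/funext => w; rewrite big_cons.
apply: (@fin_measurable_comp _ _ (fun w => (X i w, \sum_(j <- s) X j w)) (fun z => z.1 + z.2)).
apply: fin_measurable_pair; first by apply: mX; rewrite mem_head.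
by apply: IH => j js; apply: mX; rewrite in_cons js orbT.
Qed.

Lemma fin_measurable_fun (X : Om -> R) : fin_measurable X ->
  measurable_fun setT (X : g_sigma_algebraType G -> R).
Proof. by move=> mX _ A _; rewrite setTI; exact: fin_measurable_preimage. Qed.

End FinitelyValued.

Section StageRecursion.
Context {R : realType}.
Variables (K : nat) (a phi D : nat -> R) (b B : R).
Hypotheses (K0 : (0 < K)%N) (b0 : 0 <= b) (B0 : 0 <= B)
  (a0 : forall k, (1 <= k <= K)%N -> 0 <= a k)
  (phi0 : forall k, (1 <= k <= K)%N -> 0 <= phi k)
  (Db : forall k, (1 <= k <= K)%N -> D k <= b)
  (DK : 0 <= D K.+1)
  (descent : forall k, (1 <= k <= K)%N -> a k <= D k - D k.+1 + phi k)
  (accuracy : forall k, (1 <= k <= K)%N -> phi k <= a k / 2 + B / k%:R).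

Let stage_le k : (1 <= k <= K)%N -> a k + phi k <= 3 * (D k - D k.+1) + 4 * B * k%:R^-1.
Proof.
by move=> kK; have := descent kK; have := accuracy kK; have := a0 kK; have := phi0 kK; lra.
Qed.

Lemma weighted_stage_le (w : nat -> R) : nondecreasing_seq w -> w 0%N = 0 ->
  \sum_(1 <= k < K.+1) w k * (a k + phi k) <=
  3 * b * w K + 4 * B * \sum_(1 <= k < K.+1) w k / k%:R.
Proof.
move=> mw w0; have wge0 k : 0 <= w k by rewrite -w0 mw.
apply: le_trans (_ : \sum_(1 <= k < K.+1)
    (3 * (w k * (D k - D k.+1)) + 4 * B * (w k / k%:R)) <= _).
  rewrite big_nat_cond [leRHS]big_nat_cond; apply: ler_sum => k; rewrite andbT => kK.
  have := ler_wpM2l (wge0 k) (stage_le kK); rewrite mulrDr.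
  by move=> h; apply: le_trans h _; apply: le_of_eq; ring.
rewrite big_split/= -!mulr_sumr lerD2r.
have := telescope_weighted_le mw Db w0.
have : 0 <= w K * D K.+1 by rewrite mulr_ge0.
by lra.
Qed.

Lemma powR_average_le (al : R) : 1 <= al ->
  \sum_(1 <= k < K.+1) (k%:R `^ al / \sum_(1 <= j < K.+1) j%:R `^ al) * a k
  <= 2 * 2 `^ al * (3 * b + 4 * B) / K%:R.
Proof.
move=> al1; have al0 : 0 <= al by apply: le_trans al1.
have mw : nondecreasing_seq (fun k : nat => k%:R `^ al : R).
  by move=> i j ij; rewrite ge0_ler_powR ?nnegrE ?ler0n// ler_nat.
have w0 : (0%N%:R : R) `^ al = 0 by rewrite powR0// gt_eqF// (lt_le_trans ltr01).
have := weighted_stage_le mw w0.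
have K0' : 0 < (K%:R : R) by rewrite ltr0n.
have : \sum_(1 <= k < K.+1) (k%:R `^ al / k%:R : R) <= K%:R `^ al.
  apply: le_trans (_ : \sum_(1 <= k < K.+1) (K%:R `^ al / K%:R : R) <= _); last first.
    by rewrite sumr_const_nat subn1 /= -[leLHS]mulr_natr divfK ?gt_eqF.
  rewrite big_nat_cond [leRHS]big_nat_cond; apply: ler_sum => k; rewrite andbT => /andP[k1 kK].
  have k0 : 0 < (k%:R : R) by rewrite ltr0n.
  have E (t : R) : 0 < t -> t `^ al / t = t `^ (al - 1).
    by move=> t0; rewrite powRB ?powRr1 ?(ltW t0)// (gt_eqF t0) implybT.
  by rewrite !E// ge0_ler_powR ?nnegrE ?ler0n ?subr_ge0// ler_nat.
have := sum_powR_ge al0 K0.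
set S := \sum_(1 <= j < K.+1) j%:R `^ al => hS h1 h2.
have W0 : 0 < (K%:R : R) `^ al by rewrite powR_gt0.
have S0 : 0 < S.
  have : 0 < 2 * 2 `^ al * S by apply: lt_le_trans hS; rewrite mulr_gt0.
  by rewrite pmulr_rgt0// mulr_gt0// powR_gt0.
under eq_bigr do rewrite mulrAC.
rewrite -mulr_suml ler_pdivrMr//.
have h3 : \sum_(1 <= k < K.+1) k%:R `^ al * a k <= (3 * b + 4 * B) * K%:R `^ al.
  apply: le_trans (_ : \sum_(1 <= k < K.+1) k%:R `^ al * (a k + phi k) <= _).
    rewrite big_nat_cond [leRHS]big_nat_cond; apply: ler_sum => k; rewrite andbT => kK.
    by rewrite ler_wpM2l ?powR_ge0// lerDl phi0.
  have : 4 * B * \sum_(1 <= k < K.+1) (k%:R `^ al / k%:R : R) <= 4 * B * K%:R `^ al.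
    by rewrite ler_wpM2l// mulr_ge0.
  by lra.
apply: le_trans h3 _.
rewrite [leRHS]mulrAC ler_pdivlMr//.
have c0 : 0 <= 3 * b + 4 * B by rewrite addr_ge0// mulr_ge0.
by have := ler_wpM2l c0 hS; lra.
Qed.

Lemma sqrt_sum_le :
  \sum_(1 <= k < K.+1) Num.sqrt k%:R * (a k + phi k) <= (3 * b + 8 * B) * Num.sqrt K%:R.
Proof.
have mw : nondecreasing_seq (fun k : nat => Num.sqrt k%:R : R).
  by move=> i j ij; rewrite ler_sqrt ?ler0n// ler_nat.
apply: le_trans (weighted_stage_le mw _) _; first by rewrite sqrtr0.
have : \sum_(1 <= k < K.+1) (Num.sqrt k%:R / k%:R : R) <= 2 * Num.sqrt K%:R.
  apply: le_trans (sum_inv_sqrt_le K).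
  rewrite big_nat_cond [leRHS]big_nat_cond; apply: ler_sum => k; rewrite andbT => /andP[k1 _].
  have s0 : Num.sqrt (k%:R : R) != 0 by rewrite gt_eqF// sqrtr_gt0 ltr0n.
  by rewrite -{2}(sqr_sqrtr (ler0n _ k)) expr2 invfM mulrA mulfV// mul1r.
move=> /(ler_wpM2l (mulr_ge0 (ler0n R 4) B0)); lra.
Qed.

End StageRecursion.

Section RandomIndex.
Context {R : realType} {dO : measure_display} {Om : measurableType dO} (P : probability Om R).
Local Open Scope ereal_scope.

(* [f] will be the distance to the Frechet subdifferential at the output, which need not be
   measurable; its integral is still a supremum over simple functions below it. *)
Lemma le_integral_nonmeasurable (f g : Om -> \bar R) :
  (forall w, 0 <= f w) -> (forall w, f w <= g w) ->
  \int[P]_w f w <= \int[P]_w g w.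
Proof.
move=> f0 fg; have g0 w : 0 <= g w by exact: le_trans (f0 w) (fg w).
rewrite !ge0_integralTE//; apply: ereal_sup_le => _ [h hf <-]; exists h => // w.
exact: le_trans (hf w) (fg w).
Qed.

Variables (al : R) (K : nat) (tau : Om -> nat) (G : set (set Om)).
Hypotheses (tau_law : index_law P al K tau)
  (Gm : <<s G >> `<=` measurable)
  (indG : forall A B, <<s G >> A -> P (A `&` tau @^-1` B) = P A * P (tau @^-1` B)).

Let p k : R := (k%:R `^ al / \sum_(1 <= j < K.+1) j%:R `^ al)%R.

Let mtau : measurable_fun setT tau. Proof. by case: tau_law. Qed.

Lemma measurable_sub_sigma (u : Om -> R) :
  measurable_fun setT (u : g_sigma_algebraType G -> R) -> measurable_fun setT u.
Proof. by move=> mu mT A mA; apply: Gm; exact: mu. Qed.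

Let tau_mixin := isMeasurableFun.Build _ _ _ _ tau mtau.
Let tau' : {mfun Om >-> nat} := HB.pack tau tau_mixin.

Lemma integral_random_index (u : Om -> R) k : (1 <= k <= K)%N ->
  measurable_fun setT (u : g_sigma_algebraType G -> R) -> (forall w, 0 <= u w)%R ->
  \int[P]_w ((tau w == k)%:R * u w)%:E = (p k)%:E * \int[P]_w (u w)%:E.
Proof.
move=> kK mu u0; have [_ _ pk] := tau_law.
pose f (z : g_sigma_algebraType G * nat) : \bar R := ((z.2 == k)%:R * u z.1)%:E.
have mid : measurable_fun setT (id : Om -> g_sigma_algebraType G).
  by move=> _ A mA; rewrite setTI preimage_id; exact: Gm.
have mk : measurable_fun setT (fun z : g_sigma_algebraType G * nat => (z.2 == k)%:R : R).
  have mk1 : measurable_fun setT (fun n : nat => (n == k)%:R : R) by [].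
  exact: (measurableT_comp mk1 measurable_snd).
have mf : measurable_fun setT f.
  apply/measurable_EFinP; apply: measurable_funM => //.
  exact: (measurableT_comp mu measurable_fst).
have f0 z : 0 <= f z by rewrite lee_fin mulr_ge0.
have ind A B : measurable A -> measurable B ->
    P ((id : Om -> g_sigma_algebraType G) @^-1` A `&` tau @^-1` B) =
    P ((id : Om -> g_sigma_algebraType G) @^-1` A) * distribution P tau' B.
  by move=> mA _; rewrite !preimage_id; exact: indG.
have /= -> := freezing_ge0 mid mtau ind mf f0.
have p0 : (0 <= p k)%R by rewrite divr_ge0 ?powR_ge0// sumr_ge0// => j _; exact: powR_ge0.
have muP : measurable_fun setT (EFin \o u) by apply/measurable_EFinP; exact: measurable_sub_sigma.
have u0' w : setT w -> 0 <= (EFin \o u) w by move=> _; rewrite lee_fin.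
rewrite -(ge0_integralZl_EFin P measurableT u0' muP p0).
apply: eq_integral => w _; rewrite /f /=.
have -> : (fun t : nat => ((t == k)%:R * u w)%:E) = (fun t => (u w)%:E * (\1_[set k] t)%:E).
  apply/funext => t; rewrite indicE mulrC EFinM.
  by have -> : (t \in [set k]) = (t == k) by apply/idP/eqP; rewrite inE.
rewrite ge0_integralZl_EFin//.
rewrite integral_indic// setIT muleC /p -(pk k kK).
by [].
Qed.

Lemma random_index_integral_le (f : Om -> \bar R) (u : nat -> Om -> R) :
  (forall k, (1 <= k <= K)%N -> measurable_fun setT (u k : g_sigma_algebraType G -> R)) ->
  (forall k w, (1 <= k <= K)%N -> 0 <= u k w)%R ->
  (forall w, 0 <= f w) ->
  (forall w, f w <= (u (tau w) w)%:E) ->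
  \int[P]_w f w <= \sum_(1 <= k < K.+1) (p k)%:E * \int[P]_w (u k w)%:E.
Proof.
move=> mu u0 f0 fu; have [_ tK _] := tau_law.
have -> : \sum_(1 <= k < K.+1) (p k)%:E * \int[P]_w (u k w)%:E =
    \int[P]_w \sum_(k <- index_iota 1 K.+1) ((tau w == k)%:R * (if (1 <= k <= K)%N then u k w else 0%R))%:E.
  rewrite ge0_integral_sum//.
  - rewrite big_nat_cond [RHS]big_nat_cond; apply: eq_bigr => k /andP[kK _].
    rewrite -integral_random_index//.
    + by apply: eq_integral => w _; rewrite kK.
    + exact: mu.
    + by move=> w; exact: u0.
  - move=> k; apply/measurable_EFinP; apply: measurable_funM.
      have mk1 : measurable_fun setT (fun n : nat => (n == k)%:R : R) by [].
      exact: (measurableT_comp mk1 mtau).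
    case kK : (1 <= k <= K)%N; last exact: measurable_cst.
    by apply: measurable_sub_sigma; exact: mu.
  - by move=> k w _; rewrite lee_fin mulr_ge0//; case: ifP => // kK; exact: u0.
apply: le_integral_nonmeasurable => // w; apply: le_trans (fu w) _.
have ti : tau w \in index_iota 1 K.+1 by rewrite mem_index_iota; exact: tK.
rewrite (bigD1_seq _ ti (iota_uniq _ _)) /=.
rewrite eqxx mul1r tK leeDl// sume_ge0// => k _.
by rewrite lee_fin mulr_ge0//; case: ifP => // kK; exact: u0.
Qed.

End RandomIndex.

(* [b] bounds the mean excess F(x_k) - inf F, [B / k] is the additive error of the inner solver,
   and [Cs], [CK], [CQ] express that 1/mu, K and eps are balanced. *)
Definition rate_const {R : realType} (L al b B Cs CK c0 M0 CQ : R) : R :=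
  let CA := 2 * 2 `^ al * (3 * b + 4 * B) * CK in
  let C1 := M0 + (1 + 2 * L + c0 + (1 + L) * Cs * CA + 2 * L * ((2 * (3 * b + 8 * B) + 1) * CQ)) in
  C1 + (1 + 2 * L + 2 * L * C1 + (1 + L) * Cs * CA).

Section RandomStageRates.
Context {R : realType} {d : nat} {dO : measure_display} {Om : measurableType dO}
  (P : probability Om R).
Local Notation V := 'rV[R]_d.
Context {L nu : R} {g h : V -> R} {r : V -> \bar R} {p : R -> V -> V}.
Hypothesis Hdc : dc_problem L nu g h r p.
Variables (al : R) (K : nat) (tau : Om -> nat) (G : set (set Om)).
Hypotheses (al1 : 1 <= al) (K0 : (0 < K)%N) (tau_law : index_law P al K tau)
  (Gm : <<s G >> `<=` measurable)
  (indG : forall A B, <<s G >> A -> (P (A `&` tau @^-1` B) = P A * P (tau @^-1` B))%E).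
Variables (eps mu : R) (gamma : nat -> R) (x : nat -> Om -> V) (x0 : V) (m b B Cs CK : R).
Definition stage_start_gap k w := @start_gap R d g h p mu (gamma k) (x k w).
Definition stage_end_gap k w := @end_gap R d g h p mu (gamma k) (x k w) (x k.+1 w).
Definition stage_excess k w := @smoothed_real R d g h r p mu (x k w) - m.
Local Notation A := stage_start_gap.
Local Notation Phi := stage_end_gap.
Local Notation Dl := stage_excess.
Local Notation z k w := (@dc_stage_sol R d g h p mu (gamma k) (x k w)).
Hypotheses (eps0 : 0 < eps) (eps1 : eps < 1) (mu0 : 0 < mu) (mueps : mu <= eps)
  (gamma0 : forall k, 0 <= gamma k) (hx0 : forall w, x 1%N w = x0)
  (hm : forall y, m <= @smoothed_real R d g h r p mu y)
  (mA : forall k, (1 <= k <= K)%N -> measurable_fun setT (A k : g_sigma_algebraType G -> R))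
  (mPhi : forall k, (1 <= k <= K)%N -> measurable_fun setT (Phi k : g_sigma_algebraType G -> R))
  (mD : forall k, (1 <= k <= K.+1)%N -> measurable_fun setT (Dl k : g_sigma_algebraType G -> R))
  (stage : forall k, (1 <= k <= K)%N -> P.-integrable setT (EFin \o A k) ->
     P.-integrable setT (EFin \o Phi k) /\
     \int[P]_w Phi k w <= (\int[P]_w A k w) / 2 + B / k%:R)
  (Db : forall k, (1 <= k <= K)%N -> (\int[P]_w (Dl k w)%:E <= b%:E)%E)
  (b0 : 0 <= b) (B0 : 0 <= B) (Cs0 : 0 <= Cs)
  (sigma_le : forall k, (1 <= k <= K)%N -> gamma k + mu^-1 <= Cs / mu)
  (K_ge : K%:R^-1 <= CK * (mu * eps `^ (2 * nu))).

Let stage_z k w : stage_grad g mu (gamma k) (@dc_slope R d h p mu (x k w)) (x k w) (z k w) = 0.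
Proof. exact: (dc_stage_solP Hdc). Qed.

Let A_ge k w : (gamma k + mu^-1) / 2 * enorm (x k w - z k w) ^+ 2 <= A k w.
Proof. exact: (start_gap_ge Hdc). Qed.

Let Phi_ge k w : (gamma k + mu^-1) / 2 * enorm (x k.+1 w - z k w) ^+ 2 <= Phi k w.
Proof. exact: (end_gap_ge Hdc). Qed.

Let A0 k w : 0 <= A k w.
Proof. exact: (start_gap_ge0 Hdc). Qed.

Let Phi0 k w : 0 <= Phi k w.
Proof. exact: (end_gap_ge0 Hdc). Qed.

Let Dl0 k w : 0 <= Dl k w.
Proof. by rewrite subr_ge0. Qed.

Let pathwise_descent k w : A k w <= Dl k w - Dl k.+1 w + Phi k w.
Proof.
have := gap_descent Hdc (x k w) (x k.+1 w) mu0 (gamma0 k).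
by rewrite /stage_start_gap /stage_excess /stage_end_gap; lra.
Qed.

Let iA_of k : (1 <= k <= K)%N -> P.-integrable setT (EFin \o Dl k) ->
  P.-integrable setT (EFin \o A k).
Proof.
move=> kK iD; apply: integrable_dominated iD _ => [|w]; first exact: (measurable_sub_sigma Gm (mA kK)).
by rewrite ger0_norm//; exact: (start_gap_le Hdc).
Qed.

Let iD k : (1 <= k <= K.+1)%N -> P.-integrable setT (EFin \o Dl k).
Proof.
elim: k => [//|k IH] /andP[_]; rewrite ltnS => kK.
case: (posnP k) => [->|k0].
  have -> : Dl 1%N = cst (@smoothed_real R d g h r p mu x0 - m).
    by apply/funext => w; rewrite /stage_excess hx0.
  exact: finite_measure_integrable_cst.
have kK' : (1 <= k <= K)%N by rewrite k0.
have {}IH : P.-integrable setT (EFin \o Dl k) by apply: IH; rewrite k0 ltnW.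
have [iPhi _] := stage kK' (iA_of kK' IH).
apply: integrable_dominated (integrableD measurableT IH iPhi) _ => [|w].
  by apply: (measurable_sub_sigma Gm (mD (k := k.+1) _)); rewrite ltnS.
rewrite ger0_norm// ; have := pathwise_descent k w; have := A0 k w; lra.
Qed.

Let iA k : (1 <= k <= K)%N -> P.-integrable setT (EFin \o A k).
Proof. by move=> kK; apply: iA_of => //; apply: iD; case/andP: kK => -> /leqW ->. Qed.

Let iPhi k (kK : (1 <= k <= K)%N) : P.-integrable setT (EFin \o Phi k) := (stage kK (iA kK)).1.
Let accuracy k (kK : (1 <= k <= K)%N) := (stage kK (iA kK)).2.
Let D k := \int[P]_w Dl k w.

Let D_le k : (1 <= k <= K)%N -> D k <= b.
Proof.
move=> kK; have kK' : (1 <= k <= K.+1)%N by case/andP: kK => -> /leqW ->.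
by rewrite -lee_fin fineK; [exact: Db|exact: (integrable_fin_num measurableT (iD kK'))].
Qed.

Let DK : 0 <= D K.+1.
Proof. exact: Rintegral_ge0. Qed.

Let descent k : (1 <= k <= K)%N -> \int[P]_w A k w <= D k - D k.+1 + \int[P]_w Phi k w.
Proof.
move=> kK; have /andP[k1 kK1] := kK.
have i1 := iD (k := k) ltac:(by rewrite k1 ltnW).
have i2 := iD (k := k.+1) ltac:(by rewrite ltnS).
rewrite -(RintegralB measurableT i1 i2).
have i4 : P.-integrable setT (EFin \o (fun w => Dl k w - Dl k.+1 w)).
  exact: (integrableB measurableT i1 i2).
rewrite -(RintegralD measurableT i4 (iPhi kK)); apply: le_Rintegral => //.
  exact: iA.
exact: (integrableD measurableT i4 (iPhi kK)).
Qed.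

Let EA0 k : (1 <= k <= K)%N -> 0 <= \int[P]_w A k w.
Proof. by move=> kK; apply: Rintegral_ge0 => w _; exact: A0. Qed.

Let EPhi0 k : (1 <= k <= K)%N -> 0 <= \int[P]_w Phi k w.
Proof. by move=> kK; apply: Rintegral_ge0 => w _; exact: Phi0. Qed.

Let CA := 2 * 2 `^ al * (3 * b + 4 * B) * CK.

Let EA_le : \sum_(1 <= k < K.+1) (k%:R `^ al / \sum_(1 <= j < K.+1) j%:R `^ al) * \int[P]_w A k w
  <= CA * (mu * eps `^ (2 * nu)).
Proof.
apply: le_trans (powR_average_le K0 b0 B0 EA0 EPhi0 D_le DK descent accuracy al1) _.
rewrite /CA -[leRHS]mulrA; apply: ler_wpM2l K_ge.
by rewrite mulr_ge0 ?addr_ge0 ?mulr_ge0// powR_ge0.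
Qed.

Let prob k : R := k%:R `^ al / \sum_(1 <= j < K.+1) j%:R `^ al.

Let S0 : 0 < \sum_(1 <= j < K.+1) (j%:R `^ al : R).
Proof.
rewrite (big_ltn (n := K.+1))// ltr_pwDl// ?powR_gt0//.
by apply: sumr_ge0 => j _; exact: powR_ge0.
Qed.

Let prob_sum : \sum_(1 <= k < K.+1) prob k = 1.
Proof. by rewrite -mulr_suml divff// gt_eqF. Qed.

Lemma random_stage_integral_le (a e c : R) (W : Om -> R) (f : Om -> \bar R) :
  0 <= a -> 0 <= e -> 0 <= c -> (forall w, 0 <= W w) ->
  measurable_fun setT (W : g_sigma_algebraType G -> R) -> P.-integrable setT (EFin \o W) ->
  (forall w, 0 <= f w)%E ->
  (forall w, f w <= (a + e * A (tau w) w + c * W w)%:E)%E ->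
  (\int[P]_w f w <= (a + e * (\sum_(1 <= k < K.+1) prob k * \int[P]_w A k w)
     + c * \int[P]_w W w)%:E)%E.
Proof.
move=> a0 e0 c0 W0 mW iW f0 fu.
pose u k w := a + e * A k w + c * W w.
apply: le_trans (@random_index_integral_le _ _ _ P al K tau G tau_law Gm indG f u _ _ f0 fu) _.
- move=> k kK; apply: measurable_funD; last exact: measurable_funM.
  by apply: measurable_funD => //; apply: measurable_funM => //; exact: mA.
- by move=> k w kK; rewrite !addr_ge0// mulr_ge0// A0.
have uE k : (1 <= k <= K)%N ->
    (\int[P]_w (u k w)%:E = (a + e * \int[P]_w A k w + c * \int[P]_w W w)%:E)%E.
  move=> kK.
  have i1 : P.-integrable setT (EFin \o (fun w => e * A k w)).
    exact: (integrableZl measurableT e (iA kK)).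
  have i2 : P.-integrable setT (EFin \o (fun w => c * W w)).
    exact: (integrableZl measurableT c iW).
  have i0 : P.-integrable setT (EFin \o (fun _ : Om => a)).
    exact: finite_measure_integrable_cst.
  have i3 : P.-integrable setT (EFin \o (fun w => a + e * A k w)).
    exact: (integrableD measurableT i0 i1).
  have i4 : P.-integrable setT (EFin \o u k).
    exact: (integrableD measurableT i3 i2).
  rewrite -[LHS]fineK; last exact: (integrable_fin_num measurableT i4).
  congr (_%:E); rewrite -[LHS]/(\int[P]_w u k w) /u RintegralD// RintegralD//.
  rewrite (RintegralZl e measurableT (iA kK)) (RintegralZl c measurableT iW).
  by rewrite Rintegral_prob_cst.
rewrite big_nat_cond (eq_bigr (fun k => (prob k * (a + e * \int[P]_w A k w + c * \int[P]_w W w))%:E)).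
  rewrite -big_nat_cond sumEFin lee_fin; apply: le_of_eq.
  under eq_bigr do rewrite !mulrDr.
  have sc (t : R) : \sum_(1 <= k < K.+1) prob k * t = t by rewrite -mulr_suml prob_sum mul1r.
  rewrite !big_split/= !sc; congr (_ + _ + _).
  by rewrite mulr_sumr; apply: eq_bigr => k _; ring.
by move=> k /andP[kK _]; rewrite uE// EFinM.
Qed.

Lemma sigma_dist_le k w : (1 <= k <= K)%N ->
  (gamma k + mu^-1) * enorm (x k w - z k w) <= eps `^ nu + Cs / (mu * eps `^ nu) * A k w.
Proof.
move=> kK; have e0 : 0 < eps `^ nu by exact: powR_gt0.
set s := gamma k + mu^-1; set t := enorm _.
have s0 : 0 <= s by rewrite addr_ge0// invr_ge0 ltW.
have h1 : s * t <= eps `^ nu + (s * (s / 2 * t ^+ 2)) / eps `^ nu.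
  move: e0; clearbody s t; move: (eps `^ nu) => e e0.
  rewrite -(ler_pM2r e0) mulrDl divfK ?gt_eqF//.
  have := sqr_ge0 (s * t - e); have := sqr_ge0 e; rewrite !expr2; lra.
apply: le_trans h1 _; rewrite lerD2l.
have -> : Cs / (mu * eps `^ nu) * A k w = (Cs / mu * A k w) / eps `^ nu.
  by field; rewrite !gt_eqF.
rewrite ler_pM2r ?invr_gt0//.
apply: ler_pM; [exact: s0|by rewrite mulr_ge0 ?sqr_ge0// divr_ge0| exact: sigma_le|exact: A_ge].
Qed.

Section RandomStageMeans.
Variables (a1 b1 c1 C1 : R) (W : Om -> R).
Let EA := \sum_(1 <= k < K.+1) prob k * \int[P]_w A k w.
Hypotheses (a1_ge0 : 0 <= a1) (b1_ge0 : 0 <= b1) (c1_ge0 : 0 <= c1) (W_ge0 : forall w, 0 <= W w)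
  (mW : measurable_fun setT (W : g_sigma_algebraType G -> R))
  (iW : P.-integrable setT (EFin \o W))
  (disp : forall k w, (1 <= k <= K)%N ->
     enorm (x k w - p mu (x k w)) <= a1 + b1 * A k w + c1 * W w)
  (disp_mean : a1 + b1 * EA + c1 * \int[P]_w W w <= C1 * eps).

Lemma random_stage_displacement_mean :
  (\int[P]_w (enorm (x (tau w) w - p mu (x (tau w) w)))%:E <= (C1 * eps)%:E)%E.
Proof.
have [_ tK _] := tau_law.
have : (\int[P]_w (enorm (x (tau w) w - p mu (x (tau w) w)))%:E <=
   (a1 + b1 * EA + c1 * \int[P]_w W w)%:E)%E.
  apply: random_stage_integral_le => // w; first by rewrite lee_fin enorm_ge0.
  by rewrite lee_fin disp.
by move=> h1; apply: le_trans h1 _; rewrite lee_fin.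
Qed.

Lemma random_stage_dist_mean :
  (\int[P]_w set_dist [set grad h (p mu (x (tau w) w))]
     [set (grad g (p mu (x (tau w) w)) + v)%R | v in frechet_subdiff r (p mu (x (tau w) w))]
   <= ((1 + 2 * L + 2 * L * C1 + (1 + L) * Cs * CA) * eps `^ nu)%:E)%E.
Proof.
have [_ tK _] := tau_law.
have L0 := dc_L_gt0 Hdc; have /andP[nu0 nu1] := dc_nu Hdc.
have e0 : 0 < eps `^ nu by exact: powR_gt0.
pose c := L * (eps `^ nu / eps) + L.
have [L0' e0' eps0' mu0'] := And4 (ltW L0) (ltW e0) (ltW eps0) (ltW mu0).
have c_ge0 : 0 <= c by rewrite addr_ge0// mulr_ge0// divr_ge0.
have q_ge0 : 0 <= Cs / (mu * eps `^ nu) by rewrite divr_ge0// mulr_ge0.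
pose a := L * eps `^ nu + c * a1 + (1 + L) * eps `^ nu.
pose e := c * b1 + (1 + L) * (Cs / (mu * eps `^ nu)).
have L1_ge0 : 0 <= 1 + L by rewrite addr_ge0.
have a_ge0 : 0 <= a by rewrite /a !addr_ge0// mulr_ge0.
have e_ge0 : 0 <= e by rewrite /e addr_ge0// mulr_ge0.
have : (\int[P]_w set_dist [set grad h (p mu (x (tau w) w))]
     [set (grad g (p mu (x (tau w) w)) + v)%R | v in frechet_subdiff r (p mu (x (tau w) w))]
   <= (a + e * EA + (c * c1) * \int[P]_w W w)%:E)%E.
  apply: random_stage_integral_le => //; first exact: mulr_ge0.
    move=> w; apply: le_ereal_inf_tmp => _ [? _ [? _ ->]].
    by rewrite lee_fin enorm_ge0.
  move=> w; have kK := tK w; set k := tau w in kK *.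
  apply: le_trans (stationarity_dist_le Hdc mu0 (gamma0 k) (stage_z k w)) _.
  rewrite lee_fin.
  set t := enorm (x k w - p mu (x k w)); set s := enorm (x k w - z k w).
  have t0 : 0 <= t by exact: enorm_ge0.
  have h1 : L * t `^ nu <= L * (eps `^ nu + eps `^ nu / eps * t).
    rewrite ler_pM2l//.
    have -> : t = eps * (t / eps) by field; rewrite gt_eqF.
    rewrite powRM ?divr_ge0// ?(ltW eps0)//.
    have -> : eps `^ nu + eps `^ nu / eps * (eps * (t / eps)) = eps `^ nu * (1 + t / eps).
      by field; rewrite gt_eqF.
    by rewrite ler_pM2l// powR_le1D ?divr_ge0// ?(ltW nu0)// ltW.
  have h2 := sigma_dist_le w kK; rewrite -/s in h2.
  have h3 : c * t <= c * (a1 + b1 * A k w + c1 * W w) by rewrite ler_wpM2l// disp.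
  have s0 : 0 <= s by exact: enorm_ge0.
  have h4 : L * s <= L * ((gamma k + mu^-1) * s).
    rewrite ler_pM2l// ler_peMl// ler_wpDl//.
    by rewrite invf_ge1// (le_trans mueps)// ltW.
  have h5 : (1 + L) * ((gamma k + mu^-1) * s) <=
      (1 + L) * (eps `^ nu + Cs / (mu * eps `^ nu) * A k w).
    by rewrite ler_wpM2l// addr_ge0// ltW.
  have k1 : L * t `^ nu + L * t <= L * eps `^ nu + c * (a1 + b1 * A k w + c1 * W w).
    apply: le_trans (lerD h1 (lexx _)) _; apply: le_trans (lerD (lexx _) h3).
    by apply: le_of_eq; rewrite /c; ring.
  have k2 : (L + gamma k + mu^-1) * s <=
      (1 + L) * (eps `^ nu + Cs / (mu * eps `^ nu) * A k w).
    apply: le_trans h5; rewrite -addrA mulrDl.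
    by apply: le_trans (lerD h4 (lexx _)) _; apply: le_of_eq; ring.
  apply: le_trans (lerD k1 k2) _.
  by apply: le_of_eq; rewrite /a /e; ring.
move=> hI; apply: le_trans hI _; rewrite lee_fin.
have C1e : c * (a1 + b1 * EA + c1 * \int[P]_w W w) <= c * (C1 * eps) by rewrite ler_wpM2l.
have h1 : (1 + L) * (Cs / (mu * eps `^ nu) * EA) <= (1 + L) * (Cs * CA * eps `^ nu).
  rewrite ler_wpM2l ?addr_ge0 ?(ltW L0)//.
  apply: le_trans (ler_wpM2l q_ge0 EA_le) _.
  have -> : eps `^ (2 * nu) = eps `^ nu * eps `^ nu.
    by rewrite -powRD ?mulr_natl ?mulr2n// (gt_eqF eps0) implybT.
  by apply: le_of_eq; field; rewrite !gt_eqF.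
have h2 : eps <= eps `^ nu by rewrite ger1_powR// eps0 ltW.
have C10 : 0 <= C1.
  have : 0 <= C1 * eps.
    apply: le_trans disp_mean; rewrite !addr_ge0// mulr_ge0//.
      rewrite /EA big_nat_cond sumr_ge0// => k; rewrite andbT => kK.
      by rewrite mulr_ge0 ?EA0// divr_ge0 ?powR_ge0// ltW.
    exact: Rintegral_ge0.
  by rewrite pmulr_lge0.
have h3 : c * (C1 * eps) <= 2 * L * C1 * eps `^ nu.
  have -> : c * (C1 * eps) = L * C1 * (eps `^ nu + eps) by rewrite /c; field; rewrite gt_eqF.
  have : L * C1 * (eps `^ nu + eps) <= L * C1 * (eps `^ nu + eps `^ nu).
    by rewrite ler_wpM2l ?mulr_ge0 ?(ltW L0)// lerD2l.
  by lra.
rewrite /a /e; lra.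
Qed.

Lemma random_stage_near_stationary M :
  C1 <= M -> 1 + 2 * L + 2 * L * C1 + (1 + L) * Cs * CA <= M ->
  near_stationary P g h r (p mu) nu eps M tau x.
Proof.
move=> C1M CM; split.
  apply: le_trans random_stage_displacement_mean _.
  by rewrite lee_fin ler_wpM2r// ltW.
apply: le_trans random_stage_dist_mean _.
by rewrite lee_fin ler_wpM2r// powR_ge0.
Qed.

End RandomStageMeans.

Lemma near_stationary_lipschitz (M0 M : R) : 0 <= M0 ->
  (forall y, enorm (y - p mu y) <= M0 * mu) ->
  M0 <= M -> 1 + 2 * L + 2 * L * M0 + (1 + L) * Cs * CA <= M ->
  near_stationary P g h r (p mu) nu eps M tau x.
Proof.
move=> M00 hM0 M0M CM.
have disp k w : (1 <= k <= K)%N -> enorm (x k w - p mu (x k w)) <= M0 * mu + 0 * A k w + 0 * cst 0 w.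
  by move=> _; rewrite !mul0r !addr0.
have mean : M0 * mu + 0 * (\sum_(1 <= k < K.+1)
    (k%:R `^ al / \sum_(1 <= j < K.+1) j%:R `^ al) * \int[P]_w A k w)
    + 0 * \int[P]_w (cst 0 w) <= M0 * eps.
  by rewrite !mul0r !addr0 ler_wpM2l.
have mc : measurable_fun setT (cst 0 : g_sigma_algebraType G -> R) by exact: measurable_cst.
have ic : P.-integrable setT (EFin \o (cst 0 : Om -> R)) by exact: integrable0.
have a0 : 0 <= M0 * mu by rewrite mulr_ge0// ltW.
have c0 (w : Om) : 0 <= (cst 0 w : R) by [].
exact: (random_stage_near_stationary a0 (lexx 0) (lexx 0) c0 mc ic disp mean).
Qed.

(* AM-GM with weights sqrt k bounds each step |x_{k+1} - x_k| by the k-th summand; [W] therefore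
   dominates |x_k - x_1| for all k at once, hence also at the random index. *)
Let W (w : Om) : R := \sum_(j < K)
  ((Num.sqrt j.+1%:R / eps) * (2 * mu * (A j.+1 w + Phi j.+1 w)) + eps / 2 / Num.sqrt j.+1%:R).

Let W_ge0 w : 0 <= W w.
Proof.
apply: sumr_ge0 => j _.
have jK : (1 <= j.+1 <= K)%N by rewrite /= ltn_ord.
rewrite addr_ge0// ?divr_ge0 ?sqrtr_ge0// ?(ltW eps0)//.
by rewrite !mulr_ge0 ?sqrtr_ge0 ?invr_ge0 ?(ltW eps0) ?(ltW mu0)// addr_ge0 ?A0 ?Phi0.
Qed.

Let mW : measurable_fun setT (W : g_sigma_algebraType G -> R).
Proof.
apply: measurable_sum => j; have jK : (1 <= j.+1 <= K)%N by rewrite /= ltn_ord.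
apply: measurable_funD => //; apply: measurable_funM => //; apply: measurable_funM => //.
by apply: measurable_funD; [exact: mA|exact: mPhi].
Qed.

Let int_W : P.-integrable setT (EFin \o W) /\
  \int[P]_w W w = \sum_(j < K)
    ((Num.sqrt j.+1%:R / eps) * (2 * mu * (\int[P]_w A j.+1 w + \int[P]_w Phi j.+1 w))
     + eps / 2 / Num.sqrt j.+1%:R).
Proof.
have ij (j : 'I_K) : P.-integrable setT (EFin \o (fun w =>
    ((Num.sqrt j.+1%:R / eps) * (2 * mu * (A j.+1 w + Phi j.+1 w)) + eps / 2 / Num.sqrt j.+1%:R)))
  /\ \int[P]_w ((Num.sqrt j.+1%:R / eps) * (2 * mu * (A j.+1 w + Phi j.+1 w)) + eps / 2 / Num.sqrt j.+1%:R)
  = (Num.sqrt j.+1%:R / eps) * (2 * mu * (\int[P]_w A j.+1 w + \int[P]_w Phi j.+1 w))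
     + eps / 2 / Num.sqrt j.+1%:R.
  have jK : (1 <= j.+1 <= K)%N by rewrite /= ltn_ord.
  have i0 (t : R) : P.-integrable setT (EFin \o (fun _ : Om => t)).
    exact: finite_measure_integrable_cst.
  have i1 : P.-integrable setT (EFin \o (fun w => A j.+1 w + Phi j.+1 w)).
    exact: (integrableD measurableT (iA jK) (iPhi jK)).
  have i2 : P.-integrable setT (EFin \o (fun w => 2 * mu * (A j.+1 w + Phi j.+1 w))).
    exact: (integrableZl measurableT (2 * mu) i1).
  have i3 : P.-integrable setT (EFin \o (fun w =>
     (Num.sqrt j.+1%:R / eps) * (2 * mu * (A j.+1 w + Phi j.+1 w)))).
    exact: (integrableZl measurableT (Num.sqrt j.+1%:R / eps) i2).
  split; first exact: (integrableD measurableT i3 (i0 _)).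
  rewrite (RintegralD measurableT i3 (i0 _)) (RintegralZl _ measurableT i2).
  rewrite (RintegralZl _ measurableT i1) (RintegralD measurableT (iA jK) (iPhi jK)).
  by rewrite Rintegral_prob_cst.
have [h1 h2] := Rintegral_sum (index_enum 'I_K) (fun j => (ij j).1).
split => //; rewrite [LHS]h2; apply: eq_bigr => j _; exact: (ij j).2.
Qed.

Let CS := 3 * b + 8 * B.

Let EW_le (CQ : R) : mu = eps ^+ 2 -> Num.sqrt K%:R <= CQ / eps ^+ 2 ->
  \int[P]_w W w <= (2 * CS + 1) * CQ / eps.
Proof.
move=> muE KQ; rewrite int_W.2 big_split/=.
have e1 : \sum_(j < K) (Num.sqrt j.+1%:R / eps) *
    (2 * mu * (\int[P]_w A j.+1 w + \int[P]_w Phi j.+1 w)) =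
    2 * eps * \sum_(1 <= k < K.+1) Num.sqrt k%:R * (\int[P]_w A k w + \int[P]_w Phi k w).
  rewrite big_add1 /= big_mkord mulr_sumr; apply: eq_bigr => j _.
  by rewrite muE; field; rewrite gt_eqF.
have e2 : \sum_(j < K) eps / 2 / Num.sqrt j.+1%:R =
    eps / 2 * \sum_(1 <= k < K.+1) (Num.sqrt k%:R)^-1.
  by rewrite big_add1 /= big_mkord mulr_sumr.
have h1 := sqrt_sum_le B0 EA0 EPhi0 D_le DK descent accuracy.
have h2 := @sum_inv_sqrt_le R K.
have CS0 : 0 <= CS by rewrite addr_ge0// mulr_ge0.
have h3 : eps * Num.sqrt K%:R <= CQ / eps.
  have -> : CQ / eps = eps * (CQ / eps ^+ 2) by field; rewrite gt_eqF.
  by rewrite ler_pM2l.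
have e0 := ltW eps0.
rewrite e1 e2.
have k1 := ler_wpM2l (mulr_ge0 (ler0n R 2) e0) h1.
have k2 := ler_wpM2l (divr_ge0 e0 (ler0n R 2)) h2.
have k3 := ler_wpM2l (addr_ge0 (mulr_ge0 (ler0n R 2) CS0) ler01) h3.
rewrite -/CS in k1; lra.
Qed.

Let step_le k w : (1 <= k <= K)%N -> enorm (x k.+1 w - x k w) <=
  (Num.sqrt k%:R / eps) * (2 * mu * (A k w + Phi k w)) + eps / 2 / Num.sqrt k%:R.
Proof.
move=> kK; have k0 : 0 < Num.sqrt (k%:R : R).
  by rewrite sqrtr_gt0 ltr0n; case/andP: kK.
have s0 : 0 < gamma k + mu^-1 by rewrite ltr_wpDl// invr_gt0.
have h1 : enorm (x k.+1 w - x k w) ^+ 2 <= 4 * mu * (A k w + Phi k w).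
  have e1 : x k.+1 w - x k w = (x k.+1 w - z k w) + (z k w - x k w) by rewrite addrA subrK.
  have h2 := enorm_sq_le2 (x k.+1 w - z k w) (z k w - x k w).
  rewrite -e1 (enormB (z k w)) in h2.
  have h3 := lerD (A_ge k w) (Phi_ge k w).
  have h4 : mu^-1 / 2 * (enorm (x k w - z k w) ^+ 2 + enorm (x k.+1 w - z k w) ^+ 2) <= A k w + Phi k w.
    apply: le_trans h3; rewrite -mulrDr ler_wpM2r ?addr_ge0 ?sqr_ge0// ler_pM2r ?invr_gt0//.
    by rewrite lerDr.
  have h5 : enorm (x k w - z k w) ^+ 2 + enorm (x k.+1 w - z k w) ^+ 2 <= 2 * mu * (A k w + Phi k w).
    rewrite -ler_pdivrMl ?mulr_gt0//; apply: le_trans h4.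
    by apply: le_of_eq; field; rewrite gt_eqF.
  by apply: le_trans h2 _; move: h5; lra.
set t := enorm _ in h1 *; set s := Num.sqrt _ in k0 *.
have h2 : t <= s / eps * (t ^+ 2 / 2) + eps / 2 / s.
  rewrite -subr_ge0.
  have -> : s / eps * (t ^+ 2 / 2) + eps / 2 / s - t = (s / eps * t - 1) ^+ 2 * (eps / (2 * s)).
    by field; rewrite !gt_eqF.
  by rewrite mulr_ge0 ?sqr_ge0// divr_ge0 ?(ltW eps0)// mulr_ge0// ltW.
apply: le_trans h2 _; rewrite lerD2r ler_pM2l ?divr_gt0//; move: h1; lra.
Qed.

Let drift_le k w : (1 <= k <= K)%N -> enorm (x k w - x 1%N w) <= W w.
Proof.
move=> kK; have jK (j : 'I_K) : (1 <= j.+1 <= K)%N by rewrite /= ltn_ord.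
have {kK} : (k.-1 <= K)%N /\ (0 < k)%N.
  by case/andP: kK => k1 kK; split => //; exact: leq_trans (leq_pred k) kK.
case: k => [[]//|k [kK _]] /=.
rewrite /W -(big_mkord xpredT (fun j : nat => (Num.sqrt j.+1%:R / eps) *
  (2 * mu * (A j.+1 w + Phi j.+1 w)) + eps / 2 / Num.sqrt j.+1%:R)).
rewrite (big_cat_nat (n := k))//=.
have t0 : 0 <= \sum_(k <= i < K) ((Num.sqrt i.+1%:R / eps) *
  (2 * mu * (A i.+1 w + Phi i.+1 w)) + eps / 2 / Num.sqrt i.+1%:R).
  rewrite big_nat_cond sumr_ge0// => i; rewrite andbT => /andP[_ iK].
  by apply: le_trans (step_le w _); rewrite ?enorm_ge0.
apply: ler_wpDr => //.
elim: k kK {t0} => [_|k IH kK]; first by rewrite subrr enorm0 big_geq.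
rewrite big_nat_recr//=.
apply: le_trans (enorm_triangle (x k.+1 w) _ _) _; rewrite [leLHS]addrC lerD//; first exact/IH/ltnW.
exact: step_le.
Qed.

Lemma near_stationary_drift (CQ M : R) :
  let C1 := 1 + 2 * L + enorm (grad h x0 - grad g x0) + (1 + L) * Cs * CA
    + 2 * L * ((2 * CS + 1) * CQ) in
  mu = eps ^+ 2 -> Num.sqrt K%:R <= CQ / eps ^+ 2 -> 0 <= CA ->
  C1 <= M -> 1 + 2 * L + 2 * L * C1 + (1 + L) * Cs * CA <= M ->
  near_stationary P g h r (p mu) nu eps M tau x.
Proof.
move=> C1 muE KQ CA0 C1M CM.
have L0 := dc_L_gt0 Hdc; have /andP[nu0 nu1] := dc_nu Hdc.
have [L0' nu0' eps0' mu0'] := And4 (ltW L0) (ltW nu0) (ltW eps0) (ltW mu0).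
have en0 : 0 < eps `^ nu by exact: powR_gt0.
have en1 : eps `^ nu <= 1.
  by rewrite -(powRr0 eps) ger_powR// eps0 ltW.
set c0 := enorm (grad h x0 - grad g x0) in C1 C1M CM *.
have c00 : 0 <= c0 by exact: enorm_ge0.
pose a1 := mu * (1 + 2 * L + c0).
pose b1 := (1 + L) * Cs / eps `^ nu.
pose c1 := 2 * L * mu.
have a10 : 0 <= a1 by rewrite mulr_ge0// !addr_ge0// mulr_ge0.
have b10 : 0 <= b1 by rewrite divr_ge0 ?(ltW en0)// mulr_ge0// addr_ge0.
have c10 : 0 <= c1 by rewrite !mulr_ge0.
have disp k w : (1 <= k <= K)%N -> enorm (x k w - p mu (x k w)) <= a1 + b1 * A k w + c1 * W w.
  move=> kK.
  apply: le_trans (prox_displacement_le Hdc x0 mu0 (gamma0 k) (stage_z k w)) _.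
  have h1 := sigma_dist_le w kK.
  have h2 := drift_le w kK; rewrite hx0 in h2.
  set s := enorm (x k w - z k w) in h1 *; set t := enorm (x k w - x0) in h2 *.
  have s0 : 0 <= s by exact: enorm_ge0.
  have e1 : (1 + mu * gamma k + mu * L) * s = mu * ((gamma k + mu^-1) * s + L * s).
    by field; rewrite gt_eqF.
  have h3 : s <= (gamma k + mu^-1) * s.
    by rewrite ler_peMl// ler_wpDl// invf_ge1// (le_trans mueps)// ltW.
  have h4 : L * s <= L * ((gamma k + mu^-1) * s) by rewrite ler_pM2l.
  have h5 : (1 + L) * ((gamma k + mu^-1) * s) <=
      (1 + L) * (1 + Cs / (mu * eps `^ nu) * A k w).
    apply: ler_wpM2l; first by rewrite addr_ge0.
    by apply: le_trans h1 _; rewrite lerD2r.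
  have h6 : mu * ((gamma k + mu^-1) * s + L * s) <= mu * ((1 + L) * (1 + Cs / (mu * eps `^ nu) * A k w)).
    rewrite ler_pM2l//; apply: le_trans h5; rewrite [leRHS]mulrDl mul1r.
    by rewrite lerD2l.
  have h7 : mu * (2 * L * t) <= mu * (2 * L * W w) by rewrite ler_pM2l// ler_wpM2l// mulr_ge0.
  rewrite e1.
  have -> : a1 + b1 * A k w + c1 * W w = mu * ((1 + L) * (1 + Cs / (mu * eps `^ nu) * A k w)) +
     (mu * (c0 + L) + mu * (2 * L * W w)).
    by rewrite /a1 /b1 /c1; field; rewrite !gt_eqF.
  by apply: lerD h6 _; rewrite mulrDr lerD2l.
have mean : a1 + b1 * (\sum_(1 <= k < K.+1)
    (k%:R `^ al / \sum_(1 <= j < K.+1) j%:R `^ al) * \int[P]_w A k w)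
    + c1 * \int[P]_w W w <= C1 * eps.
  have h1 := ler_wpM2l b10 EA_le.
  have h2 := ler_wpM2l c10 (EW_le muE KQ).
  have e1 : b1 * (CA * (mu * eps `^ (2 * nu))) = (1 + L) * Cs * CA * (mu * eps `^ nu).
    rewrite /b1.
    have -> : eps `^ (2 * nu) = eps `^ nu * eps `^ nu.
      by rewrite -powRD ?mulr_natl ?mulr2n// (gt_eqF eps0) implybT.
    by field; rewrite gt_eqF.
  have h3 : (1 + L) * Cs * CA * (mu * eps `^ nu) <= (1 + L) * Cs * CA * eps.
    have L1 : 0 <= 1 + L by rewrite addr_ge0.
    apply: (ler_wpM2l (mulr_ge0 (mulr_ge0 L1 Cs0) CA0)).
    by rewrite -[leRHS]mulr1; apply: ler_pM => //; exact: ltW.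
  have e2 : c1 * ((2 * CS + 1) * CQ / eps) = 2 * L * ((2 * CS + 1) * CQ) * eps.
    by rewrite /c1 muE; field; rewrite gt_eqF.
  have h4 : a1 <= (1 + 2 * L + c0) * eps.
    by rewrite /a1 mulrC ler_wpM2l// !addr_ge0// mulr_ge0.
  rewrite e1 in h1; rewrite e2 in h2; rewrite /C1 !mulrDl.
  move: h1 h2 h3 h4; rewrite !mulrDl; lra.
exact: (random_stage_near_stationary a10 b10 c10 W_ge0 mW int_W.1 disp mean C1M CM).
Qed.

Lemma near_stationary_stages (M0 CQ : R) :
  0 <= CK -> 0 <= M0 -> 0 <= CQ ->
  (forall y, enorm (y - p mu y) <= M0 * mu) \/
    (mu = eps ^+ 2 /\ Num.sqrt K%:R <= CQ / eps ^+ 2) ->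
  near_stationary P g h r (p mu) nu eps
    (rate_const L al b B Cs CK (enorm (grad h x0 - grad g x0)) M0 CQ) tau x.
Proof.
move=> CK0 M00 CQ0 alt; rewrite /rate_const -/CS -/CA.
have L0 := ltW (dc_L_gt0 Hdc).
have CA0 : 0 <= CA by rewrite /CA !mulr_ge0 ?powR_ge0// addr_ge0// mulr_ge0.
have CS0 : 0 <= CS by rewrite addr_ge0// mulr_ge0.
have L1 : 0 <= 1 + L by rewrite addr_ge0.
set c0 := enorm (grad h x0 - grad g x0).
have c00 : 0 <= c0 by exact: enorm_ge0.
set t1 := (1 + L) * Cs * CA; set t2 := 2 * L * ((2 * CS + 1) * CQ).
have t10 : 0 <= t1 by rewrite /t1 (mulr_ge0 (mulr_ge0 L1 Cs0) CA0).
have t20 : 0 <= t2 by rewrite /t2 !mulr_ge0// addr_ge0// mulr_ge0.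
set C1 := M0 + _.
have C10 : 0 <= C1 by rewrite /C1; move: M00 L0 c00 t10 t20; lra.
have LC1 : 0 <= L * C1 by rewrite mulr_ge0.
case: alt => [hM0|[muE KQ]].
  apply: (near_stationary_lipschitz M00 hM0); first by rewrite /C1; move: L0 c00 t10 t20 LC1; rewrite /C1; lra.
  have : L * M0 <= L * C1 by rewrite ler_wpM2l// /C1; move: L0 c00 t10 t20; lra.
  rewrite -/t1; move: C10 L0 t10; lra.
apply: (near_stationary_drift muE KQ CA0); rewrite -/c0 -/t1 -/t2.
  by move: M00 L0 LC1 t10; rewrite /C1; lra.
set C1' := 1 + 2 * L + c0 + t1 + t2.
have : L * C1' <= L * C1 by rewrite ler_wpM2l// /C1 /C1'; move: M00; lra.
move: C10 L0 t10; lra.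
Qed.

End RandomStageRates.

(** * SVRG *)

Section SvrgEpoch.
Context {R : realType} {d : nat}.
Local Notation V := 'rV[R]_d.
Implicit Types (g : V -> R) (b x z u v : V).

Lemma prox_step_optimality (v x y y' : V) (mu gam eta : R) :
  0 < mu -> 0 <= gam -> 0 < eta ->
  is_argmin (fun u : V => dot u v + (2 * mu)^-1 * enorm u ^+ 2
      + gam / 2 * enorm (u - x) ^+ 2 + (2 * eta)^-1 * enorm (u - y) ^+ 2) y' ->
  v + mu^-1 *: y' + gam *: (y' - x) + eta^-1 *: (y' - y) = 0.
Proof.
move=> mu0 gam0 eta0; apply: (@argmin_grad_eq0 _ _ _ _ _ (mu^-1 + gam + eta^-1)).
  by rewrite addr_gt0 ?invr_gt0// ltr_pwDl ?invr_gt0.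
move=> w; apply: le_of_eq.
by dot_expand; field; rewrite !gt_eqF.
Qed.

Lemma svrg_step_optimality (v x y y' : V) (mu gam eta : R) :
  0 < mu -> 0 <= gam -> 0 < eta ->
  is_argmin (fun u : V => dot v (u - y) + (2 * eta)^-1 * enorm (u - y) ^+ 2
      + (2 * mu)^-1 * enorm u ^+ 2 + gam / 2 * enorm (u - x) ^+ 2) y' ->
  v + mu^-1 *: y' + gam *: (y' - x) + eta^-1 *: (y' - y) = 0.
Proof.
move=> mu0 gam0 eta0 ymin; apply: prox_step_optimality => // u.
have := ymin u; rewrite !(dotC v) !dotDl !dotNl; lra.
Qed.

Lemma prox_step_explicit (v x y y' : V) (mu gam eta : R) : 0 < mu -> 0 < gam -> 0 < eta ->
  v + mu^-1 *: y' + gam *: (y' - x) + eta^-1 *: (y' - y) = 0 ->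
  y' = (mu^-1 + gam + eta^-1)^-1 *: (gam *: x + eta^-1 *: y - v).
Proof.
move=> mu0 gam0 eta0 opt.
have s0 : 0 < mu^-1 + gam + eta^-1 by rewrite !addr_gt0 ?invr_gt0.
have -> : gam *: x + eta^-1 *: y - v = (mu^-1 + gam + eta^-1) *: y'.
  apply/eqP; rewrite eq_sym -subr_eq0 -opt; apply/eqP/rowP => i; rewrite !mxE; ring.
by rewrite scalerA mulVf ?gt_eqF// scale1r.
Qed.

Variables (g : V -> R) (L mu gam : R) (b x z : V).
Hypotheses (L0 : 0 < L) (mu0 : 0 < mu) (gam0 : 0 < gam)
  (cg : convex_function [set: V] g) (sg : smooth L g)
  (gz : stage_grad g mu gam b x z = 0).
Local Notation F := (stage_obj g mu gam b x).
Let eta : R := 5%:R / 100%:R / L.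

Lemma svrg_step_le (gi : V -> R) (xb u u' : V) : smooth L gi ->
  is_argmin (fun y : V =>
      dot (grad gi u - grad gi xb + (grad g xb - b)) (y - u)
      + (2 * eta)^-1 * enorm (y - u) ^+ 2
      + (2 * mu)^-1 * enorm y ^+ 2
      + gam / 2 * enorm (y - x) ^+ 2) u' ->
  F u' - F z + (10 * L + (gam + mu^-1) / 2) * enorm (u' - z) ^+ 2 <=
  14 * L * enorm (u - z) ^+ 2 + 2 * L * enorm (xb - z) ^+ 2.
Proof.
move=> si; set v := _ - _ + _ => umin.
have eta0 : 0 < eta by rewrite !divr_gt0.
have opt := svrg_step_optimality mu0 (ltW gam0) eta0 umin.
pose e := grad gi u - grad gi xb + (grad g xb - grad g u).
have etaL : eta * L = 5%:R / 100%:R by rewrite /eta divfK ?gt_eqF.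
have etaL1 : eta * L < 1 by rewrite etaL; lra.
have ge : grad g u + e - b + mu^-1 *: u' + gam *: (u' - x) + eta^-1 *: (u' - u) = 0.
  rewrite -opt /v /e; apply/rowP => i; rewrite !mxE; ring.
have := prox_gradient_step z (lt0r_neq0 mu0) eta0 etaL1 cg sg ge.
rewrite etaL.
have -> : (2 * eta)^-1 = 10 * L by rewrite /eta; field; rewrite gt_eqF.
have -> : eta / (2 * (1 - 5%:R / 100%:R)) = (5 / 190) / L by rewrite /eta; field; rewrite gt_eqF.
have e1 : enorm e <= 2 * L * enorm (u - xb).
  apply: le_trans (enormD _ _) _.
  have := si.2 u xb; have := sg.2 xb u; rewrite (enormB xb); lra.
have e2 := enorm_triangle z u xb; rewrite (enormB z) in e2.
set s := enorm (u - z) in e2 *; set q := enorm (xb - z) in e2 *.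
have s0 : 0 <= s by exact: enorm_ge0.
have q0 : 0 <= q by exact: enorm_ge0.
have e3 : enorm e <= 2 * L * (s + q).
  by apply: le_trans e1 _; rewrite ler_pM2l// mulr_gt0.
have e4 : - dot e (u - z) <= L * (3 * s ^+ 2 + q ^+ 2).
  have := dot_le_enorm (- e) (u - z); rewrite dotNl enormN -/s => h1.
  apply: le_trans h1 _; apply: le_trans (ler_wpM2r s0 e3) _.
  have : 0 <= (s - q) ^+ 2 by exact: sqr_ge0.
  have -> : 2 * L * (s + q) * s = L * (2 * (s + q) * s) by ring.
  rewrite ler_pM2l// !expr2; lra.
have e5 : (5 / 190) / L * enorm e ^+ 2 <= (1/4) * L * (s ^+ 2 + q ^+ 2).
  have h1 : enorm e ^+ 2 <= (2 * L * (s + q)) ^+ 2.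
    by rewrite lerXn2r ?nnegrE ?enorm_ge0// !mulr_ge0// ?addr_ge0// ltW.
  have c0 : 0 <= (5 / 190) / L by rewrite divr_ge0// ltW.
  apply: le_trans (ler_wpM2l c0 h1) _.
  have -> : 5 / 190 / L * (2 * L * (s + q)) ^+ 2 = L * ((20 / 190) * (s + q) ^+ 2).
    by field; rewrite gt_eqF.
  have -> : 1 / 4 * L * (s ^+ 2 + q ^+ 2) = L * (1 / 4 * (s ^+ 2 + q ^+ 2)) by ring.
  rewrite ler_pM2l//.
  have : 0 <= (s - q) ^+ 2 by exact: sqr_ge0.
  have := sqr_ge0 s; have := sqr_ge0 q; rewrite !expr2; lra.
have : 0 <= L * s ^+ 2 by rewrite mulr_ge0 ?sqr_ge0// ltW.
have : 0 <= L * q ^+ 2 by rewrite mulr_ge0 ?sqr_ge0// ltW.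
lra.
Qed.

(* The components g_i may be nonconvex, so the variance of the SVRG gradient is not controlled by
   function gaps. The crude sure bound |v_t - grad g(x_{t-1})| <= 2 L |x_{t-1} - xbar| already gives
   a pathwise contraction once gamma_k >= 64 L; in the finitely many earlier stages an epoch
   expands the gap by at most a factor depending on T_k, which is absorbed in the constants. *)
Definition svrg_factor (T : nat) : R :=
  if 64%:R * L <= gam then 2^-1 else 32%:R * L * 2 ^+ T / gam.

Lemma svrg_factor_ge0 T : 0 <= svrg_factor T.
Proof.
rewrite /svrg_factor; case: ifP => _; first by rewrite invr_ge0.
by rewrite divr_ge0 ?(ltW gam0)// !mulr_ge0 ?exprn_ge0// ltW.
Qed.

Lemma svrg_epoch_le (T : nat) (us : nat -> V) (xb' : V) : (0 < T)%N ->
  (forall t, (1 <= t <= T)%N -> F (us t) - F z + (10 * L + (gam + mu^-1) / 2) * enorm (us t - z) ^+ 2 <=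
     14 * L * enorm (us t.-1 - z) ^+ 2 + 2 * L * enorm (us 0%N - z) ^+ 2) ->
  xb' = T%:R^-1 *: \sum_(1 <= t < T.+1) us t ->
  F xb' - F z <= svrg_factor T * (F (us 0%N) - F z).
Proof.
move=> T0 step ->.
set q := enorm (us 0%N - z) ^+ 2 in step *.
have q0 : 0 <= q by exact: sqr_ge0.
have T0' : 0 < (T%:R : R) by rewrite ltr0n.
have L0' := ltW L0.
have growth y := stage_growth y (lt0r_neq0 mu0) cg sg gz.
have sg0 : 0 < gam + mu^-1 by rewrite addr_gt0// invr_gt0.
have Fge y : 0 <= F y - F z.
  by apply: le_trans (growth y); rewrite mulr_ge0 ?sqr_ge0// divr_ge0// ltW.
have avg : F (T%:R^-1 *: \sum_(1 <= t < T.+1) us t) - F z <=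
    T%:R^-1 * \sum_(1 <= t < T.+1) (F (us t) - F z).
  have W0 : 0 < \sum_(1 <= t < T.+1) (1 : R) by rewrite sumr_const_nat subn1.
  have := stage_obj_mean_le b x z us mu0 (ltW gam0) cg sg (fun=> ler01) W0.
  under [X in _ <= X]eq_bigr do rewrite mul1r.
  under [\sum_(1 <= i < T.+1) 1 *: _]eq_bigr do rewrite scale1r.
  rewrite sumr_const_nat subn1/= => h1.
  by rewrite mulrC ler_pdivlMr// mulrC.
apply: le_trans avg _; rewrite ler_pdivrMl//.
have qle : q <= 2 / (gam + mu^-1) * (F (us 0%N) - F z).
  have := growth (us 0%N); rewrite -/q => h1.
  rewrite -(ler_pM2l (_ : 0 < (gam + mu^-1) / 2)) ?divr_gt0//.
  apply: le_trans h1 _; rewrite mulrA.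
  have -> : (gam + mu^-1) / 2 * (2 / (gam + mu^-1)) = 1.
    by rewrite mulrA divfK// mulfV// gt_eqF.
  by rewrite mul1r.
have siginv : 2 / (gam + mu^-1) <= 2 / gam.
  by rewrite ler_pM2l// lef_pV2 ?posrE// lerDl invr_ge0 ltW.
have qle' : q <= 2 / gam * (F (us 0%N) - F z).
  by apply: le_trans qle _; rewrite ler_wpM2r.
rewrite /svrg_factor; case: ifPn => [gL|_].
  have Ssum (n : nat) : (n <= T)%N -> \sum_(1 <= t < n.+1) (F (us t) - F z)
      + 14 * L * enorm (us n - z) ^+ 2 <= 14 * L * q + n%:R * (2 * L * q).
    elim: n => [_|n IH nT]; first by rewrite big_geq// mul0r add0r addr0.
    rewrite big_nat_recr//=; have {}IH := IH (ltnW nT).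
    have h1 := step n.+1 nT; rewrite /= in h1.
    have h2 : 14 * L * enorm (us n.+1 - z) ^+ 2 <=
        (10 * L + (gam + mu^-1) / 2) * enorm (us n.+1 - z) ^+ 2.
      rewrite ler_wpM2r ?sqr_ge0//.
      have : 0 < mu^-1 by rewrite invr_gt0.
      by move: L0; lra.
    rewrite -natr1 mulrDl mul1r; lra.
  have := Ssum T (leqnn T).
  have h2 : 0 <= 14 * L * enorm (us T - z) ^+ 2 by rewrite mulr_ge0 ?sqr_ge0// mulr_ge0.
  have h3 : 14 * L * q <= T%:R * (14 * L * q).
    by rewrite ler_peMl ?ler1n// mulr_ge0// mulr_ge0.
  have h4 : T%:R * (16%:R * L * q) <= T%:R * (2^-1 * (F (us 0%N) - F z)).
    rewrite ler_pM2l//; apply: le_trans (_ : 16%:R * L * (2 / gam * (F (us 0%N) - F z)) <= _).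
      by rewrite ler_pM2l// mulr_gt0.
    rewrite mulrA ler_wpM2r//.
    have -> : 16%:R * L * (2 / gam) = (32%:R * L) / gam by field; rewrite gt_eqF.
    rewrite ler_pdivrMr//; lra.
  move=> h1; apply: le_trans h4.
  have -> : T%:R * (16%:R * L * q) = T%:R * (14 * L * q) + T%:R * (2 * L * q) by ring.
  lra.
have Pt n : (n <= T)%N -> enorm (us n - z) ^+ 2 <= 2 ^+ n * q.
  elim: n => [_|n IH nT]; first by rewrite expr0 mul1r.
  have {}IH := IH (ltnW nT); have h1 := step n.+1 nT; rewrite /= in h1.
  have h2 : 0 <= (gam + mu^-1) / 2 * enorm (us n.+1 - z) ^+ 2.
    by rewrite mulr_ge0 ?sqr_ge0// divr_ge0// ltW.
  have h3 := Fge (us n.+1).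
  have h4 : q <= 2 ^+ n * q by rewrite ler_peMl// exprn_ege1// ler1n.
  rewrite -(ler_pM2l L0) [2 ^+ n.+1]exprS.
  have := ler_wpM2l (ltW L0) IH; have := ler_wpM2l (ltW L0) h4.
  have := mulr_ge0 L0' q0.
  lra.
apply: le_trans (_ : \sum_(1 <= t < T.+1) 16%:R * L * (2 ^+ T * q) <= _).
  rewrite big_nat_cond [leRHS]big_nat_cond; apply: ler_sum => t; rewrite andbT => /andP[t1 tT].
  have h1 := step t; rewrite t1 -ltnS tT in h1; have {}h1 := h1 isT.
  have t1T : (t.-1 <= T)%N by apply: leq_trans (leq_pred _) _.
  have h2 := Pt t.-1 t1T.
  have h3 : 0 <= (10 * L + (gam + mu^-1) / 2) * enorm (us t - z) ^+ 2.
    by rewrite mulr_ge0 ?sqr_ge0// addr_ge0 ?mulr_ge0 ?divr_ge0// ltW.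
  have h4 : 2 ^+ t.-1 * q <= 2 ^+ T * q by rewrite ler_wpM2r// ler_weXn2l// ler1n.
  have h5 : q <= 2 ^+ T * q by rewrite ler_peMl// exprn_ege1// ler1n.
  have := mulr_ge0 L0' q0; have := ler_wpM2l (ltW L0) (le_trans h2 h4); have := ler_wpM2l (ltW L0) h5.
  lra.
rewrite sumr_const_nat subn1/= -[leLHS]mulr_natl ler_pM2l//.
have c0 : 0 <= 16%:R * L * 2 ^+ T by rewrite mulr_ge0 ?exprn_ge0// mulr_ge0.
have := ler_wpM2l c0 qle'.
have -> : 16%:R * L * 2 ^+ T * (2 / gam * (F (us 0%N) - F z)) =
  32%:R * L * 2 ^+ T / gam * (F (us 0%N) - F z) by field; rewrite gt_eqF.
by rewrite mulrA.
Qed.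

End SvrgEpoch.

Section SvrgPath.
Context {R : realType} {d : nat}.
Local Notation V := 'rV[R]_d.
Context {L nu : R} {g h : V -> R} {r : V -> \bar R} {p : R -> V -> V}.
Hypothesis Hdc : dc_problem L nu g h r p.
Context {n1 : nat} {gi : 'I_n1 -> V -> R}.
Hypothesis sgi : forall i, smooth L (gi i).
Variables (mu : R) (gamma : nat -> R) (T S : nat -> nat) (K : nat) (x1 : V).
Hypotheses (mu0 : 0 < mu) (gamma0 : forall k, (1 <= k)%N -> 0 < gamma k)
  (T0 : forall k, (1 <= k)%N -> (0 < T k)%N).

Lemma svrg_stage_le (i : nat -> nat -> nat -> 'I_n1) (x : nat -> V) (xb : nat -> nat -> V)
    (xs : nat -> nat -> nat -> V) k :
  svrg_path L gi g h (p mu) mu gamma T S K x1 i x xb xs -> (1 <= k <= K)%N ->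
  @end_gap R d g h p mu (gamma k) (x k) (x k.+1) <=
  svrg_factor L (gamma k) (T k) ^+ S k * @start_gap R d g h p mu (gamma k) (x k).
Proof.
move=> H kK; have k1 : (1 <= k)%N by case/andP: kK.
have gk0 := gamma0 k1; have L0 := dc_L_gt0 Hdc.
rewrite (svrg_output H kK) /end_gap /start_gap /dc_stage.
set b := @dc_slope R d h p mu (x k).
have gz : stage_grad g mu (gamma k) b (x k) (@dc_stage_sol R d g h p mu (gamma k) (x k)) = 0.
  exact: (dc_stage_solP Hdc (x k) mu0 (ltW gk0)).
set z := @dc_stage_sol R d g h p mu (gamma k) (x k) in gz *.
have rho0 : 0 <= svrg_factor L (gamma k) (T k) by exact: svrg_factor_ge0.
suff Hs (s : nat) : (s <= S k)%N ->
   stage_obj g mu (gamma k) b (x k) (xb k s) - stage_obj g mu (gamma k) b (x k) z <=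
   svrg_factor L (gamma k) (T k) ^+ s *
   (stage_obj g mu (gamma k) b (x k) (xb k 0%N) - stage_obj g mu (gamma k) b (x k) z).
  by have := Hs (S k) (leqnn _); rewrite (svrg_stage_init H kK).
elim: s => [_|s IH sS]; first by rewrite expr0 mul1r.
have sS' : (1 <= s.+1 <= S k)%N by rewrite sS.
have {}IH := IH (ltnW sS).
have e0 := svrg_epoch_init H kK sS'.
have := @svrg_epoch_le _ _ g L mu (gamma k) b (x k) z L0 mu0 gk0 (dc_g_convex Hdc) (dc_g_smooth Hdc)
  gz (T k) (xs k s.+1) (xb k s.+1) (T0 k1) _ (svrg_epoch_output H kK sS').
rewrite e0 /= => hep; apply: le_trans (hep _) _; last first.
  by rewrite exprS -mulrA ler_wpM2l.
move=> t tT; apply: (svrg_step_le z L0 mu0 gk0 (dc_g_convex Hdc) (dc_g_smooth Hdc)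
  (sgi (i k s.+1 t))).
have := svrg_step H kK sS' tT; rewrite /= /b /dc_slope.
have -> : grad g (xb k s) - (grad h (x k) + mu^-1 *: p mu (x k)) =
  grad g (xb k s) - grad h (x k) - mu^-1 *: p mu (x k) by rewrite opprD addrA.
by [].
Qed.

Section Measurability.
Context {dO : measure_display} {Om : measurableType dO} (G : set (set Om)).
Variables (i : nat -> nat -> nat -> Om -> 'I_n1) (x : nat -> Om -> V)
  (xb : nat -> nat -> Om -> V) (xs : nat -> nat -> nat -> Om -> V).
Hypotheses
  (path : forall w, svrg_path L gi g h (p mu) mu gamma T S K x1
     (fun k s t => i k s t w) (fun k => x k w) (fun k s => xb k s w) (fun k s t => xs k s t w))
  (mi : forall k s t, (1 <= k <= K)%N -> (1 <= s <= S k)%N -> (1 <= t <= T k)%N ->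
     fin_measurable G (i k s t)).

Lemma svrg_fin_measurable k : (1 <= k <= K.+1)%N -> fin_measurable G (x k).
Proof.
elim: k => [//|k IH] /andP[_]; rewrite ltnS => kK.
case: (posnP k) => [->|k0].
  have -> : x 1%N = (fun _ => x1) by apply/funext => w; exact: (svrg_init (path w)).
  exact: fin_measurable_cst.
have kK' : (1 <= k <= K)%N by rewrite k0.
have {}IH : fin_measurable G (x k) by apply: IH; rewrite k0 ltnW.
have -> : x k.+1 = xb k (S k) by apply/funext => w; exact: (svrg_output (path w) kK').
have L0 := dc_L_gt0 Hdc; have gk0 := gamma0 k0.
have eta0 : 0 < (5%:R / 100%:R / L : R) by rewrite !divr_gt0.
elim: {-2}(S k) (leqnn (S k)) => [_|s IHs sS].
  have -> : xb k 0%N = x k by apply/funext => w; exact: (svrg_stage_init (path w) kK').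
  exact: IH.
have {}IHs := IHs (ltnW sS); have sS' : (1 <= s.+1 <= S k)%N by rewrite sS.
have mxs t : (t <= T k)%N -> fin_measurable G (xs k s.+1 t).
  elim: t => [_|t IHt tT].
    have -> : xs k s.+1 0%N = xb k s by apply/funext => w; exact: (svrg_epoch_init (path w) kK' sS').
    exact: IHs.
  have tT' : (1 <= t.+1 <= T k)%N by rewrite tT.
  pose f (q : (V * V) * (V * 'I_n1)) : V :=
    (mu^-1 + gamma k + (5%:R / 100%:R / L)^-1)^-1 *: (gamma k *: q.1.1 + (5%:R / 100%:R / L)^-1 *: q.2.1
     - (grad (gi q.2.2) q.2.1 - grad (gi q.2.2) q.1.2
        + (grad g q.1.2 - grad h q.1.1 - mu^-1 *: p mu q.1.1))).
  have -> : xs k s.+1 t.+1 = (fun w => f ((x k w, xb k s w), (xs k s.+1 t w, i k s.+1 t.+1 w))).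
    apply/funext => w; rewrite /f /=.
    apply: prox_step_explicit => //.
    exact: (svrg_step_optimality mu0 (ltW gk0) eta0 (svrg_step (path w) kK' sS' tT')).
  apply: (@fin_measurable_comp _ _ _ _ _ (fun w => ((x k w, xb k s w), (xs k s.+1 t w, i k s.+1 t.+1 w))) f).
  apply: fin_measurable_pair; first exact: fin_measurable_pair.
  by apply: fin_measurable_pair; [exact/IHt/ltnW|exact: mi].
have -> : xb k s.+1 = (fun w => (T k)%:R^-1 *: \sum_(1 <= t < (T k).+1) xs k s.+1 t w).
  by apply/funext => w; exact: (svrg_epoch_output (path w) kK' sS').
apply: (@fin_measurable_comp _ _ _ _ _ (fun w => \sum_(1 <= t < (T k).+1) xs k s.+1 t w)
  (fun v => (T k)%:R^-1 *: v)).
by apply: fin_measurable_sum => t; rewrite mem_index_iota => /andP[_ tT]; exact: mxs.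
Qed.

End Measurability.
End SvrgPath.

Section SvrgRate.
Context {R : realType} {d : nat}.
Local Notation V := 'rV[R]_d.
Context {L nu : R} {g h : V -> R} {r : V -> \bar R} {p : R -> V -> V}.
Hypothesis Hdc : dc_problem L nu g h r p.
Context {n1 : nat} {gi : 'I_n1 -> V -> R}.
Hypothesis sgi : forall i, smooth L (gi i).
Variables (gamma : nat -> R) (T : nat -> nat) (x1 : V) (al Delta : R).
Hypotheses (gamma_ge0 : forall k, 0 <= gamma k) (gamma_gt0 : forall k, (1 <= k)%N -> 0 < gamma k)
  (gamma_large : exists k0, forall k, (k0 <= k)%N -> 64%:R * L <= gamma k)
  (T0 : forall k, (1 <= k)%N -> (0 < T k)%N) (al1 : 1 <= al) (Delta0 : 0 < Delta).
Let S (k : nat) : nat := up_log 2 k.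

Let rho k : R := svrg_factor L (gamma k) (T k) ^+ S k.

Let rho_ge0 k : (1 <= k)%N -> 0 <= rho k.
Proof. by move=> k1; rewrite exprn_ge0// svrg_factor_ge0// ?(dc_L_gt0 Hdc)// gamma_gt0. Qed.

Let rho_le k : (1 <= k)%N -> 64%:R * L <= gamma k -> rho k <= k%:R^-1.
Proof.
move=> k1 gL; rewrite /rho /svrg_factor gL exprVn lef_pV2 ?posrE ?exprn_gt0 ?ltr0n//.
by rewrite -natrX ler_nat up_logP.
Qed.

Fixpoint gap_bound (k : nat) : R :=
  if k is j.+1 then Num.max 1 (rho j) * gap_bound j else Delta.

Let gap_bound_gt0 k : 0 < gap_bound k.
Proof. by elim: k => [|k IH] //=; rewrite mulr_gt0// lt_max ltr01. Qed.

Let gap_bound_le j k : (j <= k)%N -> gap_bound j <= gap_bound k.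
Proof.
move=> /subnKC <-; elim: (k - j)%N => [|n IH]; first by rewrite addn0.
rewrite addnS /=; apply: le_trans IH _.
by rewrite ler_peMl ?(ltW (gap_bound_gt0 _))// le_max lexx.
Qed.

Let gap_bound_ex : exists2 b, 0 <= b & forall k, gap_bound k <= b.
Proof.
have [k0 hk0] := gamma_large; exists (gap_bound k0.+1); first exact: ltW.
move=> k; have [kk0|kk0] := leqP k k0.+1; first exact: gap_bound_le.
rewrite -(subnKC (ltnW kk0)); elim: (k - k0.+1)%N => [|n IH]; first by rewrite addn0.
rewrite addnS /= (_ : Num.max 1 _ = 1) ?mul1r//.
apply/max_idPl; apply: le_trans (rho_le _ _) _ => //.
  by apply: hk0; rewrite addSn ltnW// ltnS leq_addr.
by rewrite invf_le1 ?ler1n ?ltr0n.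
Qed.

Let accuracy_ex (b : R) : 0 <= b ->
  exists2 B, 0 <= B & forall k, (1 <= k)%N -> rho k * b <= B / k%:R.
Proof.
move=> b0; have [k0 hk0] := gamma_large.
pose s := \sum_(1 <= j < k0) j%:R * rho j.
have s0 : 0 <= s.
  by rewrite /s big_nat_cond sumr_ge0// => j /andP[/andP[j1 _] _]; rewrite mulr_ge0// rho_ge0.
exists (b * (1 + s)); first by rewrite mulr_ge0// addr_ge0.
move=> k k1; have k0' : 0 < (k%:R : R) by rewrite ltr0n.
rewrite mulrC -mulrA ler_wpM2l// ler_pdivlMr//.
have [kk0|kk0] := leqP k0 k.
  have := rho_le k1 (hk0 k kk0); rewrite -(ler_pM2r k0') mulVf ?gt_eqF// => h1.
  by apply: le_trans h1 _; rewrite lerDl.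
apply: le_trans (_ : s <= _); last by rewrite lerDr.
rewrite /s (bigD1_seq k) ?iota_uniq ?mem_index_iota ?k1//= mulrC lerDl.
by rewrite big_seq_cond sumr_ge0// => j; rewrite mem_index_iota => /andP[/andP[j1 _] _];
  rewrite mulr_ge0// rho_ge0.
Qed.

Lemma svrg_near_stationary : exists b B, [/\ 0 <= b, 0 <= B &
  forall (eps mu : R) (K : nat) (Cs CK M0 CQ : R)
    (dO : measure_display) (Om : measurableType dO) (P : probability Om R)
    (i : nat -> nat -> nat -> Om -> 'I_n1) (tau : Om -> nat) (x : nat -> Om -> V)
    (xb : nat -> nat -> Om -> V) (xs : nat -> nat -> nat -> Om -> V),
  0 < eps -> eps < 1 -> 0 < mu -> mu <= eps -> (0 < K)%N ->
  svrg_run P L gi g h (p mu) mu al gamma T S K x1 i tau x xb xs ->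
  (smoothed_objective g h r mu x1 - ereal_inf (range (smoothed_objective g h r mu)) <= Delta%:E)%E ->
  0 <= Cs -> 0 <= CK -> 0 <= M0 -> 0 <= CQ ->
  (forall k, (1 <= k <= K)%N -> gamma k + mu^-1 <= Cs / mu) ->
  K%:R^-1 <= CK * (mu * eps `^ (2 * nu)) ->
  (forall y, enorm (y - p mu y) <= M0 * mu) \/
    (mu = eps ^+ 2 /\ Num.sqrt K%:R <= CQ / eps ^+ 2) ->
  near_stationary P g h r (p mu) nu eps
    (rate_const L al b B Cs CK (enorm (grad h x1 - grad g x1)) M0 CQ) tau x].
Proof.
have [b b0 hb] := gap_bound_ex; have [B B0 hB] := accuracy_ex b0.
exists b, B; split => // eps mu K Cs CK M0 CQ dO Om P i tau x xb xs.
move=> eps0 eps1 mu0 mueps K0 run hDelta Cs0 CK0 M00 CQ0 sigma_le K_ge alt.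
have [m [_ hm x1m]] := smoothed_inf_real Hdc mu0 hDelta.
have path := svrg_traj run.
pose J : seq ((nat * nat * nat) + unit) := undup
  [seq inl (q.1, q.2.1, q.2.2) | q <-
    [seq (k, st) | k <- iota 1 K, st <- [seq (s, t) | s <- iota 1 (S k), t <- iota 1 (T k)]]].
have JP k s t : (inl (k, s, t) \in J) = svrg_index T S K (inl (k, s, t)).
  rewrite mem_undup; apply/mapP/and3P => [[[k' [s' t']] /allpairsPdep[k2 [st2 [hk hst]]]]|[hk hs ht]].
    move=> [-> e2] [-> -> ->]; move: hst; rewrite -e2 => /allpairsP[[s3 t3] [/= h3 h4 [-> ->]]].
    by move: hk h3 h4; rewrite !mem_iota !add1n !ltnS.
  exists (k, (s, t)) => //; apply/allpairsPdep; exists k, (s, t); split => //.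
    by rewrite mem_iota add1n ltnS.
  by apply/allpairsP; exists (s, t); split => //=; rewrite mem_iota add1n ltnS.
have Jinr u : inr u \notin J.
  by rewrite mem_undup; apply/negP => /mapP[].
pose G : set (set Om) := \bigcup_(j in [set` J]) svrg_sigma i tau j.
have [mtau tK taup] := svrg_tau_law run.
have sigE j : j \in (inr tt : (nat * nat * nat) + unit) :: J ->
    sigma_algebra setT (svrg_sigma i tau j) /\ svrg_sigma i tau j `<=` measurable.
  case: j => [[[k s] t]|[]] jJ /=; (split; first exact: sigma_of_algebra).
    apply: sigma_of_measurable; apply: (svrg_i_meas run); rewrite -JP.
    by move: jJ; rewrite in_cons.
  exact: sigma_of_measurable.
have Gm : <<s G>> `<=` measurable.
  apply: smallest_sub; first exact: sigma_algebra_measurable.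
  move=> A [j /= jJ]; apply: (sigE j _).2; by rewrite in_cons jJ orbT.
have indG A B' : <<s G>> A -> (P (A `&` tau @^-1` B') = P A * P (tau @^-1` B'))%E.
  move=> sA; apply: (independent_generated (svrg_indep run) (J := J) (i := inr tt) _ _ sigE sA).
  - by rewrite /= Jinr undup_uniq.
  - by apply/allP => -[[[k s] t]|[]]; rewrite in_cons //= JP.
  - by exists B' => //; rewrite setTI.
have mi k s t : (1 <= k <= K)%N -> (1 <= s <= S k)%N -> (1 <= t <= T k)%N ->
    fin_measurable G (i k s t).
  move=> kK sS tT; split; first exact: finite_finset.
  move=> j; apply: sub_sigma_algebra; exists (inl (k, s, t)).
    by rewrite /= JP /svrg_index kK sS tT.
  exists [set (j : nat)] => //; rewrite setTI.
  by apply/seteqP; split => w /=; [move/ord_inj|move->].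
have mx k : (1 <= k <= K.+1)%N -> fin_measurable G (x k).
  exact: (svrg_fin_measurable Hdc mu0 gamma_gt0 path mi).
pose A k w := @start_gap R d g h p mu (gamma k) (x k w).
pose Phi k w := @end_gap R d g h p mu (gamma k) (x k w) (x k.+1 w).
pose Dl k w := @smoothed_real R d g h r p mu (x k w) - m.
have fmA k : (1 <= k <= K)%N -> fin_measurable G (A k).
  move=> /andP[k1 kK]; apply: (@fin_measurable_comp _ _ _ _ _ (x k)).
  by apply: mx; rewrite k1 ltnW.
have fmPhi k : (1 <= k <= K)%N -> fin_measurable G (Phi k).
  move=> /andP[k1 kK]; apply: (@fin_measurable_comp _ _ _ _ _ (fun w => (x k w, x k.+1 w))
    (fun q => @end_gap R d g h p mu (gamma k) q.1 q.2)).
  by apply: fin_measurable_pair; apply: mx; rewrite ?k1 ?ltnS// ltnW.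
have fmD k : (1 <= k <= K.+1)%N -> fin_measurable G (Dl k).
  move=> kK; apply: (@fin_measurable_comp _ _ _ _ _ (x k)
    (fun y => @smoothed_real R d g h r p mu y - m)); exact: mx.
have desc k w : A k w <= Dl k w - Dl k.+1 w + Phi k w.
  have := gap_descent Hdc (x k w) (x k.+1 w) mu0 (gamma_ge0 k).
  by rewrite /A /Dl /Phi; lra.
have A_le k w : A k w <= Dl k w by exact: (start_gap_le Hdc).
have A_ge0 k w : 0 <= A k w by exact: (start_gap_ge0 Hdc).
have rel k w : (1 <= k <= K)%N -> Phi k w <= rho k * A k w.
  move=> kK; exact: (svrg_stage_le Hdc sgi mu0 gamma_gt0 T0 (path w) kK).
have Dl_le k w : (1 <= k <= K.+1)%N -> Dl k w <= gap_bound k.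
  elim: k => [//|k IH] /andP[_]; rewrite ltnS => kK.
  case: (posnP k) => [->|k0].
    rewrite /Dl (svrg_init (path w)); apply: le_trans x1m _.
    by rewrite /= ler_peMl ?(ltW Delta0)// le_max lexx.
  have kK' : (1 <= k <= K)%N by rewrite k0.
  have {}IH : Dl k w <= gap_bound k by apply: IH; rewrite k0 ltnW.
  have h1 := desc k w; have h2 := rel k w kK'; have h3 := A_le k w; have h4 := A_ge0 k w.
  have h5 : rho k * A k w <= Num.max 1 (rho k) * A k w by rewrite ler_wpM2r// le_max lexx orbT.
  have h6 : (Num.max 1 (rho k) - 1) * A k w <= (Num.max 1 (rho k) - 1) * Dl k w.
    by rewrite ler_wpM2l// subr_ge0 le_max lexx.
  have h7 : Num.max 1 (rho k) * Dl k w <= Num.max 1 (rho k) * gap_bound k.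
    by rewrite ler_wpM2l// le_max ler01.
  rewrite /=; move: h1 h2 h5 h6 h7; move: (Num.max 1 (rho k)) => u; lra.
apply: (near_stationary_stages Hdc al1 K0 (svrg_tau_law run) Gm indG eps0 eps1 mu0 mueps gamma_ge0
  (fun w => svrg_init (path w)) hm) => //.
- by move=> k kK; apply: fin_measurable_fun; exact: fmA.
- by move=> k kK; apply: fin_measurable_fun; exact: fmPhi.
- by move=> k kK; apply: fin_measurable_fun; exact: fmD.
- move=> k kK iA; have /andP[k1 kK1] := kK.
  have iPhi : P.-integrable setT (EFin \o Phi k).
    apply: integrable_dominated (integrableZl measurableT (rho k) iA) _ => [|w].
      exact: (measurable_sub_sigma Gm (fin_measurable_fun (fmPhi k kK))).
    by rewrite ger0_norm; [exact: rel|exact: (end_gap_ge0 Hdc)].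
  split => //; apply: le_trans (_ : B / k%:R <= _); last first.
    by rewrite lerDr divr_ge0//; apply: Rintegral_ge0 => w _; exact: A_ge0.
  rewrite -[leRHS](Rintegral_prob_cst P); apply: le_Rintegral => //.
    exact: finite_measure_integrable_cst.
  move=> w _; apply: le_trans (rel k w kK) _; apply: le_trans (hB k k1).
  rewrite ler_wpM2l ?rho_ge0//; apply: le_trans (A_le k w) _.
  by apply: le_trans (hb k); apply: Dl_le; rewrite k1 ltnW.
- move=> k /andP[k1 kK]; rewrite -(integral_prob_cst P b%:E).
  apply: le_integral_nonmeasurable => w; rewrite lee_fin ?subr_ge0//.
  by apply: le_trans (hb k); apply: Dl_le; rewrite k1 ltnW.
Qed.

End SvrgRate.

(** * SPG *)

Section OracleVariance.
Context {R : realType} {d : nat}.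
Local Notation V := 'rV[R]_d.

Lemma vecE_coord {dO} {Om : measurableType dO} (mu : {measure set Om -> \bar R}) (X : Om -> V) i :
  vecE mu X 0 i = \int[mu]_w X w 0 i.
Proof. by rewrite mxE. Qed.

Section Mean.
Context {dT : measure_display} {T : measurableType dT} (Q : probability T R).
Variable X : T -> V.
Hypotheses (iX : forall i, Q.-integrable setT (fun t => (X t 0 i)%:E))
  (X0 : vecE Q X = 0).

Lemma integrable_dot v : Q.-integrable setT (fun t => (dot v (X t))%:E).
Proof.
have -> : (fun t => (dot v (X t))%:E) = EFin \o (fun t => \sum_(i < d) v 0 i * X t 0 i) by [].
apply: (Rintegral_sum _ _).1 => i; exact: (integrableZl measurableT (v 0 i) (iX i)).
Qed.

Lemma integral_dot_eq0 v : (\int[Q]_t (dot v (X t))%:E = 0)%E.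
Proof.
rewrite -[LHS]fineK; last exact: (integrable_fin_num measurableT (integrable_dot v)).
congr (_%:E); rewrite -[LHS]/(\int[Q]_t dot v (X t)) /dot.
rewrite (Rintegral_sum (P := Q) (index_enum 'I_d) (f := fun i t => v 0 i * X t 0 i) _).2; last first.
  by move=> i; exact: (integrableZl measurableT (v 0 i) (iX i)).
rewrite big1// => i _; rewrite (RintegralZl (v 0 i) measurableT (iX i)).
by rewrite -vecE_coord X0 mxE mulr0.
Qed.

(* Jensen: integrating out the other sample shows that the noise of g and the noise of h are each
   bounded by the joint variance. *)
Lemma mean_sq_ge a : measurable_fun setT (fun t => enorm (a - X t) ^+ 2) ->
  ((enorm a ^+ 2)%:E <= \int[Q]_t (enorm (a - X t) ^+ 2)%:E)%E.
Proof.
move=> ma.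
have [fin|] := boolP (Q.-integrable setT (EFin \o (fun t => enorm (a - X t) ^+ 2))); last first.
  move=> nint; suff -> : (\int[Q]_t (enorm (a - X t) ^+ 2)%:E = +oo)%E by rewrite leey.
  apply/eqP; rewrite -leye_eq leNgt; apply: contra nint => hlt.
  apply/integrableP; split; first exact/measurable_EFinP.
  by under eq_integral do rewrite gee0_abs ?lee_fin ?sqr_ge0//.
have i1 : Q.-integrable setT (EFin \o (fun t => enorm a ^+ 2)).
  exact: finite_measure_integrable_cst.
have i2 : Q.-integrable setT (EFin \o (fun t => 2 * dot a (X t))).
  exact: (integrableZl measurableT 2 (integrable_dot a)).
rewrite -(@fineK _ (\int[Q]_t _)%E); last exact: (integrable_fin_num measurableT fin).
rewrite lee_fin.
have -> : enorm a ^+ 2 = \int[Q]_t (enorm a ^+ 2 - 2 * dot a (X t)).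
  rewrite (RintegralB measurableT i1 i2) (RintegralZl 2 measurableT (integrable_dot a)).
  rewrite (_ : \int[Q]_t dot a (X t) = 0) ?mulr0 ?subr0; last by rewrite /Rintegral integral_dot_eq0.
  by rewrite Rintegral_prob_cst.
apply: le_Rintegral => //; first exact: (integrableB measurableT i1 i2).
move=> t _; have -> : enorm (a - X t) ^+ 2 = enorm a ^+ 2 - 2 * dot a (X t) + dot (X t) (X t).
  by dot_expand; ring.
by rewrite lerDl dot_ge0.
Qed.

End Mean.

Context {d1 d2 : measure_display} {T1 : measurableType d1} {T2 : measurableType d2}
  (P1 : probability T1 R) (P2 : probability T2 R).
Context {g h : V -> R} {gs : V -> T1 -> R} {hs : V -> T2 -> R}
  {dg : V -> T1 -> V} {dh : V -> T2 -> V} {G0 : R}.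
Hypotheses (orc : stochastic_oracles P1 P2 g h gs hs dg dh) (var : variance_bound P1 P2 dg dh G0).

Lemma measurable_dg_sample x : measurable_fun setT (dg x : T1 -> borelV R d).
Proof.
have m1 : measurable_fun setT (fun xi : T1 => (x, xi) : borelV R d * T1).
  exact: measurable_fun_pair.
exact: (measurableT_comp (so_dg_meas orc) m1).
Qed.

Lemma measurable_dh_sample x : measurable_fun setT (dh x : T2 -> borelV R d).
Proof.
have m1 : measurable_fun setT (fun xi : T2 => (x, xi) : borelV R d * T2).
  exact: measurable_fun_pair.
exact: (measurableT_comp (so_dh_meas orc) m1).
Qed.

Let centered {dT : measure_display} {T : measurableType dT} (Q : probability T R)
    (X : T -> V) (v : V) : (forall i, Q.-integrable setT (fun t => (X t 0 i)%:E)) ->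
  vecE Q X = v ->
  (forall i, Q.-integrable setT (fun t => ((X t - v) 0 i)%:E)) /\ vecE Q (fun t => X t - v) = 0.
Proof.
move=> iX <-.
have ic (c : R) : Q.-integrable setT (EFin \o (fun _ : T => c)).
  exact: finite_measure_integrable_cst.
split=> [i|].
  have := integrableB measurableT (iX i) (ic (vecE Q X 0 i)).
  by apply: eq_integrable => // t _; rewrite /= !mxE.
apply/rowP => i; rewrite vecE_coord [RHS]mxE.
under eq_Rintegral do rewrite !mxE.
by rewrite (RintegralB measurableT (iX i) (ic _)) Rintegral_prob_cst subrr.
Qed.

Lemma centered_dg x : (forall i, P1.-integrable setT (fun t => ((dg x t - grad g x) 0 i)%:E)) /\
  vecE P1 (fun t => dg x t - grad g x) = 0.
Proof. exact: (centered (so_dg_int orc x) (so_dg_unbiased orc x)). Qed.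

Lemma centered_dh x : (forall i, P2.-integrable setT (fun t => ((dh x t - grad h x) 0 i)%:E)) /\
  vecE P2 (fun t => dh x t - grad h x) = 0.
Proof. exact: (centered (so_dh_int orc x) (so_dh_unbiased orc x)). Qed.

Let integral_fst (f : T1 -> R) : P1.-integrable setT (EFin \o f) ->
  (P1 \x P2)%E.-integrable setT (EFin \o (fun z => f z.1)) /\
  \int[(P1 \x P2)%E]_z f z.1 = \int[P1]_t f t.
Proof.
move=> fi; have [mf foo] := integrableP _ _ _ fi.
have mf1 : measurable_fun setT (EFin \o (fun z : T1 * T2 => f z.1)).
  apply/measurable_EFinP; apply: (measurableT_comp _ measurable_fst); exact/measurable_EFinP.
have i1 : (P1 \x P2)%E.-integrable setT (EFin \o (fun z => f z.1)).
  apply/integrable12ltyP => //; apply: le_lt_trans foo.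
  apply: le_of_eq.
  by apply: eq_integral => t _ /=; exact: integral_prob_cst.
split => //; rewrite /Rintegral -(integral12_prod_meas1 i1).
by congr fine; apply: eq_integral => t _; rewrite /fubini_F /=; exact: integral_prob_cst.
Qed.

Let integral_snd (f : T2 -> R) : P2.-integrable setT (EFin \o f) ->
  (P1 \x P2)%E.-integrable setT (EFin \o (fun z => f z.2)) /\
  \int[(P1 \x P2)%E]_z f z.2 = \int[P2]_t f t.
Proof.
move=> fi; have [mf foo] := integrableP _ _ _ fi.
have mf1 : measurable_fun setT (EFin \o (fun z : T1 * T2 => f z.2)).
  apply/measurable_EFinP; apply: (measurableT_comp _ measurable_snd); exact/measurable_EFinP.
have i1 : (P1 \x P2)%E.-integrable setT (EFin \o (fun z => f z.2)).
  apply/integrable21ltyP => //; apply: le_lt_trans foo.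
  apply: le_of_eq.
  by apply: eq_integral => t _ /=; exact: integral_prob_cst.
split => //; rewrite /Rintegral -(integral21_prod_meas1 i1).
by congr fine; apply: eq_integral => t _; rewrite /fubini_G /=; exact: integral_prob_cst.
Qed.

Lemma oracle_difference_mean x :
  vecE (P1 \x P2)%E (fun z => dg x z.1 - dh x z.2) = grad g x - grad h x.
Proof.
rewrite -(so_dg_unbiased orc) -(so_dh_unbiased orc).
apply/rowP => i; rewrite vecE_coord [RHS]mxE [X in _ + X]mxE !vecE_coord.
have [i1 e1] := integral_fst (so_dg_int orc x i); have [i2 e2] := integral_snd (so_dh_int orc x i).
rewrite -e1 -e2 -(RintegralB measurableT i1 i2).
by apply: eq_Rintegral => z _; rewrite !mxE.
Qed.

Let eg x xi := dg x xi - grad g x.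
Let eh x zeta := dh x zeta - grad h x.

Lemma oracle_variance x :
  (\int[(P1 \x P2)%E]_z (enorm (eg x z.1 - eh x z.2) ^+ 2)%:E <= (G0 ^+ 2)%:E)%E.
Proof.
have := var x; rewrite oracle_difference_mean.
suff -> : (fun z : T1 * T2 => (enorm (dg x z.1 - dh x z.2 - (grad g x - grad h x)) ^+ 2)%:E) =
   (fun z => (enorm (eg x z.1 - eh x z.2) ^+ 2)%:E) by [].
apply/funext => z; congr ((enorm _ ^+ 2)%:E); rewrite /eg /eh.
by apply/rowP => i; rewrite !mxE; ring.
Qed.

Let meg x : measurable_fun setT (eg x : T1 -> borelV R d).
Proof. by apply: measurable_rVB; [exact: measurable_dg_sample|exact: measurable_cst]. Qed.

Let meh x : measurable_fun setT (eh x : T2 -> borelV R d).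
Proof. by apply: measurable_rVB; [exact: measurable_dh_sample|exact: measurable_cst]. Qed.

Let mdiff x : measurable_fun setT (fun z : T1 * T2 => (enorm (eg x z.1 - eh x z.2) ^+ 2)%:E).
Proof.
apply/measurable_EFinP; apply: measurable_enorm_sq; apply: measurable_rVB.
  exact: (measurableT_comp (meg x) measurable_fst).
exact: (measurableT_comp (meh x) measurable_snd).
Qed.

Lemma dg_variance x : (\int[P1]_xi (enorm (dg x xi - grad g x) ^+ 2)%:E <= (G0 ^+ 2)%:E)%E.
Proof.
apply: le_trans (oracle_variance x).
rewrite fubini_tonelli1//; last by move=> z; rewrite lee_fin sqr_ge0.
apply: ge0_le_integral => //.
- by move=> t _; rewrite lee_fin sqr_ge0.
- by apply/measurable_EFinP; exact: (measurable_enorm_sq (meg x)).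
- by apply: measurable_fun_fubini_tonelli_F => // z; rewrite lee_fin sqr_ge0.
- move=> t _; have [i0 m0] := centered_dh x.
  apply: (mean_sq_ge i0 m0 (a := eg x t)).
  by apply: measurable_enorm_sq; apply: measurable_rVB; [exact: measurable_cst|exact: meh].
Qed.

Lemma dh_variance x : (\int[P2]_zeta (enorm (dh x zeta - grad h x) ^+ 2)%:E <= (G0 ^+ 2)%:E)%E.
Proof.
apply: le_trans (oracle_variance x).
rewrite fubini_tonelli2//; last by move=> z; rewrite lee_fin sqr_ge0.
apply: ge0_le_integral => //.
- by move=> t _; rewrite lee_fin sqr_ge0.
- by apply/measurable_EFinP; exact: (measurable_enorm_sq (meh x)).
- by apply: measurable_fun_fubini_tonelli_G => // z; rewrite lee_fin sqr_ge0.
- move=> t _; have [i0 m0] := centered_dg x; rewrite /fubini_G.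
  under [leRHS]eq_integral do rewrite enormB.
  apply: (mean_sq_ge i0 m0 (a := eh x t)).
  by apply: measurable_enorm_sq; apply: measurable_rVB; [exact: measurable_cst|exact: meg].
Qed.

End OracleVariance.

Section SpgStep.
Context {R : realType} {d : nat}.
Local Notation V := 'rV[R]_d.
Variables (g : V -> R) (L mu gam : R) (b x z : V).
Hypotheses (L0 : 0 < L) (mu0 : 0 < mu) (gamL : 3 * L <= gam)
  (cg : convex_function [set: V] g) (sg : smooth L g).
Local Notation F := (stage_obj g mu gam b x).
Let eta (t : nat) : R := 3 / (gam * t.+1%:R).

Let gam0 : 0 < gam. Proof. by apply: lt_le_trans gamL; rewrite mulr_gt0. Qed.

Let eta0 t : 0 < eta t.
Proof. by rewrite divr_gt0// mulr_gt0// ltr0n. Qed.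

Lemma spg_step_le (y y' e : V) (t : nat) : (1 <= t)%N ->
  grad g y + e - b + mu^-1 *: y' + gam *: (y' - x) + (eta t)^-1 *: (y' - y) = 0 ->
  t.+1%:R * (F y' - F z) <=
  t.+1%:R * (- dot e (y - z)) + 3 / gam * enorm e ^+ 2
  + gam / 6 * (t.+1%:R ^+ 2 * enorm (y - z) ^+ 2 - t.+2%:R ^+ 2 * enorm (y' - z) ^+ 2).
Proof.
move=> t1 E; have t0 : 0 < (t.+1%:R : R) by rewrite ltr0n.
have etaL : eta t * L <= 2^-1.
  rewrite /eta mulrAC ler_pdivrMr ?mulr_gt0//.
  have : 2 <= (t.+1%:R : R) by rewrite ler_nat.
  move: gamL gam0 L0; nra.
have etaL1 : eta t * L < 1 by lra.
have := prox_gradient_step z (lt0r_neq0 mu0) (eta0 t) etaL1 cg sg E.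
set u := enorm (y - z) ^+ 2; set u' := enorm (y' - z) ^+ 2; set n := enorm e ^+ 2.
have u'0 : 0 <= u' by exact: sqr_ge0.
have n0 : 0 <= n by exact: sqr_ge0.
have c1 : eta t / (2 * (1 - eta t * L)) * n <= eta t * n.
  by rewrite ler_wpM2r// ler_pdivrMr ?mulr_gt0 ?subr_gt0// ler_peMr ?(ltW (eta0 t))//; lra.
have c2 : (2 * eta t)^-1 = gam * t.+1%:R / 6.
  by rewrite /eta; field; rewrite !gt_eqF.
have c3 : gam * t.+1%:R / 6 * u' + gam / 2 * u' <= (gam * t.+1%:R / 6 + (gam + mu^-1) / 2) * u'.
  rewrite -mulrDl ler_wpM2r// lerD2l ler_pM2r ?invr_gt0// lerDl invr_ge0 ltW//.
rewrite c2 => h1.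
have h2 : F y' - F z <= - dot e (y - z) + eta t * n + gam * t.+1%:R / 6 * u
    - (gam * t.+1%:R / 6 * u' + gam / 2 * u') by lra.
have := ler_wpM2l (ltW t0) h2.
have c4 : t.+1%:R * (eta t * n) = 3 / gam * n by rewrite /eta; field; rewrite !gt_eqF.
have c5 : t.+2%:R ^+ 2 * u' <= t.+1%:R * (t.+1%:R + 3) * u'.
  rewrite ler_wpM2r// -[t.+2%:R]natr1; move: t0; have := ler0n R t; rewrite -[t.+1%:R]natr1; nra.
have := ler_wpM2l (ltW gam0) c5.
rewrite !mulrDr c4; lra.
Qed.

Lemma sum_2_to_T (T : nat) : \sum_(2 <= t < T.+2) (t%:R : R) = T%:R * (T%:R + 3) / 2.
Proof.
elim: T => [|T IH]; first by rewrite big_geq// !mul0r.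
rewrite big_nat_recr//= IH -!natr1; by field.
Qed.

Lemma spg_sum_le (y e : nat -> V) (x' : V) (T : nat) : (1 <= T)%N ->
  (forall t, (1 <= t <= T)%N ->
    grad g (y t) + e t - b + mu^-1 *: y t.+1 + gam *: (y t.+1 - x)
      + (eta t)^-1 *: (y t.+1 - y t) = 0) ->
  x' = (\sum_(2 <= t < T.+2) t%:R)^-1 *: \sum_(2 <= t < T.+2) t%:R *: y t ->
  T%:R * (T%:R + 3) / 2 * (F x' - F z) <=
  \sum_(1 <= t < T.+1) (t.+1%:R * (- dot (e t) (y t - z)) + 3 / gam * enorm (e t) ^+ 2)
  + 2 / 3 * gam * enorm (y 1%N - z) ^+ 2.
Proof.
move=> T1 E ->; have T0 : 0 < (T%:R : R) by rewrite ltr0n.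
have W0 : 0 < \sum_(2 <= t < T.+2) (t%:R : R).
  by rewrite sum_2_to_T divr_gt0// mulr_gt0// addr_gt0.
have := stage_obj_mean_le b x z y mu0 (ltW gam0) cg sg (fun t : nat => ler0n R t) W0.
rewrite {1}sum_2_to_T => h1; apply: le_trans h1 _.
rewrite big_add1 /=.
suff H n : (n <= T)%N -> \sum_(1 <= t < n.+1) t.+1%:R * (F (y t.+1) - F z) <=
   \sum_(1 <= t < n.+1) (t.+1%:R * (- dot (e t) (y t - z)) + 3 / gam * enorm (e t) ^+ 2)
   + gam / 6 * (4 * enorm (y 1%N - z) ^+ 2 - n.+2%:R ^+ 2 * enorm (y n.+1 - z) ^+ 2).
  apply: le_trans (H T (leqnn T)) _; rewrite lerD2l.
  have : 0 <= gam * (T.+2%:R ^+ 2 * enorm (y T.+1 - z) ^+ 2).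
    exact: (mulr_ge0 (ltW gam0) (mulr_ge0 (sqr_ge0 _) (sqr_ge0 _))).
  lra.
elim: n => [_|n IH nT].
  by rewrite !big_geq// add0r (_ : 2%:R ^+ 2 = 4) ?subrr ?mulr0// expr2; ring.
rewrite big_nat_recr//= [X in _ <= X + _]big_nat_recr//=.
have {}IH := IH (ltnW nT).
have := @spg_step_le (y n.+1) (y n.+2) (e n.+1) n.+1 isT (E n.+1 nT).
move: IH; set s1 := \sum_(1 <= t < n.+1) _; set s2 := \sum_(1 <= t < n.+1) _.
move: (enorm (y 1%N - z) ^+ 2) (enorm (y n.+1 - z) ^+ 2) (enorm (y n.+2 - z) ^+ 2) => p1 p2 p3.
move: (n.+2%:R ^+ 2) (n.+3%:R ^+ 2) => q1 q2; lra.
Qed.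

End SpgStep.

Section MeasurableStage.
Context {R : realType} {d : nat}.
Local Notation V := 'rV[R]_d.
Context {L nu : R} {g h : V -> R} {r : V -> \bar R} {p : R -> V -> V}.
Hypothesis Hdc : dc_problem L nu g h r p.
Hypothesis mp : forall mu : R, 0 < mu -> measurable_fun setT (p mu : borelV R d -> borelV R d).
Variables (mu gam : R).
Hypotheses (mu0 : 0 < mu) (gam0 : 0 <= gam).

Lemma measurable_grad_g : measurable_fun setT (grad g : borelV R d -> borelV R d).
Proof. exact: (lipschitz_measurable (ltW (dc_L_gt0 Hdc)) (dc_g_smooth Hdc).2). Qed.

Lemma measurable_grad_h : measurable_fun setT (grad h : borelV R d -> borelV R d).
Proof.
have /andP[nu0 _] := dc_nu Hdc.
exact: (holder_measurable (ltW (dc_L_gt0 Hdc)) nu0 (dc_h_holder Hdc).2).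
Qed.

Lemma measurable_dc_slope : measurable_fun setT (@dc_slope R d h p mu : borelV R d -> borelV R d).
Proof.
apply: measurable_rVD; first exact: measurable_grad_h.
by apply: measurable_rVZ; exact: mp.
Qed.

Lemma measurable_dc_stage_sol :
  measurable_fun setT (@dc_stage_sol R d g h p mu gam : borelV R d -> borelV R d).
Proof.
have L0 := ltW (dc_L_gt0 Hdc).
pose res (u : V) : V := xget 0 [set z | stage_grad g mu gam u 0 z = 0].
have resP u : stage_grad g mu gam u 0 (res u) = 0.
  have [z zmin] := stage_argmin_ex u 0 mu0 gam0 L0 (dc_g_convex Hdc) (dc_g_smooth Hdc).
  have hz := stage_argmin_grad0 mu0 gam0 L0 (dc_g_smooth Hdc) zmin.
  exact: (@xgetPex _ 0 [set z | stage_grad g mu gam u 0 z = 0] (ex_intro _ z hz)).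
have s0 : 0 < gam + mu^-1 by rewrite ltr_wpDl// invr_gt0.
have res_lip u u' : enorm (res u - res u') <= (gam + mu^-1)^-1 * enorm (u - u').
  rewrite ler_pdivlMl//.
  have := stage_solution_lipschitz mu0 gam0 (dc_g_convex Hdc) (dc_g_smooth Hdc) (resP u) (resP u').
  by rewrite scaler0 !addr0.
have mres : measurable_fun setT (res : borelV R d -> borelV R d).
  by apply: lipschitz_measurable res_lip; rewrite invr_ge0 ltW.
have solE (x : V) : @dc_stage_sol R d g h p mu gam x = res (@dc_slope R d h p mu x + gam *: x).
  set u := _ + gam *: x.
  have := stage_solution_lipschitz mu0 gam0 (dc_g_convex Hdc) (dc_g_smooth Hdc)
    (dc_stage_solP Hdc x mu0 gam0) (resP u).
  rewrite scaler0 addr0 -/u subrr enorm0 pmulr_rle0// => h0.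
  by apply/eqP; rewrite -subr_eq0; apply/eqP/enorm_eq0/eqP; rewrite eq_le h0 enorm_ge0.
have -> : @dc_stage_sol R d g h p mu gam = res \o (fun x : V => @dc_slope R d h p mu x + gam *: x).
  by apply/funext => x; rewrite solE.
apply: (measurableT_comp mres); apply: measurable_rVD; first exact: measurable_dc_slope.
by apply: measurable_rVZ; exact: measurable_id.
Qed.

Lemma measurable_g : measurable_fun setT (g : borelV R d -> R).
Proof.
apply: continuous_measurable_borelV => x.
exact: (differentiable_continuous ((dc_g_smooth Hdc).1 x)).
Qed.

Lemma measurable_h : measurable_fun setT (h : borelV R d -> R).
Proof.
apply: continuous_measurable_borelV => x.
exact: (differentiable_continuous ((dc_h_holder Hdc).1 x)).
Qed.

Lemma measurable_moreau_real :
  measurable_fun setT (@moreau_real R d r p mu : borelV R d -> R).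
Proof.
apply: (measurability _ (RGenInftyO.measurableE R)) => _ [_ [a ->] <-].
apply: sub_sigma_algebra; rewrite setTI.
pose phi (y x : V) : R := (2 * mu)^-1 * enorm (p mu y - x) ^+ 2 + fine (r (p mu y)).
have -> : @moreau_real R d r p mu @^-1` `]-oo, a[%classic =
   \bigcup_(y in setT) (phi y @^-1` `]-oo, a[%classic).
  apply/seteqP; split => [x /=|x [y _] /=]; rewrite !in_itv/=.
    by move=> xa; exists x => //=; rewrite in_itv.
  by apply: le_lt_trans; exact: (moreau_real_le Hdc).
apply: bigcup_open => y _.
have /continuousP : continuous (phi y).
  apply: enorm_calm_continuous => x.
  exists ((2 * mu)^-1 * (2 * enorm (p mu y - x) + 1)) => x' x'1.
  have c0 : 0 < (2 * mu)^-1 by rewrite invr_gt0 mulr_gt0.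
  have -> : phi y x' - phi y x = (2 * mu)^-1 *
      (enorm (x' - x) ^+ 2 - 2 * dot (p mu y - x) (x' - x)).
    by rewrite /phi; dot_expand; ring.
  rewrite normrM (gtr0_norm c0) -mulrA ler_pM2l//.
  have h1 := dot_le_enorm (p mu y - x) (x' - x).
  have h2 := dot_le_enorm (- (p mu y - x)) (x' - x); rewrite dotNl enormN in h2.
  have h3 : enorm (x' - x) ^+ 2 <= enorm (x' - x) by rewrite expr2 ler_piMr ?enorm_ge0.
  have h4 := sqr_ge0 (enorm (x' - x)).
  by rewrite ler_norml; apply/andP; split; lra.
by apply; exact: interval_open.
Qed.

Lemma measurable_smoothed_real :
  measurable_fun setT (@smoothed_real R d g h r p mu : borelV R d -> R).
Proof.
apply: measurable_funD; last exact: measurable_moreau_real.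
by apply: measurable_funB; [exact: measurable_g|exact: measurable_h].
Qed.

Context {dT : measure_display} {T : measurableType dT} (X Y : T -> borelV R d).
Hypotheses (mX : measurable_fun setT X) (mY : measurable_fun setT Y).

Let mdc_stage (Z : T -> borelV R d) : measurable_fun setT Z ->
  measurable_fun setT (fun w => @dc_stage R d g h p mu gam (X w) (Z w)).
Proof.
move=> mZ; rewrite /dc_stage /stage_obj.
apply: measurable_funD.
  apply: measurable_funB.
    apply: measurable_funD; first exact: (measurableT_comp measurable_g mZ).
    by apply: measurable_funM => //; exact: measurable_enorm_sq.
  by apply: measurable_dot => //; exact: (measurableT_comp measurable_dc_slope mX).
by apply: measurable_funM => //; apply: measurable_enorm_sq; exact: measurable_rVB.
Qed.

Lemma measurable_stage_sol_comp :
  measurable_fun setT (fun w => @dc_stage_sol R d g h p mu gam (X w) : borelV R d).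
Proof. exact: (measurableT_comp measurable_dc_stage_sol mX). Qed.

Lemma measurable_end_gap :
  measurable_fun setT (fun w => @end_gap R d g h p mu gam (X w) (Y w)).
Proof.
by apply: measurable_funB; apply: mdc_stage => //; exact: measurable_stage_sol_comp.
Qed.

Lemma measurable_start_gap :
  measurable_fun setT (fun w => @start_gap R d g h p mu gam (X w)).
Proof.
by apply: measurable_funB; apply: mdc_stage => //; exact: measurable_stage_sol_comp.
Qed.

End MeasurableStage.

Section SpgMeasurability.
Context {R : realType} {d : nat}.
Local Notation V := 'rV[R]_d.
Context {L nu : R} {g h : V -> R} {r : V -> \bar R} {p : R -> V -> V}.
Context {d1 d2 dS : measure_display} {T1 : measurableType d1} {T2 : measurableType d2}
  {S : measurableType dS}.
Context {dg : V -> T1 -> V} {dh : V -> T2 -> V}.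
Hypotheses (mdg : measurable_fun setT (fun z : borelV R d * T1 => dg z.1 z.2 : borelV R d))
  (mdh : measurable_fun setT (fun z : borelV R d * T2 => dh z.1 z.2 : borelV R d)).
Variables (mu : R) (gamma : nat -> R) (T : nat -> nat) (K : nat) (x1 : V)
  (xi : nat -> nat -> S -> T1) (zeta : nat -> nat -> S -> T2)
  (x : nat -> S -> V) (y : nat -> nat -> S -> V).
Hypotheses (mp : measurable_fun setT (p mu : borelV R d -> borelV R d))
  (mu0 : 0 < mu) (gamma0 : forall k, (1 <= k)%N -> 0 < gamma k)
  (path : forall w, spg_path dg dh (p mu) mu gamma T K x1 (fun k t => xi k t w)
     (fun k t => zeta k t w) (fun k => x k w) (fun k t => y k t w)).

Lemma measurable_dg_comp (X : S -> borelV R d) (Y : S -> T1) :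
  measurable_fun setT X -> measurable_fun setT Y ->
  measurable_fun setT (fun w => dg (X w) (Y w) : borelV R d).
Proof. by move=> mX mY; exact: (measurableT_comp mdg (measurable_fun_pair mX mY)). Qed.

Lemma measurable_dh_comp (X : S -> borelV R d) (Y : S -> T2) :
  measurable_fun setT X -> measurable_fun setT Y ->
  measurable_fun setT (fun w => dh (X w) (Y w) : borelV R d).
Proof. by move=> mX mY; exact: (measurableT_comp mdh (measurable_fun_pair mX mY)). Qed.

Lemma spg_iterate_measurable k t : (1 <= k <= K)%N -> (1 <= t <= (T k).+1)%N ->
  measurable_fun setT (x k : S -> borelV R d) ->
  (forall t', (1 <= t' < t)%N -> measurable_fun setT (xi k t') /\ measurable_fun setT (zeta k t')) ->
  measurable_fun setT (y k t : S -> borelV R d).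
Proof.
move=> kK; have k1 : (1 <= k)%N by case/andP: kK.
elim: t => [//|t IH] /andP[_ tT] mx ms.
case: (posnP t) => [->|t0].
  by have -> : y k 1%N = x k by apply/funext => w; exact: (spg_stage_init (path w) kK).
rewrite ltnS in tT; have tT' : (1 <= t <= T k)%N by rewrite t0.
have {}IH : measurable_fun setT (y k t : S -> borelV R d).
  apply: IH => //; first by rewrite t0 ltnW.
  by move=> t' /andP[t'1 t't]; apply: ms; rewrite t'1 ltnS ltnW.
have [mxi mzeta] := ms t ltac:(by rewrite t0 ltnSn).
have gk0 := gamma0 k1.
have eta0 : 0 < 3 / (gamma k * t.+1%:R) by rewrite divr_gt0// mulr_gt0// ltr0n.
set eta := 3 / (gamma k * t.+1%:R) in eta0.
pose v w := dg (y k t w) (xi k t w) - dh (x k w) (zeta k t w) - mu^-1 *: p mu (x k w).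
have -> : y k t.+1 = (fun w => (mu^-1 + gamma k + eta^-1)^-1 *:
    (gamma k *: x k w + eta^-1 *: y k t w - v w)).
  apply/funext => w.
  have opt := prox_step_optimality mu0 (ltW gk0) eta0 (spg_step (path w) kK tT').
  rewrite -/(v w) in opt.
  exact: prox_step_explicit.
apply: measurable_rVZ; apply: measurable_rVB.
  by apply: measurable_rVD; apply: measurable_rVZ.
apply: measurable_rVB; last by apply: measurable_rVZ; exact: (measurableT_comp mp mx).
by apply: measurable_rVB; [exact: measurable_dg_comp|exact: measurable_dh_comp].
Qed.

Lemma spg_stage_measurable k : (1 <= k <= K.+1)%N ->
  (forall k' t', (1 <= k' < k)%N -> (1 <= t' <= T k')%N ->
     measurable_fun setT (xi k' t') /\ measurable_fun setT (zeta k' t')) ->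
  measurable_fun setT (x k : S -> borelV R d).
Proof.
elim: k => [//|k IH] /andP[_ kK] ms.
case: (posnP k) => [->|k0].
  have -> : x 1%N = cst x1 by apply/funext => w; exact: (spg_init (path w)).
  exact: measurable_cst.
rewrite ltnS in kK; have kK' : (1 <= k <= K)%N by rewrite k0.
have {}IH : measurable_fun setT (x k : S -> borelV R d).
  apply: IH; first by rewrite k0 ltnW.
  by move=> k' t' /andP[k'1 k'k]; apply: ms; rewrite k'1 ltnS ltnW.
have -> : x k.+1 = (fun w => (\sum_(2 <= t < (T k).+2) t%:R)^-1 *:
    \sum_(t <- index_iota 2 (T k).+2) (if (1 <= t <= (T k).+1)%N then t%:R *: y k t w else 0)).
  apply/funext => w; rewrite (spg_output (path w) kK'); congr (_ *: _).
  rewrite big_nat_cond [RHS]big_nat_cond; apply: eq_bigr => t; rewrite andbT => /andP[t2 tT].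
  by rewrite (ltnW t2) -ltnS tT.
apply: measurable_rVZ; apply: measurable_rV_sum => t.
case tT : (1 <= t <= (T k).+1)%N; last exact: measurable_cst.
apply: measurable_rVZ; apply: spg_iterate_measurable => // t' /andP[t'1 t't].
by apply: ms; rewrite ?k0 ?ltnSn// t'1 -ltnS (leq_trans t't)//; case/andP: tT.
Qed.

End SpgMeasurability.

Section SampledNoise.
Context {R : realType} {d : nat}.
Local Notation V := 'rV[R]_d.
Context {dO d1 d2 : measure_display} {Om : measurableType dO} {S : measurableType d1}
  {U : measurableType d2} {P : probability Om R} {Q : probability U R}.
Context {X : Om -> S} {s : Om -> U} {f : S -> U -> V} {G0 : R}.
Hypotheses (mX : measurable_fun setT X) (ms : measurable_fun setT s)
  (indXs : forall A B, measurable A -> measurable B ->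
     (P (X @^-1` A `&` s @^-1` B) = P (X @^-1` A) * Q B)%E)
  (mf : measurable_fun setT (fun q : S * U => f q.1 q.2 : borelV R d))
  (if0 : forall a, (forall i, Q.-integrable setT (fun t => (f a t 0 i)%:E)) /\ vecE Q (f a) = 0)
  (fG : forall a, (\int[Q]_t (enorm (f a t) ^+ 2)%:E <= (G0 ^+ 2)%:E)%E).

Lemma noise_measurable : measurable_fun setT (fun w => f (X w) (s w) : borelV R d).
Proof. exact: (measurableT_comp mf (measurable_fun_pair mX ms)). Qed.

Lemma noise_sq_mean :
  P.-integrable setT (EFin \o (fun w => enorm (f (X w) (s w)) ^+ 2)) /\
  \int[P]_w (enorm (f (X w) (s w)) ^+ 2) <= G0 ^+ 2.
Proof.
have mf2 : measurable_fun setT (fun q : S * U => (enorm (f q.1 q.2) ^+ 2)%:E).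
  by apply/measurable_EFinP; exact: measurable_enorm_sq.
have f20 (q : S * U) : (0 <= (enorm (f q.1 q.2) ^+ 2)%:E)%E by rewrite lee_fin sqr_ge0.
have Ef : (\int[P]_w (enorm (f (X w) (s w)) ^+ 2)%:E <= (G0 ^+ 2)%:E)%E.
  have /= -> := freezing_ge0 mX ms indXs mf2 f20.
  rewrite -(integral_prob_cst P (G0 ^+ 2)%:E); apply: ge0_le_integral => //.
  - by move=> w _; apply: integral_ge0 => t _; exact: (f20 (X w, t)).
  - exact: (measurableT_comp (measurable_fun_fubini_tonelli_F (m2 := Q) _ mf2 f20) mX).
have i : P.-integrable setT (EFin \o (fun w => enorm (f (X w) (s w)) ^+ 2)).
  apply/integrableP; split; first exact/measurable_EFinP/measurable_enorm_sq/noise_measurable.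
  under eq_integral do rewrite gee0_abs ?lee_fin ?sqr_ge0//.
  by apply: le_lt_trans Ef _; rewrite ltry.
by split => //; rewrite -lee_fin fineK//; exact: (integrable_fin_num measurableT i).
Qed.

Lemma noise_dot_mean (v : S -> borelV R d) : measurable_fun setT v ->
  P.-integrable setT (EFin \o (fun w => enorm (v (X w) : V) ^+ 2)) ->
  P.-integrable setT (EFin \o (fun w => dot (v (X w) : V) (f (X w) (s w)))) /\
  \int[P]_w (dot (v (X w) : V) (f (X w) (s w))) = 0.
Proof.
move=> mv iv; have [ie _] := noise_sq_mean.
have i := integrableD measurableT iv ie.
have id_ : P.-integrable setT (EFin \o (fun w => dot (v (X w) : V) (f (X w) (s w)))).
  apply: integrable_dominated i _ => [|w].
    by apply: measurable_dot; [exact: (measurableT_comp mv mX)|exact: noise_measurable].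
  move: (v (X w) : V) (f (X w) (s w)) => a b.
  have := sqr_ge0 (enorm (a + b)); have := sqr_ge0 (enorm (a - b)).
  have := sqr_ge0 (enorm a); have := sqr_ge0 (enorm b).
  rewrite ler_norml; dot_expand => *; apply/andP; split; lra.
split => //; rewrite /Rintegral.
have mvf : measurable_fun setT (fun q : S * U => dot (v q.1 : V) (f q.1 q.2)).
  by apply: measurable_dot => //; exact: (measurableT_comp mv measurable_fst).
have -> // := freezing_eq0 mX ms indXs mvf id_.
by move=> a; have [c1 c2] := if0 a; exact: (integral_dot_eq0 c1 c2 (v a)).
Qed.

End SampledNoise.

Section SpgRun.
Context {R : realType} {d : nat}.
Local Notation V := 'rV[R]_d.
Context {L nu : R} {g h : V -> R} {r : V -> \bar R} {p : R -> V -> V}.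
Hypothesis Hdc : dc_problem L nu g h r p.
Context {d1 d2 : measure_display} {T1 : measurableType d1} {T2 : measurableType d2}
  {P1 : probability T1 R} {P2 : probability T2 R}.
Context {gs : V -> T1 -> R} {hs : V -> T2 -> R} {dg : V -> T1 -> V} {dh : V -> T2 -> V} {G0 : R}.
Hypotheses (orc : stochastic_oracles P1 P2 g h gs hs dg dh) (var : variance_bound P1 P2 dg dh G0).
Hypothesis mp : forall mu : R, 0 < mu -> measurable_fun setT (p mu : borelV R d -> borelV R d).
Context {dO : measure_display} {Om : measurableType dO} {P : probability Om R}.
Variables (mu al : R) (gamma : nat -> R) (T : nat -> nat) (K : nat) (x1 : V)
  (xi : nat -> nat -> Om -> T1) (zeta : nat -> nat -> Om -> T2) (tau : Om -> nat)
  (x : nat -> Om -> V) (y : nat -> nat -> Om -> V).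
Hypotheses (mu0 : 0 < mu) (gammaL : forall k, (1 <= k)%N -> 3 * L <= gamma k)
  (run : spg_run P P1 P2 dg dh (p mu) mu al gamma T K x1 xi zeta tau x y).

Let L0 : 0 < L. Proof. exact: dc_L_gt0 Hdc. Qed.

Let gamma0 k : (1 <= k)%N -> 0 < gamma k.
Proof. by move=> k1; apply: lt_le_trans (gammaL k1); rewrite mulr_gt0. Qed.

Let I : eqType := ((nat * nat) + (nat * nat) + unit)%type.

Let idx : seq (nat * nat) := [seq (k, t) | k <- iota 1 K, t <- iota 1 (T k)].

Let idxP k t : ((k, t) \in idx) = ((1 <= k <= K)%N && (1 <= t <= T k)%N).
Proof.
apply/allpairsPdep/andP => [[k' [t' [h1 h2 [-> ->]]]]|[h1 h2]].
  by move: h1 h2; rewrite !mem_iota !add1n !ltnS.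
by exists k, t; rewrite !mem_iota !add1n !ltnS.
Qed.

Definition spg_samples (b : pred (nat * nat)) : seq ((nat * nat) + (nat * nat) + unit) :=
  undup ([seq inl (inl q) | q <- idx & b q] ++ [seq inl (inr q) | q <- idx & b q]).

Lemma mem_spg_samples b j : (j \in spg_samples b) =
  match j with
  | inl (inl q) | inl (inr q) => (q \in idx) && b q
  | inr _ => false
  end.
Proof.
rewrite mem_undup mem_cat.
have injl : injective (fun q : nat * nat => inl (inl q) : I) by move=> ? ? [].
have injr : injective (fun q : nat * nat => inl (inr q) : I) by move=> ? ? [].
case: j => [[q|q]|u].
- rewrite (mem_map injl) mem_filter andbC; case: (_ && _) => //=.
  by apply/negP => /mapP[].
- rewrite (mem_map injr) mem_filter andbC orbC; case: (_ && _) => //=.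
  by apply/negP => /mapP[].
- by apply/negP => /orP[] /mapP[].
Qed.

Definition spg_history (b : pred (nat * nat)) : set (set Om) :=
  \bigcup_(j in [set` spg_samples b]) spg_sigma xi zeta tau j.

Let spg_sigmaE j : spg_index T K j ->
  sigma_algebra setT (spg_sigma xi zeta tau j) /\ spg_sigma xi zeta tau j `<=` measurable.
Proof.
case: j => [[[k t]|[k t]]|u] /=; (try case/andP=> hk ht);
  (split; [exact: sigma_of_algebra|apply: sigma_of_measurable]).
- exact: (spg_xi_law run hk ht).1.
- exact: (spg_zeta_law run hk ht).1.
- by case: (spg_tau_law run).
Qed.

Let spg_samples_index b j : j \in spg_samples b -> spg_index T K j.
Proof. by rewrite mem_spg_samples; case: j => [[[k t]|[k t]]|u] // /andP[]; rewrite idxP. Qed.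

Lemma spg_history_measurable b : <<s spg_history b>> `<=` measurable.
Proof.
apply: smallest_sub; first exact: sigma_algebra_measurable.
by move=> A [j /= jJ]; apply: (spg_sigmaE _).2; exact: spg_samples_index jJ.
Qed.

Lemma spg_history_independent b j A B : spg_index T K j -> j \notin spg_samples b ->
  <<s spg_history b>> A -> spg_sigma xi zeta tau j B -> (P (A `&` B) = P A * P B)%E.
Proof.
move=> jI jJ; apply: (independent_generated (spg_indep run)).
- by rewrite /= jJ undup_uniq.
- by rewrite /= jI; apply/allP => j'; exact: spg_samples_index.
- move=> j'; rewrite in_cons => /orP[/eqP ->|/spg_samples_index]; exact: spg_sigmaE.
Qed.

Let Hist b := g_sigma_algebraType (spg_history b).

Let measurable_history b {d'} {U : measurableType d'} (X : Om -> U) :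
  measurable_fun setT (X : Hist b -> U) -> measurable_fun setT X.
Proof. by move=> mX mT A mA; apply: (spg_history_measurable (b := b)); exact: mX. Qed.

Let measurable_samples (b : pred (nat * nat)) k t : (1 <= k <= K)%N -> (1 <= t <= T k)%N -> b (k, t) ->
  measurable_fun setT (xi k t : Hist b -> T1) /\ measurable_fun setT (zeta k t : Hist b -> T2).
Proof.
move=> hk ht bkt; split => _ A mA; apply: sub_sigma_algebra.
  exists (inl (inl (k, t))); last by exists A.
  by rewrite /= mem_spg_samples idxP hk ht bkt.
exists (inl (inr (k, t))); last by exists A.
by rewrite /= mem_spg_samples idxP hk ht bkt.
Qed.

Lemma spg_point_measurable (b : pred (nat * nat)) k : (1 <= k <= K.+1)%N ->
  (forall k' t', (1 <= k' < k)%N -> b (k', t')) ->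
  measurable_fun setT (x k : Hist b -> borelV R d).
Proof.
move=> kK hb.
apply: (@spg_stage_measurable R d p d1 d2 _ T1 T2 (g_sigma_algebraType (spg_history b)) dg dh
  (so_dg_meas orc) (so_dh_meas orc) mu gamma T K x1 xi zeta x y (mp mu0) mu0 gamma0
  (spg_traj run) _ kK) => k' t' k'k t'T.
apply: measurable_samples => //; last exact: hb.
by case/andP: k'k => -> k'k; rewrite -ltnS (leq_trans k'k)//; case/andP: kK.
Qed.

Section Stage.
Variable k : nat.
Hypothesis kK : (1 <= k <= K)%N.

Let k1 : (1 <= k)%N. Proof. by case/andP: kK. Qed.
Let kK1 : (1 <= k <= K.+1)%N. Proof. by case/andP: kK => -> /leqW ->. Qed.

Let past t : pred (nat * nat) := fun q => (q.1 < k)%N || ((q.1 == k) && (q.2 < t)%N).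

Let mx t : measurable_fun setT (x k : Hist (past t) -> borelV R d).
Proof.
by apply: spg_point_measurable => // k' t' /andP[_ k'k]; rewrite /past /= k'k.
Qed.

Let my t : (1 <= t <= (T k).+1)%N -> measurable_fun setT (y k t : Hist (past t) -> borelV R d).
Proof.
move=> tT.
refine (@spg_iterate_measurable R d p d1 d2 _ T1 T2 (g_sigma_algebraType (spg_history (past t)))
  dg dh (so_dg_meas orc) (so_dh_meas orc) mu gamma T K x1 xi zeta x y (mp mu0) mu0 gamma0
  (spg_traj run) k t kK tT (@mx t) _) => t' /andP[t'1 t't].
apply: measurable_samples => //; last by rewrite /past /= eqxx t't orbT.
by rewrite t'1 -ltnS (leq_trans t't)//; case/andP: tT.
Qed.

Let mxy t : (1 <= t <= (T k).+1)%N ->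
  measurable_fun setT ((fun w => (x k w, y k t w)) : Hist (past t) -> borelV R d * borelV R d).
Proof. by move=> tT; apply: measurable_fun_pair; [exact: mx|exact: my]. Qed.

Let past_now t : past t (k, t) = false.
Proof. by rewrite /past /= !ltnn andbF. Qed.

Let ind_xi t A B : (1 <= t <= T k)%N -> measurable A -> measurable B ->
  (P ((fun w => (x k w : borelV R d, y k t w : borelV R d)) @^-1` A `&` xi k t @^-1` B) =
   P ((fun w => (x k w : borelV R d, y k t w : borelV R d)) @^-1` A) * P1 B)%E.
Proof.
move=> tT mA mB; rewrite -((spg_xi_law run kK tT).2 B mB).
have tT' : (1 <= t <= (T k).+1)%N by case/andP: tT => -> /leqW ->.
apply: (@spg_history_independent (past t) (inl (inl (k, t)))).
- by rewrite /= kK tT.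
- by rewrite mem_spg_samples past_now andbF.
- by have := mxy tT' measurableT mA; rewrite setTI.
- by exists B => //; rewrite setTI.
Qed.

Let ind_zeta t A B : (1 <= t <= T k)%N -> measurable A -> measurable B ->
  (P ((fun w => (x k w : borelV R d, y k t w : borelV R d)) @^-1` A `&` zeta k t @^-1` B) =
   P ((fun w => (x k w : borelV R d, y k t w : borelV R d)) @^-1` A) * P2 B)%E.
Proof.
move=> tT mA mB; rewrite -((spg_zeta_law run kK tT).2 B mB).
have tT' : (1 <= t <= (T k).+1)%N by case/andP: tT => -> /leqW ->.
apply: (@spg_history_independent (past t) (inl (inr (k, t)))).
- by rewrite /= kK tT.
- by rewrite mem_spg_samples past_now andbF.
- by have := mxy tT' measurableT mA; rewrite setTI.
- by exists B => //; rewrite setTI.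
Qed.

Let sol := @dc_stage_sol R d g h p mu (gamma k).
Let z w := sol (x k w).
Let eg t w := dg (y k t w) (xi k t w) - grad g (y k t w).
Let eh t w := dh (x k w) (zeta k t w) - grad h (x k w).
Let e t w := eg t w - eh t w.

Let msol : measurable_fun setT (sol : borelV R d -> borelV R d).
Proof. exact: (measurable_dc_stage_sol Hdc mp mu0 (ltW (gamma0 k1))). Qed.

Let mdg : measurable_fun setT
  (fun q : (borelV R d * borelV R d) * T1 => dg q.1.2 q.2 - grad g q.1.2 : borelV R d).
Proof.
have m12 : measurable_fun setT (fun q : (borelV R d * borelV R d) * T1 => q.1.2).
  exact: (measurableT_comp measurable_snd measurable_fst).
apply: measurable_rVB; first exact: (measurable_dg_comp (so_dg_meas orc) m12 measurable_snd).
exact: (measurableT_comp (measurable_grad_g Hdc) m12).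
Qed.

Let mdh : measurable_fun setT
  (fun q : (borelV R d * borelV R d) * T2 => dh q.1.1 q.2 - grad h q.1.1 : borelV R d).
Proof.
have m11 : measurable_fun setT (fun q : (borelV R d * borelV R d) * T2 => q.1.1).
  exact: (measurableT_comp measurable_fst measurable_fst).
apply: measurable_rVB; first exact: (measurable_dh_comp (so_dh_meas orc) m11 measurable_snd).
exact: (measurableT_comp (measurable_grad_h Hdc) m11).
Qed.

Let mxyP t : (1 <= t <= (T k).+1)%N ->
  measurable_fun setT (fun w => (x k w : borelV R d, y k t w : borelV R d)).
Proof. by move=> tT; apply: measurable_history; exact: mxy. Qed.

Let mxP : measurable_fun setT (x k : Om -> borelV R d).
Proof. by apply: measurable_history; exact: (@mx 0%N). Qed.

Let myP t : (1 <= t <= (T k).+1)%N -> measurable_fun setT (y k t : Om -> borelV R d).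
Proof. by move=> tT; apply: measurable_history; exact: my. Qed.

Let tW t : (1 <= t <= T k)%N -> (1 <= t <= (T k).+1)%N.
Proof. by case/andP=> -> /leqW ->. Qed.

Let mzP : measurable_fun setT (z : Om -> borelV R d).
Proof. exact: (measurableT_comp msol mxP). Qed.

Let fg (q : borelV R d * borelV R d) xi0 := dg q.2 xi0 - grad g q.2.
Let fh (q : borelV R d * borelV R d) zeta0 := dh q.1 zeta0 - grad h q.1.

Let eg_mean t (tT : (1 <= t <= T k)%N) :=
  noise_sq_mean (f := fg) (mxyP (tW tT)) (spg_xi_law run kK tT).1 (fun A B => @ind_xi t A B tT) mdg
    (fun q => dg_variance orc var q.2).

Let eh_mean t (tT : (1 <= t <= T k)%N) :=
  noise_sq_mean (f := fh) (mxyP (tW tT)) (spg_zeta_law run kK tT).1 (fun A B => @ind_zeta t A B tT) mdh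
    (fun q => dh_variance orc var q.1).

Let eg_dot_mean t (tT : (1 <= t <= T k)%N) :=
  noise_dot_mean (f := fg) (mxyP (tW tT)) (spg_xi_law run kK tT).1 (fun A B => @ind_xi t A B tT) mdg
    (fun q => centered_dg orc q.2) (fun q => dg_variance orc var q.2).

Let eh_dot_mean t (tT : (1 <= t <= T k)%N) :=
  noise_dot_mean (f := fh) (mxyP (tW tT)) (spg_zeta_law run kK tT).1 (fun A B => @ind_zeta t A B tT) mdh
    (fun q => centered_dh orc q.1) (fun q => dh_variance orc var q.1).

Let e_measurable t : (1 <= t <= T k)%N -> measurable_fun setT (e t : Om -> borelV R d).
Proof.
move=> tT; apply: measurable_rVB.
  exact: (noise_measurable (f := fg) (mxyP (tW tT)) (spg_xi_law run kK tT).1 mdg).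
exact: (noise_measurable (f := fh) (mxyP (tW tT)) (spg_zeta_law run kK tT).1 mdh).
Qed.

Let e_sq t : (1 <= t <= T k)%N ->
  P.-integrable setT (EFin \o (fun w => enorm (e t w) ^+ 2)) /\
  \int[P]_w (enorm (e t w) ^+ 2) <= 4 * G0 ^+ 2.
Proof.
move=> tT; have [i1 f1] := eg_mean tT; have [i2 f2] := eh_mean tT.
have j1 := integrableZl measurableT 2 i1; have j2 := integrableZl measurableT 2 i2.
have j := integrableD measurableT j1 j2.
have le w : enorm (e t w) ^+ 2 <= 2 * enorm (eg t w) ^+ 2 + 2 * enorm (eh t w) ^+ 2.
  by have := enorm_sq_le2 (eg t w) (- eh t w); rewrite enormN.
have ie : P.-integrable setT (EFin \o (fun w => enorm (e t w) ^+ 2)).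
  apply: integrable_dominated j _ => [|w]; last by rewrite ger0_norm ?sqr_ge0//; exact: le.
  by apply: measurable_enorm_sq; exact: e_measurable.
split => //; apply: le_trans (le_Rintegral measurableT ie j (fun w _ => le w)) _.
rewrite [leLHS](etrans (RintegralD measurableT j1 j2)
  (congr2 +%R (RintegralZl 2 measurableT i1) (RintegralZl 2 measurableT i2))).
have -> : 4 * G0 ^+ 2 = 2 * G0 ^+ 2 + 2 * G0 ^+ 2 by ring.
apply: lerD; rewrite (ler_pM2l (ltr0n R 2)); [exact: f1|exact: f2].
Qed.

Let e_mean0 t : (1 <= t <= T k)%N ->
  P.-integrable setT (EFin \o (fun w => enorm (y k t w - z w) ^+ 2)) ->
  P.-integrable setT (EFin \o (fun w => dot (e t w) (y k t w - z w))) /\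
  \int[P]_w (dot (e t w) (y k t w - z w)) = 0.
Proof.
move=> tT iy.
pose v (q : borelV R d * borelV R d) : borelV R d := (q.2 : V) - sol q.1.
have mv : measurable_fun setT v.
  by apply: measurable_rVB; [exact: measurable_snd|exact: (measurableT_comp msol measurable_fst)].
have [i1 E1] := eg_dot_mean tT mv iy; have [i2 E2] := eh_dot_mean tT mv iy.
have -> : (fun w => dot (e t w) (y k t w - z w)) =
    (fun w => dot (y k t w - z w) (eg t w) - dot (y k t w - z w) (eh t w)).
  by apply/funext => w; rewrite /e dotC dotDr dotNr.
split; first exact: (integrableB measurableT i1 i2).
by rewrite [LHS](etrans (RintegralB measurableT i1 i2) (congr2 (fun a b => a - b) E1 E2)) subrr.
Qed.

Let opt w t : (1 <= t <= T k)%N ->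
  grad g (y k t w) + e t w - @dc_slope R d h p mu (x k w) + mu^-1 *: y k t.+1 w
  + gamma k *: (y k t.+1 w - x k w) + (3 / (gamma k * t.+1%:R))^-1 *: (y k t.+1 w - y k t w) = 0.
Proof.
move=> tT; have eta0 : 0 < 3 / (gamma k * t.+1%:R).
  by rewrite divr_gt0// mulr_gt0// ?gamma0// ltr0n.
have := prox_step_optimality mu0 (ltW (gamma0 k1)) eta0 (spg_step (spg_traj run w) kK tT).
move=> <-; rewrite /e /eg /eh /dc_slope; apply/rowP => i; rewrite !mxE; ring.
Qed.

Let A w := @start_gap R d g h p mu (gamma k) (x k w).
Let Phi w := @end_gap R d g h p mu (gamma k) (x k w) (x k.+1 w).
Hypothesis iA : P.-integrable setT (EFin \o A).

Let s0 : 0 < gamma k + mu^-1.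
Proof. by rewrite addr_gt0 ?invr_gt0// gamma0. Qed.

Let start_sq w : enorm (x k w - z w) ^+ 2 <= 2 / (gamma k + mu^-1) * A w.
Proof.
rewrite mulrAC ler_pdivlMr//; have := start_gap_ge Hdc (x k w) mu0 (ltW (gamma0 k1)).
rewrite -/(A w) -/sol -/(z w); lra.
Qed.

Let iA' : P.-integrable setT (EFin \o (fun w => 2 / (gamma k + mu^-1) * A w)).
Proof. exact: (integrableZl measurableT _ iA). Qed.

Let start_sq_integrable : P.-integrable setT (EFin \o (fun w => enorm (x k w - z w) ^+ 2)).
Proof.
apply: integrable_dominated iA' _ => [|w]; last by rewrite ger0_norm ?sqr_ge0.
by apply: measurable_enorm_sq; apply: measurable_rVB.
Qed.

Let iterate_integrable t : (1 <= t <= (T k).+1)%N ->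
  P.-integrable setT (EFin \o (fun w => enorm (y k t w - z w) ^+ 2)).
Proof.
elim: t => [//|t IH] /andP[_ tT]; case: (posnP t) => [->|t0].
  have -> : y k 1%N = x k by apply/funext => w; exact: (spg_stage_init (spg_traj run w) kK).
  exact: start_sq_integrable.
rewrite ltnS in tT; have tT' : (1 <= t <= T k)%N by rewrite t0.
have {}IH := IH (tW tT').
have [ie _] := e_sq tT'; have [id_ _] := e_mean0 tT' IH.
have c0 : 0 < 6 / (gamma k * t.+2%:R ^+ 2) by rewrite divr_gt0// mulr_gt0 ?gamma0// exprn_gt0// ltr0n.
pose Z w := 6 / (gamma k * t.+2%:R ^+ 2) *
  (- t.+1%:R * dot (e t w) (y k t w - z w) + (3 / gamma k * enorm (e t w) ^+ 2 +
   gamma k / 6 * t.+1%:R ^+ 2 * enorm (y k t w - z w) ^+ 2)).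
have iZ : P.-integrable setT (EFin \o Z).
  have i1 := integrableZl measurableT (- t.+1%:R) id_.
  have i2 := integrableZl measurableT (3 / gamma k) ie.
  have i3 := integrableZl measurableT (gamma k / 6 * t.+1%:R ^+ 2) IH.
  exact: (integrableZl measurableT _ (integrableD measurableT i1 (integrableD measurableT i2 i3))).
apply: integrable_dominated iZ _ => [|w].
  by apply: measurable_enorm_sq; apply: measurable_rVB => //; apply: myP.
rewrite ger0_norm ?sqr_ge0//.
have := spg_step_le (z w) L0 mu0 (gammaL k1) (dc_g_convex Hdc) (dc_g_smooth Hdc) t0 (opt w tT').
have := end_gap_ge0 Hdc (x k w) (y k t.+1 w) mu0 (ltW (gamma0 k1)).
rewrite /end_gap /dc_stage -/sol -/(z w) => h1 h2.
have {h1} h1 := mulr_ge0 (ler0n R t.+1) h1.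
have g0 := gamma0 k1.
have q0 : 0 < gamma k * t.+2%:R ^+ 2 by rewrite mulr_gt0// exprn_gt0// ltr0n.
rewrite /Z mulrAC ler_pdivlMr//.
have h3 := le_trans h1 h2; move: h3.
set u := enorm (y k t.+1 w - z w) ^+ 2; set v := enorm (y k t w - z w) ^+ 2.
set n := enorm (e t w) ^+ 2; set a := dot _ _; move: (t.+1%:R : R) (t.+2%:R ^+ 2 : R) => t1 t2.
move: (3 / gamma k * n) => q; move: (gamma k) u v a => c u' v' a'; lra.
Qed.

Let mPhi : measurable_fun setT Phi.
Proof.
have mx' : measurable_fun setT (x k.+1 : Om -> borelV R d).
  apply: (measurable_history (b := predT)); apply: spg_point_measurable => //.
  by rewrite ltnS; case/andP: kK.
exact: (measurable_end_gap Hdc mp mu0 (ltW (gamma0 k1)) mxP mx').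
Qed.

Hypotheses (T3 : (3 <= T k)%N) (Tk : 3 * L * k%:R <= gamma k * (T k)%:R).

Let bound w : R :=
  \sum_(1 <= t < (T k).+1) (- t.+1%:R * dot (e t w) (y k t w - z w) + 3 / gamma k * enorm (e t w) ^+ 2)
  + 4 / 3 * A w.

Let Phi_le w : (T k)%:R * ((T k)%:R + 3) / 2 * Phi w <= bound w.
Proof.
have T1' : (1 <= T k)%N by apply: leq_trans T3.
have := spg_sum_le (z w) L0 mu0 (gammaL k1) (dc_g_convex Hdc) (dc_g_smooth Hdc) T1'
  (fun t tT => opt w tT) (spg_output (spg_traj run w) kK).
rewrite -[X in _ * X <= _ -> _]/(Phi w) => h1; apply: le_trans h1 _.
rewrite (spg_stage_init (spg_traj run w) kK); apply: lerD.
  apply: le_of_eq; apply: eq_bigr => t _; ring.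
have g0 := gamma0 k1.
apply: le_trans (_ : 2 / 3 * gamma k * (2 / (gamma k + mu^-1) * A w) <= _).
  by rewrite ler_wpM2l// mulr_ge0// ltW.
have A0 : 0 <= A w by exact: (start_gap_ge0 Hdc _ mu0 (ltW g0)).
rewrite (_ : 2 / 3 * gamma k * _ = 4 / 3 * (gamma k / (gamma k + mu^-1)) * A w); last first.
  by move: (gamma k + mu^-1) (lt0r_neq0 s0) => s sN0; field.
rewrite ler_wpM2r// ler_piMr// ler_pdivrMr// mul1r lerDl invr_ge0; exact: ltW.
Qed.

Lemma spg_stage_mean : P.-integrable setT (EFin \o Phi) /\
  \int[P]_w Phi w <= (\int[P]_w A w) / 2 + 8 * G0 ^+ 2 / L / k%:R.
Proof.
have g0 := gamma0 k1.
have T3' : 3 <= ((T k)%:R : R) by rewrite (ler_nat R 3).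
have c0 : 0 < (T k)%:R * ((T k)%:R + 3) / 2 :> R by rewrite divr_gt0// mulr_gt0//; lra.
pose f t w := if (1 <= t <= T k)%N then
  - t.+1%:R * dot (e t w) (y k t w - z w) + 3 / gamma k * enorm (e t w) ^+ 2 else 0.
have fi t : P.-integrable setT (EFin \o f t).
  rewrite /f; case tT : (1 <= t <= T k)%N; last exact: finite_measure_integrable_cst.
  have [id_ _] := e_mean0 tT (iterate_integrable (tW tT)); have [ie _] := e_sq tT.
  have i1 := integrableZl measurableT (- t.+1%:R) id_.
  exact: (integrableD measurableT i1 (integrableZl measurableT (3 / gamma k) ie)).
have fE t : \int[P]_w f t w <= 3 / gamma k * (4 * G0 ^+ 2).
  have c3 : 0 <= 3 / gamma k by rewrite divr_ge0// ltW.
  rewrite /f; case tT : (1 <= t <= T k)%N; last first.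
    by rewrite /Rintegral integral0 mulr_ge0// mulr_ge0// sqr_ge0.
  have [id_ d0] := e_mean0 tT (iterate_integrable (tW tT)); have [ie e4] := e_sq tT.
  have i1 : P.-integrable setT (EFin \o (fun w => - t.+1%:R * dot (e t w) (y k t w - z w))).
    exact: (integrableZl measurableT (- t.+1%:R) id_).
  have i2 : P.-integrable setT (EFin \o (fun w => 3 / gamma k * enorm (e t w) ^+ 2)).
    exact: (integrableZl measurableT (3 / gamma k) ie).
  rewrite (RintegralD measurableT i1 i2) (RintegralZl (- t.+1%:R) measurableT id_) d0 mulr0 add0r.
  by rewrite (RintegralZl _ measurableT ie) ler_wpM2l.
have [iS ES] := Rintegral_sum (P := P) (index_iota 1 (T k).+1) fi.
have iA4 : P.-integrable setT (EFin \o (fun w => 4 / 3 * A w)).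
  exact: (integrableZl measurableT (4 / 3) iA).
have boundE : bound = (fun w => \sum_(t <- index_iota 1 (T k).+1) f t w + 4 / 3 * A w).
  apply/funext => w; rewrite /bound; congr (_ + _).
  rewrite big_nat_cond [RHS]big_nat_cond; apply: eq_bigr => t; rewrite andbT ltnS => tT.
  by rewrite /f tT.
have ib : P.-integrable setT (EFin \o bound).
  by rewrite boundE; exact: (integrableD measurableT iS iA4).
have Phi0 w : 0 <= Phi w by exact: (end_gap_ge0 Hdc _ _ mu0 (ltW g0)).
have iPhi : P.-integrable setT (EFin \o Phi).
  apply: (integrable_dominated mPhi (integrableZl measurableT ((T k)%:R * ((T k)%:R + 3) / 2)^-1 ib)) => w.
  by rewrite ger0_norm// ler_pdivlMl.
split => //.
have icP : P.-integrable setT (EFin \o (fun w => (T k)%:R * ((T k)%:R + 3) / 2 * Phi w)).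
  exact: (integrableZl measurableT _ iPhi).
have := le_Rintegral measurableT icP ib (fun w _ => Phi_le w).
rewrite (RintegralZl _ measurableT iPhi) boundE (RintegralD measurableT iS iA4) ES.
rewrite (RintegralZl _ measurableT iA).
have EA0 : 0 <= \int[P]_w A w.
  by apply: Rintegral_ge0 => w _; exact: (start_gap_ge0 Hdc _ mu0 (ltW g0)).
have : \sum_(t <- index_iota 1 (T k).+1) \int[P]_w f t w <= (T k)%:R * (3 / gamma k * (4 * G0 ^+ 2)).
  apply: le_trans (ler_sum _ (fun t _ => fE t)) _.
  by rewrite big_const_nat subn1 iter_addr_0 [leRHS]mulr_natl.
move: EA0; set EA := \int[P]_w A w; set EP := \int[P]_w Phi w.
set sm := \sum_(t <- _) _ => EA0 hsm hle.
have k0 : 0 < (k%:R : R) by rewrite ltr0n.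
have h1 : EP <= (T k)%:R * (3 / gamma k * (4 * G0 ^+ 2)) / ((T k)%:R * ((T k)%:R + 3) / 2)
    + 4 / 3 * EA / ((T k)%:R * ((T k)%:R + 3) / 2).
  rewrite -mulrDl ler_pdivlMr// mulrC; lra.
apply: le_trans h1 _; rewrite addrC; apply: lerD.
  rewrite ler_pdivrMr//.
  have : 9 <= (T k)%:R * ((T k)%:R + 3) / 2 :> R by move: T3'; nra.
  move: EA0; nra.
have T0' : 0 < ((T k)%:R : R) by lra.
have -> : (T k)%:R * (3 / gamma k * (4 * G0 ^+ 2)) / ((T k)%:R * ((T k)%:R + 3) / 2) =
   24%:R * G0 ^+ 2 / (gamma k * ((T k)%:R + 3)).
  by field; rewrite !gt_eqF//; lra.
have -> : 8 * G0 ^+ 2 / L / k%:R = 24%:R * G0 ^+ 2 / (3 * L * k%:R).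
  by field; rewrite !gt_eqF.
have G00 := sqr_ge0 G0.
apply: ler_wpM2l; first by rewrite mulr_ge0.
rewrite lef_pV2 ?posrE; last 2 first.
- by rewrite mulr_gt0// addr_gt0.
- by rewrite !mulr_gt0.
by rewrite mulrDr (le_trans Tk)// lerDl mulr_ge0// ltW.
Qed.

End Stage.

Lemma spg_near_stationary (eps Delta Cs CK M0 CQ : R) :
  (forall k, 0 <= gamma k) -> (forall k, (1 <= k)%N -> (3 <= T k)%N) ->
  (forall k, (1 <= k)%N -> 3 * L * k%:R <= gamma k * (T k)%:R) ->
  1 <= al -> 0 < Delta -> 0 < eps -> eps < 1 -> mu <= eps -> (0 < K)%N ->
  (forall k, (1 <= k <= K)%N -> (\int[P]_w (smoothed_objective g h r mu (x k w) -
     ereal_inf (range (smoothed_objective g h r mu))) <= Delta%:E)%E) ->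
  0 <= Cs -> 0 <= CK -> 0 <= M0 -> 0 <= CQ ->
  (forall k, (1 <= k <= K)%N -> gamma k + mu^-1 <= Cs / mu) ->
  K%:R^-1 <= CK * (mu * eps `^ (2 * nu)) ->
  (forall y, enorm (y - p mu y) <= M0 * mu) \/
    (mu = eps ^+ 2 /\ Num.sqrt K%:R <= CQ / eps ^+ 2) ->
  near_stationary P g h r (p mu) nu eps
    (rate_const L al Delta (8 * G0 ^+ 2 / L) Cs CK (enorm (grad h x1 - grad g x1)) M0 CQ) tau x.
Proof.
move=> gamma_ge0 T3 Tk al1 Delta0 eps0 eps1 mueps K0 hDelta Cs0 CK0 M00 CQ0 sigma_le K_ge alt.
have path := spg_traj run.
have [m [infE hm _]] : exists m, [/\ ereal_inf (range (smoothed_objective g h r mu)) = m%:E,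
    forall y, m <= @smoothed_real R d g h r p mu y &
    @smoothed_real R d g h r p mu x1 - m <= Delta].
  apply: (smoothed_inf_real Hdc mu0); have := hDelta 1%N ltac:(by rewrite K0).
  have -> : (fun w => smoothed_objective g h r mu (x 1%N w) -
     ereal_inf (range (smoothed_objective g h r mu)))%E =
     cst (smoothed_objective g h r mu x1 - ereal_inf (range (smoothed_objective g h r mu)))%E.
    by apply/funext => w; rewrite (spg_init (path w)).
  by rewrite integral_prob_cst.
pose G : set (set Om) := spg_history predT.
have Gm : <<s G>> `<=` measurable by exact: spg_history_measurable.
have indG A B' : <<s G>> A -> (P (A `&` tau @^-1` B') = P A * P (tau @^-1` B'))%E.
  move=> sA; apply: (spg_history_independent (j := inr tt) _ _ sA) => //.
    by rewrite mem_spg_samples.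
  by exists B' => //; rewrite setTI.
have mx k : (1 <= k <= K.+1)%N ->
    measurable_fun setT (x k : g_sigma_algebraType G -> borelV R d).
  by move=> kK; exact: spg_point_measurable.
apply: (near_stationary_stages Hdc al1 K0 (spg_tau_law run) Gm indG eps0 eps1 mu0 mueps gamma_ge0
  (fun w => spg_init (path w)) hm) => //.
- move=> k /andP[k1 kK]; apply: (measurable_start_gap Hdc mp mu0 (gamma_ge0 k)).
  by apply: mx; rewrite k1 ltnW.
- move=> k /andP[k1 kK]; apply: (measurable_end_gap Hdc mp mu0 (gamma_ge0 k)).
    by apply: mx; rewrite k1 ltnW.
  by apply: mx; rewrite ltnS.
- move=> k kK; apply: measurable_funB => //.
  exact: (measurableT_comp (measurable_smoothed_real Hdc mu0) (mx k kK)).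
- move=> k kK iA; have k1 : (1 <= k)%N by case/andP: kK.
  exact: (spg_stage_mean kK iA (T3 k k1) (Tk k k1)).
- move=> k kK; apply: le_trans (hDelta k kK); apply: le_of_eq.
  by apply: eq_integral => w _; rewrite infE (smoothed_objectiveE Hdc)// EFinB.
- exact: ltW.
- by rewrite divr_ge0 ?(ltW L0)// mulr_ge0// sqr_ge0.
Qed.

End SpgRun.

(** * Choice of the parameters *)

Section StageCount.
Context {R : realType}.

Lemma le_ceiln (a : R) : 0 <= a -> a <= (ceiln a)%:R.
Proof.
move=> a0; rewrite /ceiln natr_absz ger0_norm ?Num.Theory.ceil_ge//.
by rewrite Num.Theory.ceil_ge0; apply: lt_le_trans a0; rewrite ltrN10.
Qed.

Lemma ceiln_le (a : R) : 0 <= a -> (ceiln a)%:R <= a + 1.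
Proof.
move=> a0; rewrite /ceiln natr_absz ger0_norm; last first.
  by rewrite Num.Theory.ceil_ge0; apply: lt_le_trans a0; rewrite ltrN10.
by have := Num.Theory.ceilB1_lt a; rewrite intrB; lra.
Qed.

Variables (C c e1 e2 eps : R).
Hypotheses (C0 : 0 < C) (c0 : 0 < c) (e10 : 0 < e1) (e2_01 : 0 < e2 <= 1)
  (eps0 : 0 < eps) (eps1 : eps < 1).
Local Notation K := (ceiln (C * (1 / eps `^ e1))).

Let q := eps `^ e1.
Let q0 : 0 < q. Proof. exact: powR_gt0. Qed.
Let q1 : q <= 1.
Proof. by rewrite /q -(powRr0 eps) ger_powR ?eps0 ?ltW. Qed.
Let Cq0 : 0 < C * (1 / q). Proof. by rewrite mulr_gt0// divr_gt0. Qed.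

Lemma stage_count_ge : C / eps `^ e1 <= K%:R.
Proof. by apply: le_trans (le_ceiln (ltW Cq0)); rewrite mul1r. Qed.

Lemma stage_count_gt0 : (0 < K)%N.
Proof. by rewrite -(ltr_nat R); apply: lt_le_trans stage_count_ge; rewrite divr_gt0. Qed.

Lemma stage_count_le : K%:R <= (C + 1) / eps `^ e1.
Proof.
apply: le_trans (ceiln_le (ltW Cq0)) _; rewrite -/q div1r mulrDl lerD2l mul1r.
by rewrite invf_ge1.
Qed.

Lemma stage_count_powR_le (a : R) : 0 <= a ->
  K%:R `^ a <= (C + 1) `^ a / eps `^ (e1 * a).
Proof.
move=> a0.
have -> : (C + 1) `^ a / eps `^ (e1 * a) = ((C + 1) / eps `^ e1) `^ a.
  rewrite powRM ?invr_ge0 ?ltW//; last by rewrite ltr_wpDr.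
  by congr (_ * _); rewrite -!powRN -powRrM mulNr.
rewrite ge0_ler_powR ?nnegrE ?ler0n//; last exact: stage_count_le.
by apply: le_trans stage_count_le.
Qed.

Lemma stage_count_inv_le (nu : R) : e1 = e1 * e2 + 2 * nu ->
  K%:R^-1 <= C^-1 * (eps `^ (e1 * e2) * eps `^ (2 * nu)).
Proof.
move=> e1E; rewrite -powRD ?(gt_eqF eps0) ?implybT// -e1E.
rewrite -[leRHS]invrK lef_pV2 ?posrE ?ltr0n ?stage_count_gt0//; last first.
  by rewrite invr_gt0 mulr_gt0 ?invr_gt0.
by rewrite invfM invrK; exact: stage_count_ge.
Qed.

Lemma stage_modulus_le k : (k <= K)%N ->
  c * k%:R `^ e2 + (eps `^ (e1 * e2))^-1 <= (c * (C + 1) + 1) / eps `^ (e1 * e2).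
Proof.
move=> kK; have /andP[e20 e21] := e2_01.
rewrite [leRHS]mulrDl mul1r lerD2r -mulrA ler_pM2l//.
have h1 : k%:R `^ e2 <= K%:R `^ e2.
  by rewrite ge0_ler_powR ?nnegrE ?ler0n ?ler_nat// ltW.
apply: le_trans h1 _; apply: le_trans (stage_count_powR_le (ltW e20)) _.
rewrite ler_pM2r ?invr_gt0 ?powR_gt0//.
rewrite -[leRHS](powRr1 (a := C + 1)); last by rewrite addr_ge0// ltW.
by rewrite ler_powR// lerDr ltW.
Qed.

Lemma stage_count_sqrt_le : e1 <= 4 -> Num.sqrt K%:R <= (C + 1) / eps ^+ 2.
Proof.
move=> e14; have C10 : 0 <= (C + 1) / eps ^+ 2.
  by rewrite divr_ge0 ?sqr_ge0// addr_ge0// ltW.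
rewrite -[leRHS]ger0_norm// -sqrtr_sqr; apply: ler_wsqrtr.
apply: le_trans stage_count_le _; rewrite expr_div_n -exprM.
have -> : (2 * 2 = 4)%N by [].
rewrite -(powR_mulrn 4 (ltW eps0)); apply: ler_pM.
- by rewrite addr_ge0// ltW.
- by rewrite invr_ge0 ltW.
- by rewrite expr2 ler_peMr ?lerDr ?addr_ge0 ?ltW.
- by rewrite lef_pV2 ?posrE ?powR_gt0// ger_powR// eps0 ltW.
Qed.

Lemma sum_stage_le (t : nat -> R) (M a : R) : 0 <= M -> 0 <= a ->
  (forall k, (1 <= k)%N -> t k <= M * k%:R `^ a) ->
  \sum_(1 <= k < K.+1) t k <= M * (C + 1) `^ (1 + a) * (1 / eps `^ (e1 * (1 + a))).
Proof.
move=> M0 a0 tM.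
apply: le_trans (_ : \sum_(1 <= k < K.+1) M * K%:R `^ a <= _).
  rewrite big_nat_cond [leRHS]big_nat_cond; apply: ler_sum => k; rewrite andbT ltnS => /andP[k1 kK].
  apply: le_trans (tM k k1) _; rewrite ler_wpM2l// ge0_ler_powR// ?nnegrE ?ler0n ?ler_nat//.
rewrite big_const_nat subn1 iter_addr_0 -[leLHS]mulr_natr -mulrA -[in leRHS]mulrA ler_wpM2l//.
rewrite -[X in _ * X <= _](powRr1 (a := K%:R))// -powRD; last first.
  by apply/implyP => _; rewrite gt_eqF// ltr0n stage_count_gt0.
by rewrite [a + 1]addrC [X in _ <= _ * X]mul1r; apply: stage_count_powR_le; rewrite addr_ge0.
Qed.

Lemma up_log_stage_le : (up_log 2 K)%:R <= (1 + (ln (C + 1) + e1) / ln 2) * (1 + ln (1 / eps)) :> R.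
Proof.
have l2 : 0 < ln (2 : R) by rewrite ln_gt0// ltr1n.
have le0 : 0 <= ln (1 / eps) by rewrite ln_ge0// div1r invf_ge1// ltW.
have lC : 0 <= ln (C + 1) by rewrite ln_ge0// lerDr ltW.
have rhs1 : 1 <= (1 + (ln (C + 1) + e1) / ln 2) * (1 + ln (1 / eps)).
  apply: mulr_ege1; rewrite lerDl//; apply: divr_ge0; last exact: ltW.
  by rewrite addr_ge0// ltW.
have [K1|K1] := leqP K 1.
  have : (up_log 2 K <= 1)%N by rewrite (leq_trans (leq_up_log 2 K1)).
  by rewrite -(ler_nat R) => h; exact: le_trans h rhs1.
have := up_log_gtn (ltnSn 1) K1; set n := up_log 2 K => hn.
have hln : n.-1%:R * ln 2 <= ln (C + 1) + e1 * ln (1 / eps) :> R.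
  have Cp : 0 < C + 1 by rewrite ltr_wpDr.
  have pe : 0 < (1 / eps) `^ e1 by rewrite powR_gt0// divr_gt0.
  rewrite mulr_natl -lnXn// -ln_powR -lnM ?posrE// ler_ln ?posrE ?exprn_gt0 ?mulr_gt0//.
  rewrite -natrX; apply: le_trans (_ : K%:R <= _); first by rewrite ler_nat ltnW.
  by apply: le_trans stage_count_le _; rewrite div1r -(powR_inv1 (ltW eps0)) -powRrM mulN1r powRN.
apply: le_trans (_ : 1 + n.-1%:R <= _).
  by rewrite addrC natr1 ler_nat leqSpred.
have hn' : n.-1%:R <= (ln (C + 1) + e1 * ln (1 / eps)) / ln 2 by rewrite ler_pdivlMr.
apply: le_trans (_ : 1 + (ln (C + 1) + e1 * ln (1 / eps)) / ln 2 <= _); first by rewrite lerD2l.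
rewrite [leRHS]mulrDl [X in _ <= X + _]mul1r; apply: lerD; first by rewrite lerDl.
rewrite [leRHS]mulrAC ler_pM2r ?invr_gt0// [leRHS]mulrDl; apply: lerD.
  by rewrite ler_peMr// lerDl.
by rewrite ler_pM2l// lerDr.
Qed.

End StageCount.

Lemma near_stationary_le {R : realType} {d : nat} {dO} {Om : measurableType dO} (P : probability Om R)
    (g h : 'rV[R]_d -> R) r prox (nu eps M M' : R) tau x : 0 < eps -> M <= M' ->
  near_stationary P g h r prox nu eps M tau x -> near_stationary P g h r prox nu eps M' tau x.
Proof.
move=> eps0 MM' [h1 h2]; split.
  by apply: le_trans h1 _; rewrite lee_fin ler_wpM2r// ltW.
by apply: le_trans h2 _; rewrite lee_fin ler_wpM2r// powR_ge0.
Qed.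

Section PolynomialStages.
Context {R : realType} {d : nat}.
Local Notation V := 'rV[R]_d.
Context {L nu : R} {g h : V -> R} {r : V -> \bar R} {p : R -> V -> V}.
Hypothesis Hdc : dc_problem L nu g h r p.
Variables (al C Delta : R) (x1 : V).
Hypotheses (al1 : 1 <= al) (C0 : 0 < C) (Delta0 : 0 < Delta).
Variables (e1 e2 M0 CQ : R).
Hypotheses (e2_01 : 0 < e2 <= 1) (e12 : 1 <= e1 * e2) (e1E : e1 = e1 * e2 + 2 * nu)
  (M00 : 0 <= M0) (CQ0 : 0 <= CQ).
Local Notation mu eps := (eps `^ (e1 * e2)).
Local Notation K eps := (ceiln (C * (1 / eps `^ e1))).
Hypothesis alt : forall eps : R, 0 < eps -> eps < 1 ->
  (forall y, enorm (y - p (mu eps) y) <= M0 * mu eps) \/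
  (mu eps = eps ^+ 2 /\ Num.sqrt (K eps)%:R <= CQ / eps ^+ 2).

Let e20 : 0 < e2. Proof. by case/andP: e2_01. Qed.
Let e21 : e2 <= 1. Proof. by case/andP: e2_01. Qed.
Let e10 : 0 < e1. Proof. by rewrite -(pmulr_lgt0 _ e20); apply: lt_le_trans e12. Qed.
Let L0 : 0 < L. Proof. exact: dc_L_gt0 Hdc. Qed.

Let mu_le eps : 0 < eps -> eps < 1 -> mu eps <= eps.
Proof. by move=> p0 p1; rewrite -[leRHS](powRr1 (ltW p0)) ger_powR// p0 ltW. Qed.

Let natr_powR_ge1 k : (1 <= k)%N -> 1 <= k%:R `^ e2 :> R.
Proof.
move=> k1; apply: le_trans (_ : 1 `^ e2 <= _); first by rewrite powR1.
by rewrite ge0_ler_powR ?nnegrE ?ler0n ?ler1n// ltW.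
Qed.

Section Spg.
Context {d1 d2 : measure_display} {T1 : measurableType d1} {T2 : measurableType d2}
  {P1 : probability T1 R} {P2 : probability T2 R}.
Context {gs : V -> T1 -> R} {hs : V -> T2 -> R} {dg : V -> T1 -> V} {dh : V -> T2 -> V} {G0 : R}.
Hypotheses (orc : stochastic_oracles P1 P2 g h gs hs dg dh) (var : variance_bound P1 P2 dg dh G0).
Hypothesis mp : forall mu : R, 0 < mu -> measurable_fun setT (p mu : borelV R d -> borelV R d).

Lemma spg_rate : exists M : R, forall eps : R, 0 < eps -> eps < 1 ->
  let gamma (k : nat) := 3 * L * k%:R `^ e2 in
  let T (k : nat) := ceiln (3 * L * k%:R / gamma k + 3) in
  (forall (dO : measure_display) (Om : measurableType dO) (P : probability Om R)
     (xi : nat -> nat -> Om -> T1) (zeta : nat -> nat -> Om -> T2)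
     (tau : Om -> nat) (x : nat -> Om -> 'rV[R]_d) (y : nat -> nat -> Om -> 'rV[R]_d),
   spg_run P P1 P2 dg dh (p (mu eps)) (mu eps) al gamma T (K eps) x1 xi zeta tau x y ->
   (forall k, (1 <= k <= K eps)%N ->
      (\int[P]_w (smoothed_objective g h r (mu eps) (x k w) -
         ereal_inf (range (smoothed_objective g h r (mu eps)))) <= Delta%:E)%E) ->
   near_stationary P g h r (p (mu eps)) nu eps M tau x) /\
  \sum_(1 <= k < (K eps).+1) (T k)%:R <= M * (1 / eps `^ (e1 * (2 - e2))).
Proof.
have c0 : 0 < 3 * L by rewrite mulr_gt0.
pose Mn := rate_const L al Delta (8 * G0 ^+ 2 / L) (3 * L * (C + 1) + 1) C^-1
  (enorm (grad h x1 - grad g x1)) M0 CQ.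
pose Mc := 5%:R * (C + 1) `^ (2 - e2).
exists (Num.max Mn Mc) => eps p0 p1 gamma T.
have g_ge0 k : 0 <= gamma k by rewrite mulr_ge0 ?powR_ge0// ltW.
have gL k : (1 <= k)%N -> 3 * L <= gamma k by move=> k1; rewrite ler_peMr ?(ltW c0)// natr_powR_ge1.
have ratio k : (1 <= k)%N -> 3 * L * k%:R / gamma k = k%:R `^ (1 - e2).
  move=> k1; have k0 : 0 < (k%:R : R) by rewrite ltr0n.
  rewrite powRD ?(gt_eqF k0) ?implybT// powRr1 ?(ltW k0)// powRN /gamma.
  by field; rewrite !gt_eqF ?powR_gt0.
have arg_ge0 k : 0 <= 3 * L * k%:R / gamma k by rewrite divr_ge0// mulr_ge0// ltW.
have T_ge k : 3 * L * k%:R / gamma k + 3 <= (T k)%:R by apply: le_ceiln; rewrite addr_ge0.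
have T3 k : (1 <= k)%N -> (3 <= T k)%N.
  by move=> k1; rewrite -(ler_nat R); apply: le_trans (T_ge k); rewrite lerDr.
have Tk k : (1 <= k)%N -> 3 * L * k%:R <= gamma k * (T k)%:R.
  move=> k1; have gk0 : 0 < gamma k by apply: lt_le_trans (gL k k1).
  rewrite [leRHS]mulrC -ler_pdivrMr//; apply: le_trans (T_ge k); by rewrite lerDl.
have muE0 : 0 < mu eps by exact: powR_gt0.
split.
  move=> dO Om P xi zeta tau x y run hD.
  apply: (@near_stationary_le _ _ _ _ _ _ _ _ _ _ _ Mn) => //; first by rewrite le_max lexx.
  apply: (spg_near_stationary Hdc orc var mp muE0 gL run g_ge0 T3 Tk al1 Delta0 p0 p1 (mu_le p0 p1)
    (stage_count_gt0 _ C0 p0) hD) => //.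
  - by rewrite addr_ge0// mulr_ge0 ?(ltW c0)// addr_ge0// ltW.
  - by rewrite invr_ge0 ltW.
  - by move=> k /andP[_ kK]; exact: stage_modulus_le.
  - exact: stage_count_inv_le.
  - exact: alt.
have -> : 2 - e2 = 1 + (1 - e2) by ring.
apply: le_trans (_ : Mc * (1 / eps `^ (e1 * (1 + (1 - e2)))) <= _); last first.
  by rewrite ler_wpM2r ?le_max ?lexx ?orbT// divr_ge0// powR_ge0.
have -> : Mc = 5%:R * (C + 1) `^ (1 + (1 - e2)) by rewrite /Mc; congr (_ * _ `^ _); ring.
apply: sum_stage_le => //; first by rewrite subr_ge0.
move=> k k1; apply: le_trans (ceiln_le _) _; first by rewrite addr_ge0.
rewrite ratio//.
have : 1 <= (k%:R : R) `^ (1 - e2).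
  apply: le_trans (_ : 1 `^ (1 - e2) <= _); first by rewrite powR1.
  by rewrite ge0_ler_powR ?nnegrE ?ler0n ?ler1n// subr_ge0.
move: (_ `^ _) => u; lra.
Qed.

End Spg.

Lemma svrg_rate (c CT : R) : 0 < c ->
  let gamma (k : nat) := c * k%:R `^ e2 in
  exists (Mc : R) (j : nat), forall (n1 n2 : nat)
      (gi : 'I_n1 -> 'rV[R]_d -> R) (T : nat -> nat),
    is_mean gi g -> (forall i, smooth L (gi i)) ->
    (forall k, (1 <= k)%N -> Num.max 2 (200%:R * L / gamma k) <= (T k)%:R) ->
    exists M : R, forall eps : R, 0 < eps -> eps < 1 ->
      (forall (dO : measure_display) (Om : measurableType dO) (P : probability Om R)
         (i : nat -> nat -> nat -> Om -> 'I_n1) (tau : Om -> nat)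
         (x : nat -> Om -> 'rV[R]_d) (xb : nat -> nat -> Om -> 'rV[R]_d)
         (xs : nat -> nat -> nat -> Om -> 'rV[R]_d),
       svrg_run P L gi g h (p (mu eps)) (mu eps) al gamma T (fun k => up_log 2 k) (K eps) x1
         i tau x xb xs ->
       (smoothed_objective g h r (mu eps) x1 -
          ereal_inf (range (smoothed_objective g h r (mu eps))) <= Delta%:E)%E ->
       near_stationary P g h r (p (mu eps)) nu eps M tau x) /\
      ((forall k, (1 <= k)%N -> (T k)%:R <= CT * Num.max 2 (200%:R * L / gamma k)) ->
       \sum_(1 <= k < (K eps).+1) ((n1 + n2 + T k) * up_log 2 k)%:R
         <= Mc * ((n1 + n2)%:R / eps `^ e1) * (1 + ln (1 / eps)) ^+ j).
Proof.
move=> c0 gamma.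
pose t0 := `|CT| * Num.max 2 (200%:R * L / c).
pose lc := 1 + (ln (C + 1) + e1) / ln 2.
have m20 (a : R) : 0 <= Num.max 2 a by rewrite le_max ler0n.
have t00 : 0 <= t0 by rewrite mulr_ge0.
have g_ge0 k : 0 <= gamma k by rewrite mulr_ge0 ?powR_ge0// ltW.
have g_ge k : (1 <= k)%N -> c <= gamma k by move=> k1; rewrite ler_peMr ?(ltW c0)// natr_powR_ge1.
have g_gt0 k : (1 <= k)%N -> 0 < gamma k by move=> k1; apply: lt_le_trans (g_ge k k1).
have g_large : exists k0, forall k, (k0 <= k)%N -> 64%:R * L <= gamma k.
  exists (ceiln ((64%:R * L / c) `^ e2^-1)) => k hk.
  have a0 : 0 <= 64%:R * L / c by rewrite divr_ge0 ?(ltW c0)// mulr_ge0// ltW.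
  rewrite /gamma [leRHS]mulrC -ler_pdivrMr//.
  have -> : 64%:R * L / c = ((64%:R * L / c) `^ e2^-1) `^ e2.
    by rewrite -powRrM mulVf ?gt_eqF// powRr1.
  rewrite ge0_ler_powR ?nnegrE ?powR_ge0 ?ler0n ?(ltW e20)//.
  by apply: le_trans (le_ceiln (powR_ge0 _ _)) _; rewrite ler_nat.
exists ((C + 1) * (1 + t0) * lc), 1%N => n1 n2 gi T [n10 _] sgi hT.
have T0 k : (1 <= k)%N -> (0 < T k)%N.
  move=> k1; rewrite -(ltr_nat R); apply: lt_le_trans (hT k k1).
  by rewrite lt_max ltr0n.
have [b [B [b0 B0 main]]] := svrg_near_stationary Hdc sgi x1 g_ge0 g_gt0 g_large T0 al1 Delta0.
exists (rate_const L al b B (c * (C + 1) + 1) C^-1 (enorm (grad h x1 - grad g x1)) M0 CQ) => eps p0 p1.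
split.
  move=> dO Om P i tau x xb xs run hD.
  apply: (main eps (mu eps) (K eps) _ _ _ _ _ _ _ _ _ _ _ _ p0 p1 (powR_gt0 _ p0) (mu_le p0 p1)
    (stage_count_gt0 _ C0 p0) run hD) => //.
  - by rewrite addr_ge0// mulr_ge0 ?(ltW c0)// addr_ge0// ltW.
  - by rewrite invr_ge0 ltW.
  - by move=> k /andP[_ kK]; exact: stage_modulus_le.
  - exact: stage_count_inv_le.
  - exact: alt.
move=> T_le; rewrite expr1.
have T_le' k : (1 <= k)%N -> (T k)%:R <= t0.
  move=> k1; apply: le_trans (T_le k k1) _; apply: le_trans (_ : `|CT| * Num.max 2 (200%:R * L / gamma k) <= _).
    by rewrite ler_wpM2r// ler_norm.
  rewrite ler_wpM2l// ge_max le_max lexx /= le_max; apply/orP; right.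
  by rewrite ler_wpM2l ?mulr_ge0 ?(ltW L0)// lef_pV2 ?posrE ?g_gt0 ?g_ge.
have n0 : 1 <= (n1 + n2)%:R :> R by rewrite ler1n (leq_trans n10)// leq_addr.
apply: le_trans (_ : \sum_(1 <= k < (K eps).+1)
    (n1 + n2)%:R * (1 + t0) * (up_log 2 (K eps))%:R <= _).
  rewrite big_nat_cond [leRHS]big_nat_cond; apply: ler_sum => k; rewrite andbT ltnS => /andP[k1 kK].
  rewrite natrM; apply: ler_pM => //; last by rewrite ler_nat leq_up_log.
  rewrite natrD mulrDr mulr1 lerD2l; apply: le_trans (T_le' k k1) _.
  by rewrite ler_peMl.
rewrite big_const_nat subn1 iter_addr_0 -[leLHS]mulr_natl.
have h1 := stage_count_le C0 e10 p0 p1.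
have h2 := up_log_stage_le C0 e10 p0 p1.
have h3 : (n1 + n2)%:R * (1 + t0) * (up_log 2 (K eps))%:R <=
  (n1 + n2)%:R * (1 + t0) * (lc * (1 + ln (1 / eps))).
  by apply: (ler_wpM2l _ h2); rewrite mulr_ge0// addr_ge0.
have h4 : 0 <= (n1 + n2)%:R * (1 + t0) * (up_log 2 (K eps))%:R :> R.
  by rewrite !mulr_ge0// addr_ge0.
apply: le_trans (ler_pM (ler0n _ _) h4 h1 h3) _.
by apply: le_of_eq; rewrite /lc; ring.
Qed.

End PolynomialStages.

Unset Implicit Arguments.

Theorem theorem15 (R : realType) (d : nat) (L nu alpha C Delta : R)
    (g h : 'rV[R]_d -> R) (r : 'rV[R]_d -> \bar R)
    (p : R -> 'rV[R]_d -> 'rV[R]_d) (x1 : 'rV[R]_d)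
    (Hdc : dc_problem L nu g h r p) (Halpha : 1 <= alpha)
    (HC : 0 < C) (HDelta : 0 < Delta) :
  let F mu := smoothed_objective g h r mu in
  let S (k : nat) : nat := up_log 2 k in (* ceil (log2 k) for 0 < k *)
  [/\ (* (a) *)
    reg_R1 r ->
    forall (d1 d2 : measure_display) (T1 : measurableType d1) (T2 : measurableType d2)
      (P1 : probability T1 R) (P2 : probability T2 R)
      (gs : 'rV[R]_d -> T1 -> R) (hs : 'rV[R]_d -> T2 -> R)
      (dg : 'rV[R]_d -> T1 -> 'rV[R]_d) (dh : 'rV[R]_d -> T2 -> 'rV[R]_d) (G : R),
    stochastic_oracles P1 P2 g h gs hs dg dh ->
    0 < G -> variance_bound P1 P2 dg dh G ->
    (forall mu : R, 0 < mu -> measurable_fun setT (p mu : borelV R d -> borelV R d)) ->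
    exists M : R, forall eps : R, 0 < eps < 1 ->
      let mu := eps in
      let gamma (k : nat) := 3 * L * k%:R `^ (1 / (1 + 2 * nu)) in
      let T (k : nat) := ceiln (3 * L * k%:R / gamma k + 3) in
      let K := ceiln (C * (1 / eps `^ (1 + 2 * nu))) in
      (forall (dO : measure_display) (Om : measurableType dO) (P : probability Om R)
         (xi : nat -> nat -> Om -> T1) (zeta : nat -> nat -> Om -> T2)
         (tau : Om -> nat) (x : nat -> Om -> 'rV[R]_d) (y : nat -> nat -> Om -> 'rV[R]_d),
       spg_run P P1 P2 dg dh (p mu) mu alpha gamma T K x1 xi zeta tau x y ->
       (forall k, (1 <= k <= K)%N ->
          (\int[P]_w (F mu (x k w) - ereal_inf (range (F mu))) <= Delta%:E)%E) ->
       near_stationary P g h r (p mu) nu eps M tau x) /\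
      \sum_(1 <= k < K.+1) (T k)%:R <= M * (1 / eps `^ (1 + 4 * nu)),
    (* (b) *)
    reg_R2 r ->
    forall (d1 d2 : measure_display) (T1 : measurableType d1) (T2 : measurableType d2)
      (P1 : probability T1 R) (P2 : probability T2 R)
      (gs : 'rV[R]_d -> T1 -> R) (hs : 'rV[R]_d -> T2 -> R)
      (dg : 'rV[R]_d -> T1 -> 'rV[R]_d) (dh : 'rV[R]_d -> T2 -> 'rV[R]_d) (G : R),
    stochastic_oracles P1 P2 g h gs hs dg dh ->
    0 < G -> variance_bound P1 P2 dg dh G ->
    (forall mu : R, 0 < mu -> measurable_fun setT (p mu : borelV R d -> borelV R d)) ->
    exists M : R, forall eps : R, 0 < eps < 1 ->
      let mu := eps ^+ 2 in
      let gamma (k : nat) := 3 * L * k%:R `^ (1 / (1 + nu)) in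
      let T (k : nat) := ceiln (3 * L * k%:R / gamma k + 3) in
      let K := ceiln (C * (1 / eps `^ (2 * (1 + nu)))) in
      (forall (dO : measure_display) (Om : measurableType dO) (P : probability Om R)
         (xi : nat -> nat -> Om -> T1) (zeta : nat -> nat -> Om -> T2)
         (tau : Om -> nat) (x : nat -> Om -> 'rV[R]_d) (y : nat -> nat -> Om -> 'rV[R]_d),
       spg_run P P1 P2 dg dh (p mu) mu alpha gamma T K x1 xi zeta tau x y ->
       (forall k, (1 <= k <= K)%N ->
          (\int[P]_w (F mu (x k w) - ereal_inf (range (F mu))) <= Delta%:E)%E) ->
       near_stationary P g h r (p mu) nu eps M tau x) /\
      \sum_(1 <= k < K.+1) (T k)%:R <= M * (1 / eps `^ (2 * (1 + 2 * nu))),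
    (* (c) *)
    reg_R1 r ->
    forall c CT : R, 0 < c ->
    let gamma (k : nat) := c * k%:R `^ (1 / (1 + 2 * nu)) in
    exists (Mc : R) (j : nat), forall (n1 n2 : nat)
      (gi : 'I_n1 -> 'rV[R]_d -> R) (hj : 'I_n2 -> 'rV[R]_d -> R) (T : nat -> nat),
    is_mean gi g -> is_mean hj h -> (forall i, smooth L (gi i)) ->
    (forall k, (1 <= k)%N -> Num.max 2 (200%:R * L / gamma k) <= (T k)%:R) ->
    exists M : R, forall eps : R, 0 < eps < 1 ->
      let mu := eps in
      let K := ceiln (C * (1 / eps `^ (1 + 2 * nu))) in
      (forall (dO : measure_display) (Om : measurableType dO) (P : probability Om R)
         (i : nat -> nat -> nat -> Om -> 'I_n1) (tau : Om -> nat)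
         (x : nat -> Om -> 'rV[R]_d) (xb : nat -> nat -> Om -> 'rV[R]_d)
         (xs : nat -> nat -> nat -> Om -> 'rV[R]_d),
       svrg_run P L gi g h (p mu) mu alpha gamma T S K x1 i tau x xb xs ->
       (F mu x1 - ereal_inf (range (F mu)) <= Delta%:E)%E ->
       near_stationary P g h r (p mu) nu eps M tau x) /\
      ((forall k, (1 <= k)%N -> (T k)%:R <= CT * Num.max 2 (200%:R * L / gamma k)) ->
       \sum_(1 <= k < K.+1) ((n1 + n2 + T k) * S k)%:R
         <= Mc * ((n1 + n2)%:R / eps `^ (1 + 2 * nu)) * (1 + ln (1 / eps)) ^+ j)
  & (* (d) *)
    reg_R2 r \/ reg_R3 g h r ->
    forall c CT : R, 0 < c ->
    let gamma (k : nat) := c * k%:R `^ (1 / (1 + nu)) in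
    exists (Mc : R) (j : nat), forall (n1 n2 : nat)
      (gi : 'I_n1 -> 'rV[R]_d -> R) (hj : 'I_n2 -> 'rV[R]_d -> R) (T : nat -> nat),
    is_mean gi g -> is_mean hj h -> (forall i, smooth L (gi i)) ->
    (forall k, (1 <= k)%N -> Num.max 2 (200%:R * L / gamma k) <= (T k)%:R) ->
    exists M : R, forall eps : R, 0 < eps < 1 ->
      let mu := eps ^+ 2 in
      let K := ceiln (C * (1 / eps `^ (2 * (1 + nu)))) in
      (forall (dO : measure_display) (Om : measurableType dO) (P : probability Om R)
         (i : nat -> nat -> nat -> Om -> 'I_n1) (tau : Om -> nat)
         (x : nat -> Om -> 'rV[R]_d) (xb : nat -> nat -> Om -> 'rV[R]_d)
         (xs : nat -> nat -> nat -> Om -> 'rV[R]_d),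
       svrg_run P L gi g h (p mu) mu alpha gamma T S K x1 i tau x xb xs ->
       (F mu x1 - ereal_inf (range (F mu)) <= Delta%:E)%E ->
       near_stationary P g h r (p mu) nu eps M tau x) /\
      ((forall k, (1 <= k)%N -> (T k)%:R <= CT * Num.max 2 (200%:R * L / gamma k)) ->
       \sum_(1 <= k < K.+1) ((n1 + n2 + T k) * S k)%:R
         <= Mc * ((n1 + n2)%:R / eps `^ (2 * (1 + nu))) * (1 + ln (1 / eps)) ^+ j)
  ].
Proof.
move=> F S.
have /andP[nu0 nu1] := dc_nu Hdc.
have C10 : 0 <= C + 1 by rewrite addr_ge0// ltW.
pose a1 := 1 + 2 * nu; pose a2 := 1 / a1.
have a1p : 0 < a1 by rewrite addr_gt0// mulr_gt0.
have a12 : a1 * a2 = 1 by rewrite /a2 mul1r divff// gt_eqF.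
have a2_01 : 0 < a2 <= 1.
  by rewrite /a2 div1r invr_gt0 a1p invf_le1// /a1 lerDl mulr_ge0// ltW.
have a1E : a1 = a1 * a2 + 2 * nu by rewrite a12.
have a13 : a1 * (2 - a2) = 1 + 4 * nu by rewrite mulrBr a12 /a1; ring.
have a11 : 1 <= a1 * a2 by rewrite a12.
have a_mu (eps : R) : 0 < eps -> eps `^ (a1 * a2) = eps by move=> p0; rewrite a12 powRr1// ltW.
pose b1 := 2 * (1 + nu); pose b2 := 1 / (1 + nu).
have n1p : 0 < 1 + nu by rewrite addr_gt0.
have b12 : b1 * b2 = 2 by rewrite /b1 /b2; field; rewrite gt_eqF.
have b2_01 : 0 < b2 <= 1.
  by rewrite /b2 div1r invr_gt0 n1p invf_le1// lerDl ltW.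
have b1E : b1 = b1 * b2 + 2 * nu by rewrite b12 /b1; ring.
have b13 : b1 * (2 - b2) = 2 * (1 + 2 * nu) by rewrite mulrBr b12 /b1; ring.
have b11 : 1 <= b1 * b2 by rewrite b12 ler1n.
have b1p : 0 < b1 by rewrite mulr_gt0.
have b_mu (eps : R) : 0 < eps -> eps `^ (b1 * b2) = eps ^+ 2.
  by move=> p0; rewrite b12 powR_mulrn// ltW.
have altb (eps : R) : 0 < eps -> eps < 1 ->
    (forall y, enorm (y - p (eps `^ (b1 * b2)) y) <= 0 * eps `^ (b1 * b2)) \/
    (eps `^ (b1 * b2) = eps ^+ 2 /\
     Num.sqrt (ceiln (C * (1 / eps `^ b1)))%:R <= (C + 1) / eps ^+ 2).
  move=> p0 p1; right; split; first exact: b_mu.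
  by apply: stage_count_sqrt_le => //; rewrite /b1; move: nu1; lra.
have alta : reg_R1 r -> exists2 M0 : R, 0 <= M0 & forall eps : R, 0 < eps -> eps < 1 ->
    (forall y, enorm (y - p (eps `^ (a1 * a2)) y) <= M0 * eps `^ (a1 * a2)) \/
    (eps `^ (a1 * a2) = eps ^+ 2 /\
     Num.sqrt (ceiln (C * (1 / eps `^ a1)))%:R <= 0 / eps ^+ 2).
  move=> /(prox_displacement_lipschitz Hdc)[M0 M00 hM0]; exists M0 => // eps p0 p1.
  by left => y; apply: hM0; exact: powR_gt0.
split.
- move=> /alta[M0 M00 alt] d1 d2 T1 T2 P1 P2 gs hs dg dh G orc _ var mp.
  have [M hM] := spg_rate Hdc x1 Halpha HC HDelta a2_01 a11 a1E M00 (lexx 0) alt orc var mp.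
  exists M => eps /andP[p0 p1].
  by have := hM eps p0 p1; rewrite a13 (a_mu _ p0).
- move=> _ d1 d2 T1 T2 P1 P2 gs hs dg dh G orc _ var mp.
  have [M hM] := spg_rate Hdc x1 Halpha HC HDelta b2_01 b11 b1E (lexx 0) C10 altb orc var mp.
  exists M => eps /andP[p0 p1].
  by have := hM eps p0 p1; rewrite b13 (b_mu _ p0).
- move=> /alta[M0 M00 alt] c CT c0 gamma.
  have [Mc [j hMc]] := svrg_rate Hdc x1 Halpha HC HDelta a2_01 a11 a1E M00 (lexx 0) alt CT c0.
  exists Mc, j => n1 n2 gi hj T mg _ sgi hT; have [M hM] := hMc n1 n2 gi T mg sgi hT.
  exists M => eps /andP[p0 p1].
  by have := hM eps p0 p1; rewrite (a_mu _ p0).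
- move=> _ c CT c0 gamma.
  have [Mc [j hMc]] := svrg_rate Hdc x1 Halpha HC HDelta b2_01 b11 b1E (lexx 0) C10 altb CT c0.
  exists Mc, j => n1 n2 gi hj T mg _ sgi hT; have [M hM] := hMc n1 n2 gi T mg sgi hT.
  exists M => eps /andP[p0 p1].
  by have := hM eps p0 p1; rewrite (b_mu _ p0).
Qed.
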